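(* Let $U$ be Pełczyński's universal unconditional space. Then the relation of positions of $U$ in itself, i.e. $(\mathrm{Emb}(U,U),\sim)$, and likewise the relation of complemented positions of $U$ in itself, i.e. $(\mathrm{Emb}_c(U,U),\sim)$, has complexity $E_{\max}$: each of these equivalence relations is Borel bireducible with $E_{\max}$.
   Context: Pełczyński's universal unconditional space $U$ is the (unique up to isomorphism) Banach space with a normalized unconditional basis $(u_n)_n$ such that every normalized unconditional basic sequence (in any Banach space) is equivalent to a subsequence of $(u_n)_n$. For infinite dimensional separable Banach spaces $Y,X$, $\mathcal B(Y,X)$ is the set of bounded linear operators from $Y$ to $X$, a standard Borel space for the Borel structure generated by the strong operator topology; $\mathcal B(X)=\mathcal B(X,X)$. $\mathrm{Emb}(Y,X)$ is the Borel subset of $\mathcal B(Y,X)$ of those operators that are isomorphisms onto a closed subspace of infinite codimension in $X$. $GL(X)$ is the group of automorphisms of $X$. On $\mathrm{Emb}(Y,X)$, $T\sim U'$ iff there exists $A\in GL(X)$ with $T=AU'$. $\mathcal P(X)$ is the Borel set of bounded linear projections of infinite dimensional range in $\mathcal B(X)$. $\mathrm{Emb}_c(Y,X)$ is the Borel subset of $\mathrm{Emb}(Y,X)\times\mathcal P(X)$ of pairs $(T,P)$ with $TY=PX$, and on it $(T,P)\sim(U',Q)$ iff $T\sim U'$ in $\mathrm{Emb}(Y,X)$. An equivalence relation $R$ on a standard Borel space $E$ is Borel reducible to $S$ on a standard Borel space $F$ if there is a Borel map $f:E\to F$ with $xRy\Leftrightarrow f(x)Sf(y)$ for all $x,y$;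 they are Borel bireducible if each is Borel reducible to the other. $E_{\max}$ denotes the complete analytic equivalence relation, i.e. an analytic equivalence relation on a standard Borel space to which every analytic equivalence relation on a standard Borel space is Borel reducible (unique up to Borel bireducibility). *)

(* Defs.v *)
From HB Require Import structures.
From mathcomp Require Import all_boot all_order all_algebra.
From mathcomp Require Import all_classical all_reals all_analysis.

Set Implicit Arguments.
Unset Strict Implicit.
Unset Printing Implicit Defensive.

Import Order.TTheory GRing.Theory Num.Theory.
Import numFieldNormedType.Exports.

Local Open Scope classical_set_scope.
Local Open Scope ring_scope.

(* Banach spaces are real: [completeNormedModType R] with [R : realType]. *)

Section LinearSpan.
Context {R : realType} {X : completeNormedModType R}.
Implicit Types (x : nat -> X) (Z W : set X).

Definition finite_span (n : nat) (v : 'I_n -> X) : set X :=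
  [set z | exists a : 'I_n -> R, z = \sum_(i < n) a i *: v i].

Definition closed_span x : set X :=
  closure [set z | exists n, finite_span (fun i : 'I_n => x i) z].

Definition infinite_dim W : Prop :=
  ~ exists n (v : 'I_n -> X), W `<=` finite_span v.

(* For a linear subspace W: the quotient X / W is not finitely generated. *)
Definition infinite_codim W : Prop :=
  ~ exists n (v : 'I_n -> X),
      forall z, exists2 w, W w & exists2 s, finite_span v s & z = w + s.

End LinearSpan.

Section Bases.
Context {R : realType}.

Definition lincomb {X : completeNormedModType R}
    (a : nat -> R) (x : nat -> X) : nat -> X := fun n => a n *: x n.

Section OneSpace.
Context {X : completeNormedModType R}.
Implicit Types (x : nat -> X) (Z : set X).

Definition normalized x : Prop := forall n, `|x n| = 1.

(* Schauder basis of a closed linear subspace Z of X. *)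
Definition schauder_basis_of Z x : Prop :=
  (forall n, Z (x n)) /\
  forall z, Z z -> exists! a : nat -> R, series (lincomb a x) @ \oo --> z.

Definition unconditional_basis_of Z x : Prop :=
  schauder_basis_of Z x /\
  forall z (a : nat -> R), Z z -> series (lincomb a x) @ \oo --> z ->
    forall s : nat -> nat, bijective s ->
      cvgn (series (lincomb a x \o s)).

Definition normalized_unconditional_basis x : Prop :=
  normalized x /\ unconditional_basis_of setT x.

Definition normalized_unconditional_basic x : Prop :=
  normalized x /\ unconditional_basis_of (closed_span x) x.

End OneSpace.

Definition equivalent_sequences {X Y : completeNormedModType R}
    (x : nat -> X) (y : nat -> Y) : Prop :=
  forall a : nat -> R,
    cvgn (series (lincomb a x)) <-> cvgn (series (lincomb a y)).

Definition pelczynski_universal_unconditional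
    (U : completeNormedModType R) : Prop :=
  exists u : nat -> U,
    normalized_unconditional_basis u /\
    forall (X : completeNormedModType R) (x : nat -> X),
      normalized_unconditional_basic x ->
      exists k : nat -> nat,
        {homo k : m n / (m < n)%N} /\ equivalent_sequences x (u \o k).

End Bases.

Section BoundedOperators.
Context {R : realType}.

Record bounded_op (Y X : completeNormedModType R) := BoundedOp {
  bop_val :> {linear Y -> X} ;
  bop_bounded : exists M : R, forall y, `|bop_val y| <= M * `|y| }.

Section Structures.
Variables Y X : completeNormedModType R.

HB.instance Definition _ := gen_eqMixin (bounded_op Y X).
HB.instance Definition _ := gen_choiceMixin (bounded_op Y X).

Lemma zero_op_bounded :
  exists M : R, forall y, `|(\0 : {linear Y -> X}) y| <= M * `|y|.
Proof. by exists 0 => y; rewrite normr0 mul0r. Qed.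

HB.instance Definition _ :=
  isPointed.Build (bounded_op Y X) (BoundedOp zero_op_bounded).

(* The strong operator topology is the topology of pointwise convergence. *)
Definition sot_map (T : bounded_op Y X) : {ptws Y -> X} := T : Y -> X.

Definition sot_open : set_system (bounded_op Y X) :=
  @open (initial_topology sot_map).

HB.instance Definition _ :=
  Measurable.copy (bounded_op Y X) (g_sigma_algebraType sot_open).

End Structures.

Definition GL (X : completeNormedModType R) : set (bounded_op X X) :=
  [set A | exists B : bounded_op X X, cancel A B /\ cancel B A].

Definition isomorphism_onto_range (Y X : completeNormedModType R)
    (T : bounded_op Y X) : Prop :=
  exists S : X -> Y, cancel T S /\ {within range T, continuous S}.

Definition Emb (Y X : completeNormedModType R) : set (bounded_op Y X) :=
  [set T | [/\ isomorphism_onto_range T, closed (range T)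
             & infinite_codim (range T)]].

Definition position_equiv (Y X : completeNormedModType R)
    (T T' : bounded_op Y X) : Prop :=
  exists2 A : bounded_op X X, GL A & forall y, T y = A (T' y).

Definition Proj (X : completeNormedModType R) : set (bounded_op X X) :=
  [set P | (forall x, P (P x) = P x) /\ infinite_dim (range P)].

Definition Emb_c (Y X : completeNormedModType R) :
    set (bounded_op Y X * bounded_op X X) :=
  [set TP | [/\ Emb TP.1, Proj TP.2 & range TP.1 = range TP.2]].

Definition position_equiv_c (Y X : completeNormedModType R)
    (TP TQ : bounded_op Y X * bounded_op X X) : Prop :=
  position_equiv TP.1 TQ.1.

End BoundedOperators.

(* [measurableType]s are pointed, so a standard Borel space is represented as a
   Borel subset [D] (possibly empty) of a nonempty standard Borel space [E],
   with the trace of the Borel structure of [E]; Borel maps on it are those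
   satisfying [measurable_fun D]. *)
Section BorelReducibility.
Variable R : realType.

(* [E] is isomorphic to a Polish space with its Borel sigma-algebra. *)
Definition standard_borel_type d (E : measurableType d) : Prop :=
  exists P : completePseudoMetricType R,
    [/\ hausdorff_space P, @second_countable P
      & exists f : E -> P, bijective f /\
          @measurable d E = preimage_set_system setT f <<s @open P >>].

Definition standard_borel d (E : measurableType d) (D : set E) : Prop :=
  standard_borel_type E /\ measurable D.

Definition equivalence_on (T : Type) (D : set T) (r : T -> T -> Prop) : Prop :=
  [/\ forall x, D x -> r x x,
      forall x y, D x -> D y -> r x y -> r y x
    & forall x y z, D x -> D y -> D z -> r x y -> r y z -> r x z].

Definition standard_borel_equivalence d (E : measurableType d)
    (D : set E) (r : E -> E -> Prop) : Prop :=
  standard_borel D /\ equivalence_on D r.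

(* Analytic sets: projections of Borel sets along standard Borel spaces. *)
Definition analytic d (E : measurableType d) (A : set E) : Prop :=
  exists d' (Z : measurableType d'), standard_borel_type Z /\
    exists2 B : set (E * Z), measurable B & A = fst @` B.

Definition analytic_equivalence d (E : measurableType d)
    (D : set E) (r : E -> E -> Prop) : Prop :=
  standard_borel_equivalence D r /\
  analytic [set xy : E * E | [/\ D xy.1, D xy.2 & r xy.1 xy.2]].

Definition borel_reducible d1 d2
    (E1 : measurableType d1) (D1 : set E1) (r1 : E1 -> E1 -> Prop)
    (E2 : measurableType d2) (D2 : set E2) (r2 : E2 -> E2 -> Prop) : Prop :=
  [/\ standard_borel_equivalence D1 r1, standard_borel_equivalence D2 r2
    & exists f : E1 -> E2, [/\ set_fun D1 D2 f, measurable_fun D1 f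
        & forall x y, D1 x -> D1 y -> (r1 x y <-> r2 (f x) (f y))]].

Definition borel_bireducible d1 d2
    (E1 : measurableType d1) (D1 : set E1) (r1 : E1 -> E1 -> Prop)
    (E2 : measurableType d2) (D2 : set E2) (r2 : E2 -> E2 -> Prop) : Prop :=
  borel_reducible D1 r1 D2 r2 /\ borel_reducible D2 r2 D1 r1.

Definition complete_analytic_equivalence d (F : measurableType d)
    (D : set F) (s : F -> F -> Prop) : Prop :=
  analytic_equivalence D s /\
  forall d' (E : measurableType d') (C : set E) (r : E -> E -> Prop),
    analytic_equivalence C r -> borel_reducible C r D s.

(* All complete analytic equivalence relations are Borel bireducible with one
   another, so "some" and "every" agree here; "some" also asserts existence. *)
Definition has_complexity_Emax d (E : measurableType d)
    (D : set E) (r : E -> E -> Prop) : Prop :=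
  exists d' (F : measurableType d') (C : set F) (s : F -> F -> Prop),
    complete_analytic_equivalence C s /\ borel_bireducible D r C s.

End BorelReducibility.

(* Main.v *)
(* Every analytic equivalence relation [r] is reduced to the position relation.
   By the additive tree argument of Louveau and Rosendal, [r x y] holds iff some
   [alpha] translates the tree [S x] of finite sequences of pairs (bit, integer)
   into [S y], and [S y] contains a branch over the code of [x] exactly when [r x y].
   Let [W] be a Banach space of sequences indexed by infinitely many copies of
   the nodes, whose norm measures, along each branch, blocks of nodes at scales
   tied to the initial segments of the branch.  It has an unconditional basis, so
   it is complemented in [U].  The position attached to [x] shifts copy [c] to copy
   [c + 1] on the nodes of [S x] and is the identity elsewhere; what its range
   misses is the span of [S x] in copy [0].
   - If [r x y], translations inject [S x] and [S y] into each other, and the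
     Cantor-Bernstein bijection made of these pieces yields an automorphism.
   - Conversely an automorphism embeds the missing part for [y] into the one for
     [x]; the image of the basis along the branch of [y] would have to vanish
     coordinatewise, and blocks at the scale of a long initial segment of the
     branch detect that sums of it are too small, unless [S x] has a branch over
     the code of [y], that is, unless [r y x].
   A pair of rational approximations codes the operators by a Borel set of
   Cantor space, and embeddings of infinite codimension are characterized by
   countably many estimates on a dense set. *)
Require Import Defs.
From HB Require Import structures.
From mathcomp Require Import all_boot all_order all_algebra.
From mathcomp Require Import all_classical all_reals all_analysis.
From mathcomp Require Import lra zify.

Set Implicit Arguments.
Unset Strict Implicit.
Unset Printing Implicit Defensive.

Import Order.TTheory GRing.Theory Num.Theory.
Import numFieldNormedType.Exports.

Local Open Scope classical_set_scope.
Local Open Scope ring_scope.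

(** The scale of a block codes bits only, while nodes carry bits and integers. Translating integers
    preserves scales and comparability, so it costs nothing in the norm, whereas bits are rigid:
    [width m] nodes far along a branch over $x$ have norm $2^{7m^2}$ when $m$ codes an initial
    segment of $x$, and less by a factor $2^{2m}$ when $m$ codes a sequence off $x$. The obstacle in
    the converse is that the image of a branch may spread over many incomparable nodes of $S$. Since
    blocks are chains, each block then sees essentially one image at a time, and the squared norm of
    a sum of $n$ images is $O(n^{3/2})$, that is $O(2^{12m^2})$ for $n = 2^{8m^2}$; a bounded
    inverse would require $2^{14m^2}$. Infinitely many copies let a shift absorb any set of nodes,
    so one space serves all $x$; every index map is made of five elementary pieces, which bounds the
    norms uniformly and helps to make the operators Borel in $x$. Each position has an explicit left
    inverse, hence a projection, so a single reduction treats both relations. *)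

(** * Nodes, infinite sets of indices and greedy choices *)

Definition node := seq (bool * nat).

(** Basis vectors are indexed by numbers, here the code of node [t] in copy [c]. Numbers that code
    no pair are left fixed by the maps [code_map] below. *)
Definition idx (c : nat) (t : node) : nat := pickle (c, t).

Definition comparable_nodes (s t : node) := prefix s t || prefix t s.

Definition unbounded (P : nat -> Prop) := forall b, exists2 i, (b <= i)%N & P i.

(** With weight [theta k] $= 2^{-k^2}$, a full block of unit entries has value $2^{7k^2}$. The
    quadratic exponent separates neighbouring scales by factors that grow with the scale. *)
Definition width (k : nat) : nat := 2 ^ (8 * (k * k)).

Lemma idx_inj c : injective (idx c).
Proof. by move=> s t /(pcan_inj pickleK)[]. Qed.

Lemma prefix_mkseq (T : eqType) (f : nat -> T) (s : seq T) n :
  prefix s (mkseq f n) -> s = mkseq f (size s).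
Proof.
move=> h; have hs : (size s <= n)%N by rewrite (leq_trans (size_prefix h)) ?size_mkseq.
move: h; rewrite prefixE => /eqP <-.
by rewrite size_takel ?size_mkseq// /mkseq -map_take take_iota (minn_idPl hs).
Qed.

Lemma prefix_comparable (s t u : node) :
  prefix s u -> prefix t u -> comparable_nodes s t.
Proof.
rewrite /comparable_nodes !prefixE => /eqP hs /eqP ht.
case: (leqP (size s) (size t)) => [st|/ltnW ts]; apply/orP; [left|right].
  by rewrite -{1}ht take_takel// hs.
by rewrite -{1}hs take_takel// ht.
Qed.

Lemma unbounded_list (P : nat -> Prop) : unbounded P -> forall n,
  exists D : seq nat, [/\ uniq D, size D = n & forall i, i \in D -> P i].
Proof.
move=> Pinf; elim=> [|n [D [uD sD PD]]]; first by exists [::].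
have [i bi Pi] := Pinf (\max_(j <- D) j).+1.
exists (i :: D); split=> /=; rewrite ?sD//.
  rewrite uD andbT; apply: contraTN bi => iD; rewrite -leqNgt.
  by rewrite (big_rem i)//= leq_maxl.
by move=> j; rewrite inE => /orP[/eqP->//|/PD].
Qed.

(** Each term is chosen against the list of all earlier ones, which yields relations between all
    pairs and not only between successive terms. *)
Lemma greedy_sequence (P : nat -> Prop) (r : nat -> nat -> Prop) :
  (forall l : seq nat, (forall a, a \in l -> P a) ->
     exists i, [/\ P i, (forall a, a \in l -> (a < i)%N)
       & forall a, a \in l -> r a i]) ->
  exists u : nat -> nat, [/\ {homo u : m n / (m < n)%N}, forall n, P (u n)
    & forall m n, (m < n)%N -> r (u m) (u n)].
Proof.
move=> H.
have /choice[nxt nxtP] : forall l : seq nat, exists i, (forall a, a \in l -> P a) ->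
    [/\ P i, (forall a, a \in l -> (a < i)%N) & forall a, a \in l -> r a i].
  move=> l; case: (pselect (forall a, a \in l -> P a)) => [/H[i ?]|?]; first by exists i.
  by exists 0%N.
pose L := fix L n := if n is n'.+1 then nxt (L n') :: L n' else [::].
have LP n : forall a, a \in L n -> P a.
  elim: n => //= n IH a; rewrite inE => /orP[/eqP->|/IH//].
  by have [] := nxtP _ IH.
have Lmem m n : (m < n)%N -> nxt (L m) \in L n.
  elim: n => // n IH; rewrite ltnS leq_eqVlt => /orP[/eqP->|/IH] /=.
    by rewrite inE eqxx.
  by rewrite inE orbC => ->.
exists (fun n => nxt (L n)); split.
- by move=> m n /Lmem; have [_ + _] := nxtP _ (LP n); apply.
- by move=> n; have [] := nxtP _ (LP n).
- by move=> m n /Lmem; have [_ _ +] := nxtP _ (LP n); apply.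
Qed.

(** * The tree norm: square functions over disjoint families of blocks *)

Section TreeNorm.
Variable R : realType.
Implicit Types (f g : nat -> R) (F : seq nat) (p : nat * seq nat).

Definition theta (k : nat) : R := (2 ^+ (k * k))^-1.

(** Only bits are compared with [tau], while comparability concerns full nodes; hence translations
    of the integers preserve blocks. *)
Definition chain_above (c : nat) (tau : seq bool) F :=
  (forall i, i \in F -> exists2 t, i = idx c t & prefix tau (unzip1 t)) /\
  (forall s t, idx c s \in F -> idx c t \in F -> comparable_nodes s t).

(* Singletons are admissible at scale [0], since [width 0 = 1]. *)
Definition admissible p :=
  [/\ uniq p.2, (size p.2 <= width p.1)%N
    & p.1 = 0%N \/ exists c tau, p.1 = pickle tau /\ chain_above c tau p.2].

Definition block p f : R := theta p.1 * \sum_(i <- p.2) `|f i|.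

Definition disjoint_family (P : seq (nat * seq nat)) :=
  (forall p, p \in P -> admissible p) /\ uniq (flatten (map snd P)).

Definition sqsum P f := \sum_(p <- P) block p f ^+ 2.

(* [tree_norm_le f K] says that the norm of the sequence [f] is at most [K];
   the norm is the supremum of [sqrt (sqsum P f)] over disjoint families [P]. *)
Definition tree_norm_le f (K : R) := forall P, disjoint_family P -> sqsum P f <= K ^+ 2.

Lemma theta_gt0 k : 0 < theta k.
Proof. by rewrite invr_gt0 exprn_gt0. Qed.

Lemma block_ge0 p f : 0 <= block p f.
Proof. by rewrite mulr_ge0 ?(ltW (theta_gt0 _))// sumr_ge0. Qed.

Lemma sqsum_ge0 P f : 0 <= sqsum P f.
Proof. by rewrite sumr_ge0// => i _; exact: sqr_ge0. Qed.

Lemma block_le p f g : (forall i, i \in p.2 -> `|f i| <= `|g i|) ->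
  block p f <= block p g.
Proof.
move=> fg; rewrite ler_pM2l ?theta_gt0// !big_seq.
by apply: ler_sum => i ip; exact: fg.
Qed.

Lemma blockD p f g : block p (fun i => f i + g i) <= block p f + block p g.
Proof.
rewrite -mulrDr ler_pM2l ?theta_gt0// -big_split /=.
by apply: ler_sum => i _; exact: ler_normD.
Qed.

Lemma blockZ p a f : block p (fun i => a * f i) = `|a| * block p f.
Proof.
rewrite /block [RHS]mulrCA [X in _ = _ * X]mulr_sumr; congr (_ * _).
by apply: eq_bigr => i _; rewrite normrM.
Qed.

Lemma eq_block p f g : f =1 g -> block p f = block p g.
Proof. by move=> fg; congr (_ * _); apply: eq_bigr => i _; rewrite fg. Qed.

Lemma block_sum p (D : seq nat) (g : nat -> nat -> R) :
  block p (fun j => \sum_(i <- D) g i j) <= \sum_(i <- D) block p (g i).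
Proof.
elim: D => [|i D IH].
  rewrite big_nil (_ : block _ _ = 0)// /block big1 ?mulr0// => j _.
  by rewrite big_nil normr0.
rewrite big_cons (le_trans _ (lerD (lexx _) IH))//.
apply: le_trans (blockD _ _ _); rewrite le_eqVlt; apply/orP; left; apply/eqP.
by apply: eq_block => j; rewrite big_cons.
Qed.

Lemma sqsum_le P f g : (forall i, `|f i| <= `|g i|) -> sqsum P f <= sqsum P g.
Proof.
move=> fg; apply: ler_sum => p _; rewrite ler_sqr ?nnegrE ?block_ge0//.
by apply: block_le => i _.
Qed.

Lemma tree_norm_le_mono f g K : (forall i, `|f i| <= `|g i|) ->
  tree_norm_le g K -> tree_norm_le f K.
Proof. by move=> fg gK P fP; rewrite (le_trans (sqsum_le P fg))// gK. Qed.

Lemma tree_norm_le_trans f (K L : R) : 0 <= K -> K <= L ->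
  tree_norm_le f K -> tree_norm_le f L.
Proof.
move=> K0 KL fK P fP; rewrite (le_trans (fK P fP))// ler_sqr ?nnegrE//.
exact: le_trans KL.
Qed.

Lemma sum_square_triangle (T : eqType) (s : seq T) (a b : T -> R) (K L : R) :
  0 <= K -> 0 <= L ->
  \sum_(q <- s) a q ^+ 2 <= K ^+ 2 -> \sum_(q <- s) b q ^+ 2 <= L ^+ 2 ->
  \sum_(q <- s) (a q + b q) ^+ 2 <= (K + L) ^+ 2.
Proof.
move=> K0 L0 aK bL.
(* weighted AM-GM: [2 a b <= (l / k) a^2 + (k / l) b^2] with [k], [l] slightly above [K], [L] *)
suff H e : 0 < e -> \sum_(q <- s) (a q + b q) ^+ 2 <= (K + L + e + e) ^+ 2.
  rewrite leNgt; apply/negP => lt.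
  have s0 : 0 <= \sum_(q <- s) (a q + b q) ^+ 2 by rewrite sumr_ge0// => ? _; exact: sqr_ge0.
  set S := \sum_(q <- s) _ in lt s0 H.
  have hS : K + L < Num.sqrt S.
    by rewrite -(@ltr_pXn2r _ 2)// ?nnegrE ?addr_ge0 ?sqrtr_ge0// sqr_sqrtr.
  have := H ((Num.sqrt S - (K + L)) / 4); rewrite divr_gt0 ?subr_gt0// => /(_ isT).
  by rewrite -{1}(sqr_sqrtr s0) ler_sqr ?nnegrE ?sqrtr_ge0//; lra.
move=> e0; have k0 : 0 < K + e by rewrite ltr_wpDl.
have l0 : 0 < L + e by rewrite ltr_wpDl.
set k := K + e in k0 *; set l := L + e in l0 *.
have aK' : \sum_(q <- s) a q ^+ 2 <= k ^+ 2.
  by rewrite (le_trans aK)// ler_sqr ?nnegrE// ?(ltW k0)// lerDl ltW.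
have bL' : \sum_(q <- s) b q ^+ 2 <= l ^+ 2.
  by rewrite (le_trans bL)// ler_sqr ?nnegrE// ?(ltW l0)// lerDl ltW.
have -> : K + L + e + e = k + l by rewrite /k /l; lra.
have ck : l / k * k = l by rewrite divfK ?gt_eqF.
have dl : k / l * l = k by rewrite divfK ?gt_eqF.
have cd : l / k * (k / l) = 1 by rewrite mulrA ck divff ?gt_eqF.
have c0 : 0 < l / k by exact: divr_gt0.
have d0 : 0 < k / l by exact: divr_gt0.
move: (l / k) (k / l) => c d in ck dl cd c0 d0.
have step q : (a q + b q) ^+ 2 <= (1 + c) * a q ^+ 2 + (1 + d) * b q ^+ 2.
  have : 0 <= d * (c * a q - b q) ^+ 2 by rewrite mulr_ge0 ?sqr_ge0// ltW.
  have -> : d * (c * a q - b q) ^+ 2 =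
      (c * d) * (c * a q ^+ 2) - 2 * (c * d) * a q * b q + d * b q ^+ 2 by lra.
  by rewrite cd; lra.
rewrite (le_trans (ler_sum _ (fun q _ => step q)))// big_split/= -!mulr_sumr.
have -> : (k + l) ^+ 2 = (1 + c) * k ^+ 2 + (1 + d) * l ^+ 2.
  have -> : (1 + c) * k ^+ 2 + (1 + d) * l ^+ 2 = k ^+ 2 + (c * k) * k + l ^+ 2 + (d * l) * l by lra.
  by rewrite ck dl; lra.
by rewrite lerD// ler_pM2l// addr_gt0.
Qed.

Lemma tree_norm_leD f g K L : 0 <= K -> 0 <= L -> tree_norm_le f K ->
  tree_norm_le g L -> tree_norm_le (fun i => f i + g i) (K + L).
Proof.
move=> K0 L0 fK gL P fP; apply: le_trans; last first.
  by apply: (sum_square_triangle K0 L0 (fK P fP) (gL P fP)).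
apply: ler_sum => p _; rewrite ler_sqr ?nnegrE ?addr_ge0 ?block_ge0//.
exact: blockD.
Qed.

Lemma tree_norm_leZ f a K : tree_norm_le f K ->
  tree_norm_le (fun i => a * f i) (`|a| * K).
Proof.
move=> fK P fP; rewrite exprMn.
have -> : sqsum P (fun i => a * f i) = `|a| ^+ 2 * sqsum P f.
  by rewrite big_distrr/=; apply: eq_bigr => p _; rewrite blockZ exprMn.
by rewrite ler_wpM2l ?exprn_ge0// fK.
Qed.

(** Singletons at scale 0 have weight 1, so through them the tree norm dominates the $\ell_2$ norm
    and every coordinate. *)
Lemma singletons_disjoint (s : seq nat) : uniq s -> disjoint_family [seq (0%N, [:: i]) | i <- s].
Proof.
move=> us; split.
  by move=> p /mapP[i _ ->]; split=> //; left.
by rewrite -map_comp (_ : flatten _ = s)//; elim: s {us} => //= i s ->.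
Qed.

Lemma singleton_sqsum (s : seq nat) f :
  sqsum [seq (0%N, [:: i]) | i <- s] f = \sum_(i <- s) `|f i| ^+ 2.
Proof.
rewrite /sqsum big_map; apply: eq_bigr => i _.
by rewrite /block big_seq1 /theta expr0 invr1 mul1r.
Qed.

Lemma sum_squares_le f K (s : seq nat) : uniq s -> tree_norm_le f K ->
  \sum_(i <- s) `|f i| ^+ 2 <= K ^+ 2.
Proof. by move=> us /(_ _ (singletons_disjoint us)); rewrite singleton_sqsum. Qed.

Lemma tree_norm_le_coord f K j : 0 <= K -> tree_norm_le f K -> `|f j| <= K.
Proof.
move=> K0 /(@sum_squares_le _ _ [:: j]) => /(_ isT); rewrite big_seq1.
by rewrite ler_sqr ?nnegrE.
Qed.

Lemma block_norm_le f K p : 0 <= K -> admissible p -> tree_norm_le f K ->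
  block p f <= K.
Proof.
move=> K0 ap /(_ [:: p]); rewrite /sqsum big_seq1 ler_sqr ?nnegrE ?block_ge0//.
apply; split; first by move=> q; rewrite inE => /eqP->.
by case: ap => /= up _ _; rewrite cats0.
Qed.

End TreeNorm.

(** * Norms of sums of basis vectors along a branch *)

Section Branch.
Variables (R : realType) (x : nat -> bool).
Implicit Types (f : nat -> R) (D : seq nat).

(** The integers are all 0 because this branch lies in the tree attached to [x]: the trivial chain
    has cost 0. *)
Definition branch (i : nat) : nat := idx 0 (mkseq (fun j => (x j, 0%N)) i).

Lemma branch_inj : injective branch.
Proof.
move=> i j /idx_inj /(congr1 size); by rewrite !size_mkseq.
Qed.

Lemma uniq_map_branch D : uniq D -> uniq (map branch D).
Proof. by move=> uD; rewrite map_inj_uniq//; exact: branch_inj. Qed.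

Lemma unzip1_mkseq (b : nat -> bool * nat) n :
  unzip1 (mkseq b n) = mkseq (fst \o b) n.
Proof. by rewrite /unzip1 /mkseq -map_comp. Qed.

(** A block meeting the support of [f] has scale 0 or the code of an initial segment of [x]. If it
    contains $c$ of the branch nodes, its square is at most $2^{-2k^2}c^2$, and $c \le 2^{b+2k^2}$
    by one of the two size bounds, so it is at most $2^b c$. Disjointness bounds the sum of the $c$
    by [width m]. *)
Lemma sqsum_branch_le D f m (b : nat) P : uniq D -> size D = width m ->
  (forall j, `|f j| <= 1) -> (forall j, f j != 0 -> j \in map branch D) ->
  (forall k, k = 0%N \/ (exists l, k = pickle (mkseq x l)) ->
     (8 * (k * k) <= b + 2 * (k * k))%N || (8 * (m * m) <= b + 2 * (k * k))%N) ->
  disjoint_family P -> sqsum P f <= 2 ^+ (b + 8 * (m * m)).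
Proof.
move=> uD sD f1 fD hb [aP uP].
pose c (p : nat * seq nat) := count (mem (map branch D)) p.2.
have mass_le (p : nat * seq nat) : \sum_(i <- p.2) `|f i| <= (c p)%:R.
  rewrite /c -sum1_count natr_sum [leRHS]big_mkcond/=; apply: ler_sum => i _.
  case: ifPn => [_|iD]; first exact: f1.
  by rewrite normr_le0; apply: contraNT iD => /fD.
have cm p : p \in P -> (c p <= width m)%N.
  move=> /aP[up _ _]; rewrite /c -size_filter -sD -(size_map branch).
  apply: uniq_leq_size; first exact: filter_uniq.
  by move=> i; rewrite mem_filter => /andP[].
have step p : p \in P -> block p f ^+ 2 <= 2 ^+ b * (c p)%:R.
  move=> pP; have [cp0|cp0] := posnP (c p).
    have := mass_le p; rewrite cp0 => m0.
    have -> : block p f = 0.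
      by rewrite /block (_ : \sum_(i <- p.2) _ = 0) ?mulr0//; apply/eqP; rewrite eq_le m0 sumr_ge0.
    by rewrite expr0n/= mulr0.
  have [up wp hp] := aP _ pP.
  have vis : p.1 = 0%N \/ (exists l, p.1 = pickle (mkseq x l)).
    case: hp => [->|[d [tau [-> [ch _]]]]]; first by left.
    right; move: cp0; rewrite /c -has_count => /hasP[j /ch[t -> ht] /mapP[i _ /(pcan_inj pickleK)[_ te]]].
    exists (size tau); congr pickle; move: ht; rewrite te unzip1_mkseq.
    exact: prefix_mkseq.
  have ck : (c p <= width p.1)%N by exact: leq_trans (count_size _ _) wp.
  have hmin : (c p <= 2 ^ (b + 2 * (p.1 * p.1)))%N.
    have /orP[h|h] := hb _ vis.
      by apply: leq_trans ck _; rewrite leq_exp2l.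
    by apply: leq_trans (cm _ pP) _; rewrite leq_exp2l.
  have t2 : theta R p.1 ^+ 2 * 2 ^+ (2 * (p.1 * p.1)) = 1.
    by rewrite /theta exprVn -exprM mulnC mulVf// expf_neq0.
  have c2 : (c p)%:R ^+ 2 <= (2 ^+ (2 * (p.1 * p.1)) * 2 ^+ b) * (c p)%:R :> R.
    rewrite expr2 ler_wpM2r// -exprD addnC -natrX ler_nat//.
  rewrite exprMn; have := mass_le p; set s := \sum_(i <- _) _ => sc.
  have s0 : 0 <= s by rewrite sumr_ge0.
  have s2 : s ^+ 2 <= (c p)%:R ^+ 2 by rewrite ler_sqr ?nnegrE.
  rewrite (le_trans (ler_wpM2l (sqr_ge0 _) (le_trans s2 c2)))//.
  by rewrite !mulrA t2 mul1r.
rewrite /sqsum big_seq (le_trans (ler_sum _ step))// -big_seq -mulr_sumr exprD ler_wpM2l ?exprn_ge0//.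
rewrite -natr_sum -natrX ler_nat.
have -> : (\sum_(p <- P) c p = count (mem (map branch D)) (flatten (map snd P)))%N.
  by rewrite count_flatten sumnE !big_map.
rewrite -size_filter -[leqRHS]sD -(size_map branch); apply: uniq_leq_size; first exact: filter_uniq.
by move=> i; rewrite mem_filter => /andP[].
Qed.

(** Scales $k \le m$ are limited by the size of the block, scales $k > m$ by the number of support
    points; both bounds hold with $b = 6m^2$. *)
Lemma branch_norm_le D f m : uniq D -> size D = width m ->
  (forall j, `|f j| <= 1) -> (forall j, f j != 0 -> j \in map branch D) ->
  tree_norm_le f (2 ^+ (7 * (m * m))).
Proof.
move=> uD sD f1 fD P fP.
rewrite (le_trans (sqsum_branch_le (b := 6 * (m * m)) uD sD f1 fD _ fP))//; last first.
  by rewrite -exprM; apply: ler_weXn2l; [lra|lia].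
move=> k _; have [km|mk] := leqP k m; apply/orP; [left|right].
  have := leq_mul km km; lia.
have := leq_mul (ltnW mk) (ltnW mk); lia.
Qed.

(** For $m > 0$ no block at scale $m$ meets the branch, since [tau] is not an initial segment of
    [x]. Scale $m+1$ is the binding one among the others and gains $4m$ in the exponent of the
    square. *)
Lemma branch_norm_off_le D f m tau : uniq D -> size D = width m ->
  (forall j, `|f j| <= 1) -> (forall j, f j != 0 -> j \in map branch D) ->
  m = pickle (tau : seq bool) -> tau != mkseq x (size tau) ->
  tree_norm_le f (2 ^+ (7 * (m * m) - 2 * m)).
Proof.
move=> uD sD f1 fD mE off P fP.
rewrite (le_trans (sqsum_branch_le (b := 6 * (m * m) - 4 * m) uD sD f1 fD _ fP))//; last first.
  rewrite -exprM; apply: ler_weXn2l; first by lra.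
  case: (m) => // m'; nia.
move=> k vis; case: (ltngtP k m) => [km|mk|kmE]; apply/orP.
- by left; nia.
- by right; nia.
- case: vis => [k0|[l kE]]; first by left; rewrite -kmE k0.
  move: kmE; rewrite kE mE => /(pcan_inj pickleK) tauE.
  by move: off; rewrite -tauE size_mkseq eqxx.
Qed.

(** One block at scale $m$ suffices: branch nodes of length at least $l$ extend the sequence coded
    by $m$, and $2^{-m^2}\,2^{8m^2} = 2^{7m^2}$. *)
Lemma le_branch_norm D m l K : uniq D -> size D = width m ->
  m = pickle (mkseq x l) -> (forall i, i \in D -> (l <= i)%N) -> 0 <= K ->
  tree_norm_le (fun j => (j \in map branch D)%:R : R) K -> 2 ^+ (7 * (m * m)) <= K.
Proof.
move=> uD sD mE Dl K0 /(block_norm_le (p := (m, map branch D)) K0) => H.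
apply: le_trans (H _); last first.
  split; rewrite /= ?uniq_map_branch ?size_map ?sD//.
  right; exists 0%N, (mkseq x l); split=> //; split.
    move=> j /mapP[i iD ->]; exists (mkseq (fun j => (x j, 0%N)) i) => //.
    rewrite unzip1_mkseq /= prefixE size_mkseq /mkseq -map_take take_iota.
    by rewrite (minn_idPl (Dl _ iD)).
  move=> s t /mapP[i _ /idx_inj ->] /mapP[j _ /idx_inj ->].
  apply: (prefix_comparable (u := mkseq (fun j => (x j, 0%N)) (maxn i j)));
    rewrite prefixE size_mkseq /mkseq -map_take take_iota (minn_idPl _) ?leq_maxl ?leq_maxr//.
rewrite /block/= big_seq (eq_bigr (fun=> 1)); last by move=> i ->; rewrite normr1.
rewrite -big_seq big_const_seq iter_addr_0 count_predT size_map sD /width natrX /theta.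
rewrite [leRHS]mulrC ler_pdivlMr ?exprn_gt0// -exprD.
by apply: ler_weXn2l; [lra|lia].
Qed.

End Branch.

(** * Choice of signs, growth of powers of two, pigeonhole *)

(** Signs are fixed one index at a time. The mean of $|o_j + s a_{ij}|$ over $s = \pm 1$ is at least
    both $|o_j|$ and $|a_{ij}|$, so some sign keeps, in total over [J], the diagonal entry at $j =
    i$ and the current values elsewhere. *)
Lemma exists_signs (R : realType) (a : nat -> nat -> R) (o : nat -> R) (D J : seq nat) :
  uniq D -> exists2 eps : nat -> R, forall i, `|eps i| <= 1 &
    \sum_(j <- J) (if j \in D then `|a j j| else `|o j|) <=
    \sum_(j <- J) `|o j + \sum_(i <- D) eps i * a i j|.
Proof.
elim: D o => [|i D IH] o /=.
  by move=> _; exists (fun=> 0) => [k|]; rewrite ?normr0//; under [leRHS]eq_bigr do rewrite big_nil addr0.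
move=> /andP[iD uD].
pose T (s : R) := \sum_(j <- J) (if j \in D then `|a j j| else `|o j + s * a i j|).
have avg : \sum_(j <- J) (if j \in i :: D then `|a j j| else `|o j|) *+ 2 <= T 1 + T (- 1).
  rewrite -big_split/=; apply: ler_sum => j _; rewrite inE.
  have [->|ji] := eqVneq j i; rewrite ?(negPf iD)/=.
    have := ler_normB (o i + 1 * a i i) (o i + -1 * a i i).
    by rewrite (_ : _ - _ = a i i *+ 2) ?normrMn// mul1r mulN1r mulr2n opprD opprK addrACA subrr add0r.
  case: ifP => _; first by rewrite mulr2n.
  have := ler_normD (o j + 1 * a i j) (o j + -1 * a i j).
  by rewrite (_ : _ + _ + _ = o j *+ 2) ?normrMn// mul1r mulN1r mulr2n addrACA subrr addr0.
have [s s1 sT] : exists2 s, `|s| <= 1 &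
    \sum_(j <- J) (if j \in i :: D then `|a j j| else `|o j|) <= T s.
  rewrite sumrMnl in avg.
  have [h|h] := leP (T (-1)) (T 1); [exists 1|exists (-1)]; rewrite ?normrN ?normr1//; lra.
have [eps eps1 Heps] := IH (fun j => o j + s * a i j) uD.
exists (fun k => if k == i then s else eps k) => [k|]; first by case: ifP.
rewrite (le_trans sT)// (le_trans Heps)// le_eqVlt; apply/orP; left; apply/eqP.
apply: eq_bigr => j _; rewrite big_cons eqxx addrA; congr (`|_ + _|).
apply: eq_big_seq => k kD; case: eqP => // kE; by rewrite kE (negPf iD) in kD.
Qed.

Lemma exists_pow2_gt (R : realType) (y : R) : exists m, forall n, (m <= n)%N -> y < 2 ^+ n.
Proof.
exists (Num.truncn `|y|).+1 => n mn; rewrite (le_lt_trans (ler_norm y))//.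
rewrite (lt_le_trans (truncnS_gt _))//.
by rewrite -natrX ler_nat (leq_trans mn)// ltnW// ltn_expl.
Qed.

Lemma injective_unbounded (f : nat -> nat) : injective f ->
  forall M b, exists2 l, (b <= l)%N & (M <= f l)%N.
Proof.
move=> finj M b; apply: contrapT => H.
have : (size (map f (iota b M.+1)) <= size (iota 0 M))%N.
  apply: uniq_leq_size; first by rewrite map_inj_uniq ?iota_uniq.
  move=> j /mapP[l]; rewrite !mem_iota => /andP[bl _] ->; rewrite /= add0n ltnNge.
  by apply/negP => Ml; apply: H; exists l.
by rewrite size_map !size_iota ltnn.
Qed.

Lemma theta_width (R : realType) m : theta R m * 2 ^+ (8 * (m * m)) = 2 ^+ (7 * (m * m)).
Proof.
have -> : (8 * (m * m) = m * m + 7 * (m * m))%N by lia.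
by rewrite exprD mulrA mulVf ?mul1r// expf_neq0.
Qed.

Lemma pow2_split (R : realType) m :
  2 ^+ (7 * (m * m)) = 2 ^+ (2 * m) * 2 ^+ (7 * (m * m) - 2 * m) :> R.
Proof. by rewrite -exprD subnKC//; case: m => // n; nia. Qed.

(** * The core: images of a branch inside a tree without a branch over [x] *)

Section Core.
Variables (R : realType) (x : nat -> bool) (S : node -> Prop).
Variables (g : nat -> nat -> R) (C : R) (h : nat -> nat).
Hypothesis C_ge1 : 1 <= C.
Hypothesis S_prefix : forall s t, prefix s t -> S t -> S s.
Hypothesis S_no_branch : forall beta : nat -> nat,
  exists n, ~ S (mkseq (fun j => (x j, beta j)) n).
Hypothesis g_supp : forall i j, g i j != 0 ->
  (j < h i)%N /\ exists2 t, S t & j = idx 0 t.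
Hypothesis g_norm : forall i, tree_norm_le (g i) C.
Hypothesis g_sum : forall m D (eps : nat -> R), uniq D -> size D = width m ->
  (forall i, `|eps i| <= 1) ->
  tree_norm_le (fun j => \sum_(i <- D) eps i * g i j) (C * 2 ^+ (7 * (m * m)) + C).
Hypothesis g_sum_off : forall m tau D (eps : nat -> R), uniq D -> size D = width m ->
  (forall i, `|eps i| <= 1) -> m = pickle (tau : seq bool) ->
  tau != mkseq x (size tau) ->
  tree_norm_le (fun j => \sum_(i <- D) eps i * g i j) (C * 2 ^+ (7 * (m * m) - 2 * m) + C).
Hypothesis g_lower : forall m l D K, uniq D -> size D = width m ->
  m = pickle (mkseq x l) -> (forall i, i \in D -> (l <= i)%N) -> 0 <= K ->
  tree_norm_le (fun j => \sum_(i <- D) g i j) K -> 2 ^+ (7 * (m * m)) <= C * K + C.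

Let C_gt0 : 0 < C. Proof. exact: lt_le_trans C_ge1. Qed.

(** If coordinate $j$ were at least $d$ for infinitely many $i$, adding [width m] of these vectors
    with matching signs would give $d\,2^{8m^2}$ there, beyond $C 2^{7m^2} + C$ for large $m$. *)
Lemma coordinate_vanish j d : 0 < d ->
  exists b, forall i, (b <= i)%N -> `|g i j| < d.
Proof.
move=> d0; apply: contrapT => H.
have Pinf : unbounded (fun i => d <= `|g i j|).
  move=> b; apply: contrapT => Hb; apply: H; exists b => i bi.
  by rewrite ltNge; apply/negP => di; apply: Hb; exists i.
have [m /(_ m (leqnn m)) hm] := exists_pow2_gt (2 * C / d).
have [D [uD sD PD]] := unbounded_list Pinf (width m).
have sg1 i : `|Num.sg (g i j)| <= 1 by rewrite normr_sg; case: (_ != 0); rewrite ?lexx ?ler01.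
have K0 : 0 <= C * 2 ^+ (7 * (m * m)) + C by rewrite addr_ge0 ?mulr_ge0 ?exprn_ge0 ?ltW.
have := tree_norm_le_coord j K0 (g_sum uD sD sg1).
rewrite (eq_bigr (fun i => `|g i j|)); last by move=> i _; rewrite -normrEsg.
rewrite ger0_norm ?sumr_ge0//; apply/negP; rewrite -ltNge.
have lo : d * 2 ^+ (8 * (m * m)) <= \sum_(i <- D) `|g i j|.
  rewrite big_seq (le_trans _ (ler_sum _ PD))// -big_seq big_const_seq iter_addr_0.
  by rewrite count_predT sD -[d *+ _]mulr_natr /width natrX.
apply: lt_le_trans lo.
have -> : (8 * (m * m) = m * m + 7 * (m * m))%N by lia.
rewrite exprD mulrA.
have e1 : 1 <= 2 ^+ (7 * (m * m)) :> R by apply: exprn_ege1; lra.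
have e2 : 2 * C < d * 2 ^+ (m * m).
  rewrite -ltr_pdivrMl// mulrC (lt_le_trans hm)//; apply: ler_weXn2l; [lra|].
  by case: (m) => // n; rewrite leq_pmulr.
rewrite (@le_lt_trans _ _ (2 * C * 2 ^+ (7 * (m * m))))//; last by rewrite ltr_pM2r ?exprn_gt0.
by have := ler_wpM2l (ltW C_gt0) e1; lra.
Qed.

(** Each node occurs finitely often, so the lengths grow and the comparable nodes [t i] spell an
    infinite branch of [S]. It does not lie over [x]; once its bits have left [x], a block along it
    at an off-branch scale $m$ measures at least $d\,2^{7m^2}$, while signed sums have norm at most
    $C 2^{7m^2-2m} + C$. *)
Lemma no_chain (P : nat -> Prop) (t : nat -> node) d : 0 < d -> unbounded P ->
  (forall i, P i -> d <= `|g i (idx 0 (t i))|) ->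
  (forall i j, P i -> P j -> comparable_nodes (t i) (t j)) -> False.
Proof.
move=> d0 Pinf Pd Pc.
have tfin s : exists b, forall i, (b <= i)%N -> P i -> t i != s.
  have [b hb] := coordinate_vanish (idx 0 s) d0.
  exists b => i bi /Pd; apply: contraTneq => ->; by rewrite -ltNge hb.
have pe (s s' : node) : prefix s s' -> size s = size s' -> s = s'.
  by rewrite prefixE => /eqP hs sz; rewrite -hs sz take_size.
have same i j : P i -> P j -> size (t i) = size (t j) -> t i = t j.
  by move=> /Pc/[apply]/orP[] /pe pij sE; [exact: pij|rewrite pij].
(* Comparable nodes of equal length coincide, and a single node occurs only finitely often, so the
   maximal length can be lowered by passing to a later tail. *)
have nobound l : forall b, ~ forall i, (b <= i)%N -> P i -> (size (t i) < l)%N.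
  elim: l => [|l IH] b Hb.
    by have [i bi Pi] := Pinf b; have := Hb i bi Pi.
  have [[i1 [b1 P1 s1]]|none] := pselect (exists i, [/\ (b <= i)%N, P i & size (t i) = l]).
    have [b' hb'] := tfin (t i1); apply: (IH (maxn b b')) => i.
    rewrite geq_max => /andP[bi b'i] Pi.
    have := Hb i bi Pi; rewrite ltnS leq_eqVlt => /orP[/eqP sE|//].
    by have := hb' i b'i Pi; rewrite (same i i1)// ?eqxx// sE s1.
  apply: (IH b) => i bi Pi; have := Hb i bi Pi.
  rewrite ltnS leq_eqVlt => /orP[/eqP sE|//]; by exfalso; apply: none; exists i.
have big l : unbounded (fun i => P i /\ (l <= size (t i))%N).
  move=> b; apply: contrapT => H; apply: (nobound l b) => i bi Pi.
  by rewrite ltnNge; apply/negP => li; apply: H; exists i.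
have /choice[w wP] n : exists i, P i /\ (n < size (t i))%N.
  by have [i _ ?] := big n.+1 0%N; exists i.
pose bb n := nth (false, 0%N) (t (w n)) n.
have nthE i j k : P i -> P j -> (k < size (t i))%N -> (k < size (t j))%N ->
    nth (false, 0%N) (t i) k = nth (false, 0%N) (t j) k.
  have np s s' : prefix s s' -> (k < size s)%N -> nth (false, 0%N) s k = nth (false, 0%N) s' k.
    by rewrite prefixE => /eqP hs ks; rewrite -{1}hs nth_take.
  by move=> /Pc/[apply]/orP[] /np hp ki kj; rewrite hp.
have tE i : P i -> t i = mkseq bb (size (t i)).
  move=> Pi; apply: (@eq_from_nth _ (false, 0%N)); rewrite ?size_mkseq// => k ki.
  by rewrite nth_mkseq//; apply: nthE => //; have [] := wP k.
have tS i : P i -> S (t i).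
  move=> Pi; have : g i (idx 0 (t i)) != 0 by rewrite -normr_gt0 (lt_le_trans d0)// Pd.
  by move=> /g_supp[_ [s Ss /idx_inj ->]].
have Sbb n : S (mkseq bb n).
  have [Pw nw] := wP n; apply: S_prefix (tS _ Pw); rewrite (tE _ Pw).
  by rewrite prefixE size_mkseq /mkseq -map_take take_iota (minn_idPl (ltnW nw)).
have [eqx|] := pselect (forall j, (bb j).1 = x j).
  have [n] := S_no_branch (snd \o bb); apply.
  rewrite (_ : (fun j => _) = bb)//; apply/funext => j /=; rewrite -eqx.
  by case: (bb j).
move=> /existsNP[l0 /eqP neq].
have tauinj : injective (fun l => pickle (mkseq (fst \o bb) l)).
  by move=> l l' /(pcan_inj pickleK)/(congr1 size); rewrite !size_mkseq.
(* Beyond [m0] the gain $2^{2m}$ beats $2C/d$; a length above [l0] makes [tau] record the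
   discrepancy with [x]. *)
have [m0 hm0] := exists_pow2_gt (2 * C / d).
have [l l0l ml] := injective_unbounded tauinj m0 l0.+1.
set tau := mkseq _ l in ml; set m := pickle tau in ml.
(* The nodes must be distinct for the block to have as many points as there are vectors. *)
have [u [_ uP uneq]] : exists u : nat -> nat, [/\ {homo u : m n / (m < n)%N},
    forall n, P (u n) /\ (l <= size (t (u n)))%N
    & forall m n, (m < n)%N -> t (u m) != t (u n)].
  apply: (greedy_sequence (P := fun i => P i /\ (l <= size (t i))%N)
     (r := fun i j => t i != t j)) => L LP.
  have [b hb] : exists b, forall i, (b <= i)%N -> P i -> forall a, a \in L -> t a != t i.
    elim: L {LP} => [|a L [b hb]]; first by exists 0%N.
    have [b' hb'] := tfin (t a); exists (maxn b b') => i.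
    rewrite geq_max => /andP[bi b'i] Pi c; rewrite inE => /orP[/eqP->|/hb->//].
    by rewrite eq_sym hb'.
  have [i bi [Pi li]] := big l (maxn b (\max_(a <- L) a).+1).
  move: bi; rewrite geq_max => /andP[bi Li].
  exists i; split=> // a aL; last exact: hb.
  by rewrite (leq_trans _ Li)// ltnS (big_rem a)//= leq_maxl.
have uneq' i j : i != j -> t (u i) != t (u j).
  by rewrite neq_ltn => /orP[/uneq//|/uneq]; rewrite eq_sym.
have uinj : injective u.
  by move=> i j uE; apply/eqP; apply: contraT => /uneq'; rewrite uE eqxx.
pose D := map u (iota 0 (width m)).
have uD : uniq D by rewrite map_inj_uniq ?iota_uniq.
have sD : size D = width m by rewrite size_map size_iota.
have DP i : i \in D -> P i /\ (l <= size (t i))%N by move=> /mapP[n _ ->].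
(* The other vectors might cancel the large entry of [g j] at [t j]; suitable signs keep these
   diagonal entries in total. *)
have [eps eps1] := exists_signs (fun i j => g i (idx 0 (t j))) (fun=> 0) D uD.
move=> Heps.
have off : tau != mkseq x (size tau).
  rewrite size_mkseq; apply: contraNneq neq => tauE.
  by have := congr1 (nth false ^~ l0) tauE; rewrite !nth_mkseq// => /eqP.
have := g_sum_off uD sD eps1 erefl off.
have adm : admissible (m, map (fun i => idx 0 (t i)) D).
  split; rewrite /= ?size_map ?size_iota ?sD//.
    rewrite -map_comp map_inj_in_uniq ?iota_uniq// => i j _ _ /idx_inj tt.
    by apply/eqP; apply: contraT => /uneq'; rewrite /= tt eqxx.
  right; exists 0%N, tau; split; [by []|split].
    move=> j /mapP[i /DP[Pi li] ->]; exists (t i) => //.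
    rewrite (tE _ Pi) unzip1_mkseq prefixE size_mkseq /mkseq -map_take take_iota.
    by rewrite (minn_idPl li).
  by move=> s s' /mapP[i /DP[Pi _] /idx_inj ->] /mapP[j /DP[Pj _] /idx_inj ->]; exact: Pc.
have K0 : 0 <= C * 2 ^+ (7 * (m * m) - 2 * m) + C.
  by rewrite addr_ge0 ?mulr_ge0 ?exprn_ge0 ?ltW.
move=> /(block_norm_le K0 adm); apply/negP; rewrite -ltNge.
rewrite /block/= big_map.
have lo : d * 2 ^+ (8 * (m * m)) <= \sum_(j <- D) `|\sum_(i <- D) eps i * g i (idx 0 (t j))|.
  have -> : \sum_(j <- D) `|\sum_(i <- D) eps i * g i (idx 0 (t j))| =
    \sum_(j <- D) `|0 + \sum_(i <- D) eps i * g i (idx 0 (t j))|.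
    by apply: eq_bigr => j _; rewrite add0r.
  apply: le_trans Heps.
  rewrite big_seq (@le_trans _ _ (\sum_(i <- D | i \in D) d))//; last first.
    by apply: ler_sum => i iD; rewrite iD; apply: Pd; have [] := DP _ iD.
  by rewrite -big_seq big_const_seq iter_addr_0 count_predT sD -[d *+ _]mulr_natr /width natrX.
rewrite (lt_le_trans _ (ler_wpM2l (ltW (theta_gt0 R m)) lo))//.
have -> : theta R m * (d * 2 ^+ (8 * (m * m))) = d * 2 ^+ (7 * (m * m)).
  by rewrite mulrCA theta_width.
have -> : d * 2 ^+ (7 * (m * m)) = d * 2 ^+ (2 * m) * 2 ^+ (7 * (m * m) - 2 * m).
  by rewrite -mulrA -pow2_split.
have e1 : 1 <= 2 ^+ (7 * (m * m) - 2 * m) :> R by apply: exprn_ege1; lra.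
have e2 : 2 * C < d * 2 ^+ (2 * m).
  by rewrite -ltr_pdivrMl// mulrC hm0// (leq_trans ml)// leq_pmull.
rewrite (@le_lt_trans _ _ (2 * C * 2 ^+ (7 * (m * m) - 2 * m)))//; last by rewrite ltr_pM2r ?exprn_gt0.
by have := ler_wpM2l (ltW C_gt0) e1; lra.
Qed.

Let nod (j : nat) : node := odflt [::] (omap snd (pickle_inv j : option (nat * node))).

Let nodK c : cancel (idx c) nod.
Proof. by move=> s; rewrite /nod /idx pickleK_inv. Qed.

(* For an ultrafilter [G], either [G]-almost all indices are [G]-almost never
   linked to a later one and a greedy choice works, or a fixed position in the
   (boundedly long) lists [A j] of large coordinates extends infinitely many
   large nodes, which then form a chain. *)
Lemma unlinked_subsequence (P : nat -> Prop) d : 0 < d -> unbounded P ->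
  exists P' : nat -> Prop, [/\ unbounded P', forall i, P' i -> P i
    & forall i j s t, P' i -> P' j -> i != j ->
      d <= `|g i (idx 0 s)| -> d <= `|g j (idx 0 t)| -> ~~ comparable_nodes s t].
Proof.
move=> d0 Pinf.
pose A i := [seq j <- iota 0 (h i) | d <= `|g i j|].
have memA i j : d <= `|g i j| -> j \in A i.
  move=> dg; rewrite mem_filter dg mem_iota add0n.
  by have /g_supp[] : g i j != 0 by rewrite -normr_gt0 (lt_le_trans d0).
have Anod i j : j \in A i -> d <= `|g i j| /\ j = idx 0 (nod j).
  rewrite mem_filter => /andP[dg _]; split=> //.
  have /g_supp[_ [t _ ->]] : g i j != 0 by rewrite -normr_gt0 (lt_le_trans d0).
  by rewrite nodK.
(* By comparison with $\ell_2$ a vector has at most $C^2/d^2$ coordinates of size $d$. The bound is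
   uniform in $i$, so only finitely many positions in the lists [A j] occur. *)
pose K := (Num.truncn (C ^+ 2 / d ^+ 2)).+1.
have sizeA i : (size (A i) <= K)%N.
  have uA : uniq (A i) by rewrite filter_uniq ?iota_uniq.
  have := sum_squares_le uA (g_norm i) => hC.
  have lo : (size (A i))%:R * d ^+ 2 <= C ^+ 2.
    apply: le_trans hC; rewrite big_seq (@le_trans _ _ (\sum_(j <- A i | j \in A i) d ^+ 2))//.
      by rewrite -big_seq big_const_seq iter_addr_0 count_predT -[d ^+ 2 *+ _]mulr_natl.
    by apply: ler_sum => j /Anod[dg _]; rewrite ler_sqr ?nnegrE// ltW.
  rewrite -(ler_nat R) (le_trans _ (ltW (truncnS_gt _)))//.
  by rewrite ler_pdivlMr ?exprn_gt0.
clearbody K.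
have FP : ProperFilter (filter_from [set: nat] (fun b => [set i | (b <= i)%N /\ P i])).
  apply: filter_from_proper; last by move=> b _; have [i bi Pi] := Pinf b; exists i.
  apply: filter_from_filter; first by exists 0%N.
  move=> a b _ _; exists (maxn a b) => // i [].
  by rewrite geq_max => /andP[ai bi] Pi; split.
have [G [GU FG]] := ultraFilterLemma FP.
have GP b : G [set i | (b <= i)%N /\ P i] by apply: FG; exists b.
have Ginf B : G B -> unbounded (fun i => P i /\ B i).
  move=> GB b; have [i [[bi Pi] Bi]] := filter_ex (filterI (GP b) GB).
  by exists i.
have ultra_list (T : eqType) (L : seq T) (B : T -> set nat) :
    G [set j | exists2 p, p \in L & B p j] -> exists2 p, p \in L & G (B p).
  elim: L => [|p L IH] GL.
    by have [j [q]] := filter_ex GL.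
  have [GB|GB] := in_ultra_setVsetC (B p) GU; first by exists p; rewrite ?mem_head.
  have [|q qL Gq] := IH; last by exists q; rewrite // inE qL orbT.
  apply: filterS (filterI GL GB) => j [[q]]; rewrite inE => /orP[/eqP->//|qL Bq _].
  by exists q.
pose link i j := exists s t, [/\ d <= `|g i (idx 0 s)|, d <= `|g j (idx 0 t)|
  & comparable_nodes s t].
have linkC i j : link i j -> link j i.
  by move=> [s [t [? ? st]]]; exists t, s; split=> //; rewrite /comparable_nodes orbC.
have [Ggood|Gbad] := in_ultra_setVsetC [set i | G [set j | ~ link i j]] GU.
  have [u [umono uP ur]] : exists u : nat -> nat, [/\ {homo u : m n / (m < n)%N},
     forall n, P (u n) /\ G [set j | ~ link (u n) j]
     & forall m n, (m < n)%N -> ~ link (u m) (u n)].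
    apply: (greedy_sequence (P := fun i => P i /\ G [set j | ~ link i j])
      (r := fun i j => ~ link i j)) => L LP.
    have GL : G [set i | forall a, a \in L -> ~ link a i].
      elim: L LP => [|a L IH] LP; first by apply: filterS (GP 0%N).
      have [_ Ga] := LP a (mem_head _ _).
      have GL := IH (fun b bL => LP b (mem_behead (s := a :: L) bL)).
      apply: filterS (filterI Ga GL) => i [ai Li] b.
      by rewrite inE => /orP[/eqP->|bL]; [exact: ai|exact: Li].
    have [i [[bi Pi] [Li gi]]] :=
      filter_ex (filterI (GP (\max_(a <- L) a).+1) (filterI GL Ggood)).
    exists i; split; [exact: conj|move=> a aL|exact: Li].
    by rewrite (leq_trans _ bi)// ltnS (big_rem a)//= leq_maxl.
  have uge n : (n <= u n)%N.
    by elim: n => // n IH; rewrite (leq_ltn_trans IH)// umono.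
  exists (fun i => exists n, i = u n); split.
  - by move=> b; exists (u b) => //; exists b.
  - by move=> i [n ->]; have [] := uP n.
  - move=> i j s t [m ->] [n ->] mn ds dt; apply/negP => st.
    have lmn : link (u m) (u n) by exists s, t.
    have : m != n by apply: contraNneq mn => ->.
    by rewrite neq_ltn => /orP[/ur|/ur]; apply=> //; exact: linkC.
exfalso.
have list_vanish (L : seq node) : exists b, forall j, (b <= j)%N ->
    forall t, t \in L -> `|g j (idx 0 t)| < d.
  elim: L => [|t L [b hb]]; first by exists 0%N.
  have [b' hb'] := coordinate_vanish (idx 0 t) d0; exists (maxn b b') => j.
  rewrite geq_max => /andP[bj b'j] s; rewrite inE => /orP[/eqP->|/hb]; first exact: hb'.
  exact.
have bad i : ~ G [set j | ~ link i j] -> exists p : nat * nat,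
    [/\ p.1 \in A i, (p.2 < K)%N & G [set j | prefix (nod p.1) (nod (nth 0%N (A j) p.2))]].
  move=> ngood; have [//|Glink] := in_ultra_setVsetC [set j | ~ link i j] GU.
  (* Late vectors are small on all prefixes of the large nodes of [i], so a link from [i] to a late
     [j] goes upwards: a large node of [i] is a prefix of one of [j]. *)
  have [b hb] := list_vanish
    (flatten [seq [seq take k (nod a) | k <- iota 0 (size (nod a)).+1] | a <- A i]).
  suff : G [set j | exists2 p, p \in [seq (a, q) | a <- A i, q <- iota 0 K] &
      prefix (nod p.1) (nod (nth 0%N (A j) p.2))].
    move=> /ultra_list[p /allpairsP[[a q] [/= aA]]]; rewrite mem_iota => /andP[_ qK] -> Gp.
    by exists (a, q).
  apply: filterS (filterI Glink (GP b)) => j [/contrapT[s [t [ds dt st]]] [bj _]].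
  have tA := memA _ _ dt; have sA := memA _ _ ds.
  exists (idx 0 s, index (idx 0 t) (A j)) => /=.
    apply/allpairsP; exists (idx 0 s, index (idx 0 t) (A j)); split=> //=.
    by rewrite mem_iota add0n/= (leq_trans _ (sizeA j))// index_mem.
  rewrite nth_index// !nodK; case/orP: st => // ts; exfalso.
  have := hb j bj t; rewrite ltNge dt => /(_ _)/notF; apply.
  apply/flattenP; exists [seq take k s | k <- iota 0 (size s).+1].
    by apply/mapP; exists (idx 0 s); rewrite ?nodK.
  apply/mapP; exists (size t); first by rewrite mem_iota/= add0n ltnS size_prefix.
  by move: ts; rewrite prefixE => /eqP.
have /choice[pp ppP] : forall i, exists p : nat * nat, ~ G [set j | ~ link i j] ->
    [/\ p.1 \in A i, (p.2 < K)%N & G [set j | prefix (nod p.1) (nod (nth 0%N (A j) p.2))]].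
  move=> i; have [?|/bad[p ?]] := pselect (G [set j | ~ link i j]); last by exists p.
  by exists (0%N, 0%N).
have [q _ Gq] : exists2 q, q \in iota 0 K &
    G [set i | ~ G [set j | ~ link i j] /\ (pp i).2 = q].
  apply: ultra_list; apply: filterS Gbad => i /= ngood.
  by have [_ qK _] := ppP _ ngood; exists (pp i).2 => //; rewrite mem_iota add0n.
apply: (no_chain (P := fun i => P i /\ (~ G [set j | ~ link i j] /\ (pp i).2 = q))
  (t := fun i => nod (pp i).1) d0 (Ginf _ Gq)).
  by move=> i [_ [/ppP[/Anod[dg <-] _ _] _]].
move=> i j [_ [/ppP[_ _ Gi] qi]] [_ [/ppP[_ _ Gj] qj]].
(* For a common [k], the selected nodes of [i] and [j] are prefixes of the same node, the one at
   position [q] in [A k], hence comparable. *)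
have [k [/= pik pjk]] := filter_ex (filterI Gi Gj).
by rewrite qi in pik; rewrite qj in pjk; exact: prefix_comparable pik pjk.
Qed.


(** Each additional vector costs at most $5C^2s$ in the square. Given a finitely supported first
    vector, the others are taken pairwise unlinked at a threshold [d] so small that on each block
    they interact with the first essentially through the at most one of them that is large there.
    These interactions involve a total square of at most $nC^2$, and AM-GM with weight $s \ge \sqrt
    n$ balances them. *)
Lemma unlinked_sums (s : R) n : 1 <= s -> n%:R <= s ^+ 2 ->
  forall P : nat -> Prop, unbounded P ->
  exists D : seq nat, [/\ uniq D, size D = n, forall i, i \in D -> P i
    & forall Q, disjoint_family Q ->
        sqsum Q (fun j => \sum_(i <- D) g i j) <= n%:R * (5 * C ^+ 2 * s)].
Proof.
move=> s1; elim: n => [|n IH] ns P Pinf.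
  exists [::]; split=> // Q _; rewrite mul0r /sqsum big1// => p _.
  rewrite /block big1 ?mulr0 ?expr0n// => j _; by rewrite big_nil normr0.
have ns' : n%:R <= s ^+ 2 by apply: le_trans ns; rewrite ler_nat.
have [i1 _ Pi1] := Pinf 0%N.
pose H := (h i1).+1.
pose G1 := \sum_(j <- iota 0 H) `|g i1 j|.
have G10 : 0 <= G1 by exact: sumr_ge0.
have H0 : 0 < H%:R :> R by rewrite ltr0n.
have hH : (h i1 <= H)%N by [].
clearbody H.
have n0 : 0 <= n%:R :> R by [].
(* From scale [k0] on the weight alone makes [g i1] negligible. Below [k0] blocks have at most
   [width k0] points, and [d] makes small coordinates on them add up to little. The factor [H%:R]
   leaves an error of $1/H$ per block. *)
have [k0 hk0] := exists_pow2_gt (G1 * (n%:R * C) * H%:R).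
pose B := C * (n%:R * 2 ^+ (7 * (k0 * k0))) * H%:R + 1.
have B0 : 0 < B.
  by rewrite ltr_pwDr// !mulr_ge0// ?(ltW C_gt0)// exprn_ge0.
pose d := B^-1.
have d0 : 0 < d by rewrite invr_gt0.
have dB : d * B = 1 by rewrite mulVf ?gt_eqF.
have P1inf : unbounded (fun i => P i /\ (i1 < i)%N).
  move=> b; have [i bi Pi] := Pinf (maxn b i1.+1); exists i.
    by rewrite (leq_trans _ bi)// leq_maxl.
  by split=> //; rewrite (leq_trans _ bi)// leq_maxr.
have [P1 [P1inf' P1P P1u]] := unlinked_subsequence d0 P1inf.
have [D [uD sD DP HD]] := IH ns' P1 P1inf'.
exists (i1 :: D); split=> /=.
- by rewrite uD andbT; apply/negP => /DP/P1P[_]; rewrite ltnn.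
- by rewrite sD.
- by move=> i; rewrite inE => /orP[/eqP->//|/DP/P1P[]].
move=> Q fQ; have [aQ uQ] := fQ.
pose b1 p := block p (g i1).
pose bR p := block p (fun j => \sum_(i <- D) g i j).
pose big (p : nat * seq nat) i := has (fun j => d <= `|g i j|) p.2.
pose M p := \sum_(i <- D | big p i) block p (g i).
have bC p i : p \in Q -> block p (g i) <= C.
  by move=> pQ; exact: block_norm_le (ltW C_gt0) (aQ _ pQ) (g_norm i).
have node_of i j : d <= `|g i j| -> j = idx 0 (nod j).
  move=> dg; have /g_supp[_ [t _ ->]] : g i j != 0 by rewrite -normr_gt0 (lt_le_trans d0).
  by rewrite nodK.
(* A block is a chain, or a singleton at scale 0, whereas large nodes of distinct unlinked vectors
   are incomparable. *)
have big_eq p i j : p \in Q -> i \in D -> j \in D -> big p i -> big p j -> i = j.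
  move=> /aQ[_ sp hp] iD jD /hasP[a ap da] /hasP[b bp db].
  apply/eqP; apply: contraT => ij.
  have := P1u i j (nod a) (nod b) (DP _ iD) (DP _ jD) ij.
  rewrite -(node_of _ _ da) -(node_of _ _ db) => /(_ da db) /negP; case.
  case: hp => [p0|[c [tau [_ [hc ch]]]]].
    move: sp ap bp; rewrite p0 (_ : width 0 = 1%N)//; case: (p.2) => [|y [|//]]//= _.
    by rewrite !inE => /eqP-> /eqP->; rewrite /comparable_nodes prefix_refl.
  have [t aE _] := hc _ ap.
  have c0 : 0%N = c by move: (node_of _ _ da); rewrite {1}aE => /(pcan_inj pickleK)[].
  by apply: ch; rewrite -c0 -?(node_of _ _ da) -?(node_of _ _ db).
have M2 p : p \in Q -> M p ^+ 2 <= \sum_(i <- D) block p (g i) ^+ 2.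
  move=> pQ; apply: (@le_trans _ _ (\sum_(i <- D | big p i) block p (g i) ^+ 2)); last first.
    by rewrite [leRHS](bigID (big p))/= lerDl sumr_ge0// => i _; exact: sqr_ge0.
  rewrite /M -big_filter -[leRHS]big_filter.
  have uF : uniq [seq i <- D | big p i] by exact: filter_uniq.
  have : forall i j, i \in [seq i <- D | big p i] -> j \in [seq i <- D | big p i] -> i = j.
    by move=> i j; rewrite !mem_filter => /andP[bi iD] /andP[bj jD]; exact: (big_eq p i j pQ iD jD bi bj).
  case: [seq i <- D | big p i] uF => [|i [|j L]] /=; first by rewrite !big_nil expr0n.
    by rewrite !big_seq1.
  by rewrite inE negb_or => /andP[/andP[ij _] _] /(_ i j); rewrite !inE !eqxx orbT => /(_ isT isT) /eqP; rewrite (negPf ij).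
have M0 p : 0 <= M p by rewrite sumr_ge0// => i _; exact: block_ge0.
have b10 p : 0 <= b1 p by exact: block_ge0.
pose hits (p : nat * seq nat) : R := (has (fun j => (j < H)%N) p.2)%:R.
(* The error is charged only to blocks meeting the indices below [H]; disjointness allows at most
   [H] of them, so all errors add up to at most 1. *)
have cross p : p \in Q -> b1 p * bR p <= b1 p * M p + hits p / H%:R.
  move=> pQ; have [up wp hp] := aQ _ pQ.
  have bRle : bR p <= M p + \sum_(i <- D | ~~ big p i) block p (g i).
    by rewrite (le_trans (block_sum _ _ _))// (bigID (big p)).
  have mass1 : \sum_(j <- p.2) `|g i1 j| <= G1.
    rewrite (bigID (fun j => (j < H)%N))/= [X in _ + X]big1 ?addr0; last first.
      move=> j; rewrite -leqNgt => Hj; apply/eqP; rewrite normr_eq0.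
      by apply: contraTT Hj => /g_supp[jh _]; rewrite -ltnNge (leq_trans jh).
    rewrite -big_filter /G1.
    rewrite [leRHS](bigID (fun j => j \in p.2))/= ler_wpDr ?sumr_ge0//.
    rewrite -[leRHS]big_filter le_eqVlt; apply/orP; left; apply/eqP; apply: perm_big.
    apply: uniq_perm; rewrite ?filter_uniq ?iota_uniq//.
    by move=> j; rewrite !mem_filter mem_iota add0n andbC.
  rewrite /hits; have [hit|nohit] := boolP (has _ _); last first.
    have b1E : b1 p = 0.
      rewrite /b1 /block big_seq big1 ?mulr0// => j jp; apply/eqP; rewrite normr_eq0.
      apply: contraT => /g_supp[jh _]; move/hasPn: nohit => /(_ j jp).
      by rewrite (leq_trans jh).
    by rewrite b1E !mul0r addr0.
  apply: (le_trans (ler_wpM2l (b10 p) bRle)); rewrite mulrDr lerD2l.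
  rewrite mul1r -div1r ler_pdivlMr//.
  have small i : i \in D -> ~~ big p i -> block p (g i) <= theta R p.1 * ((size p.2)%:R * d).
    move=> iD nbig; rewrite ler_pM2l ?theta_gt0// big_seq.
    rewrite (@le_trans _ _ (\sum_(j <- p.2 | j \in p.2) d))//.
      by apply: ler_sum => j jp; rewrite ltW// ltNge; apply: contra nbig => dg; apply/hasP; exists j.
    by rewrite -big_seq big_const_seq iter_addr_0 count_predT -[d *+ _]mulr_natl.
  have sumD (c : R) : 0 <= c -> (forall i, i \in D -> ~~ big p i -> block p (g i) <= c) ->
      \sum_(i <- D | ~~ big p i) block p (g i) <= n%:R * c.
    move=> c0 hc; rewrite big_seq_cond.
    rewrite (@le_trans _ _ (\sum_(i <- D | (i \in D) && ~~ big p i) c))//.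
      by apply: ler_sum => i /andP[]; exact: hc.
    rewrite -big_seq_cond (@le_trans _ _ (\sum_(i <- D) c))//.
      by rewrite [leRHS](bigID (fun i => ~~ big p i))/= lerDl sumr_ge0.
    by rewrite big_const_seq iter_addr_0 count_predT sD -[c *+ _]mulr_natl.
  have sum0 : 0 <= \sum_(i <- D | ~~ big p i) block p (g i).
    by rewrite sumr_ge0// => i _; exact: block_ge0.
  have [kk|kk] := leqP k0 p.1.
    have b1le : b1 p <= theta R p.1 * G1 by rewrite ler_pM2l ?theta_gt0.
    have sle := sumD C (ltW C_gt0) (fun i _ _ => bC p i pQ).
    rewrite (le_trans (ler_wpM2r (ltW H0) (ler_pM (b10 p) sum0 b1le sle)))//.
    rewrite -!mulrA ler_pdivrMl ?exprn_gt0// mulr1 !mulrA.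
    rewrite -mulrA in hk0; rewrite !mulrA in hk0.
    by apply: ltW; apply: hk0; case: (p.1) kk => // k kk; rewrite (leq_trans kk)// leq_pmulr.
  have c0 : 0 <= 2 ^+ (7 * (k0 * k0)) * d by rewrite mulr_ge0 ?exprn_ge0// ltW.
  have small' i : i \in D -> ~~ big p i -> block p (g i) <= 2 ^+ (7 * (k0 * k0)) * d.
    move=> iD /(small _ iD) /le_trans; apply; rewrite mulrA ler_pM2r//.
    apply: (@le_trans _ _ (theta R p.1 * 2 ^+ (8 * (p.1 * p.1)))).
      by rewrite ler_pM2l ?theta_gt0// -natrX ler_nat.
    rewrite theta_width; apply: ler_weXn2l; first by lra.
    by rewrite leq_mul2l /= leq_mul// ltnW.
  have sle := sumD _ c0 small'.
  rewrite (le_trans (ler_wpM2r (ltW H0) (ler_pM (b10 p) sum0 (bC _ _ pQ) sle)))//.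
  have -> : C * (n%:R * (2 ^+ (7 * (k0 * k0)) * d)) * H%:R = d * (B - 1) by rewrite /B; lra.
  by rewrite mulrBr dB mulr1 lerBlDr lerDl ltW.
have hitsle : \sum_(p <- Q) hits p <= H%:R.
  rewrite (@le_trans _ _ (\sum_(p <- Q) (count (fun j => (j < H)%N) p.2)%:R))//.
    by apply: ler_sum => p _; rewrite ler_nat has_count; case: (count _ _).
  rewrite -natr_sum ler_nat.
  have -> : (\sum_(p <- Q) count (fun j => j < H) p.2 =
      count (fun j => j < H) (flatten (map snd Q)))%N.
    by rewrite count_flatten sumnE !big_map.
  rewrite -size_filter -{2}(size_iota 0 H); apply: uniq_leq_size; first exact: filter_uniq.
  by move=> j; rewrite mem_filter mem_iota => /andP[].
have sq1 : \sum_(p <- Q) b1 p ^+ 2 <= C ^+ 2 := g_norm i1 fQ.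
have sqR := HD Q fQ; rewrite -/(sqsum Q _) in sqR.
have sqM : \sum_(p <- Q) M p ^+ 2 <= n%:R * C ^+ 2.
  rewrite big_seq (le_trans (ler_sum _ M2))// -big_seq exchange_big/= big_seq.
  rewrite (@le_trans _ _ (\sum_(i <- D | i \in D) C ^+ 2))//.
    by apply: ler_sum => i _; exact: g_norm.
  by rewrite -big_seq big_const_seq iter_addr_0 count_predT sD -[C ^+ 2 *+ _]mulr_natl.
have s0 : 0 < s by exact: lt_le_trans s1.
have amgm p : 2 * (b1 p * M p) <= s * b1 p ^+ 2 + s^-1 * M p ^+ 2.
  have : 0 <= s^-1 * (s * b1 p - M p) ^+ 2 by rewrite mulr_ge0 ?sqr_ge0// invr_ge0 ltW.
  have -> : s^-1 * (s * b1 p - M p) ^+ 2 = (s^-1 * s) * s * b1 p ^+ 2 -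
     2 * (s^-1 * s) * (b1 p * M p) + s^-1 * M p ^+ 2 by lra.
  by rewrite mulVf ?gt_eqF//; lra.
have step p : p \in Q -> block p (fun j => \sum_(i <- i1 :: D) g i j) ^+ 2 <=
    b1 p ^+ 2 + bR p ^+ 2 + s * b1 p ^+ 2 + s^-1 * M p ^+ 2 + 2 / H%:R * hits p.
  move=> pQ.
  have le1 : block p (fun j => \sum_(i <- i1 :: D) g i j) <= b1 p + bR p.
    rewrite (@eq_block _ _ _ (fun j => g i1 j + \sum_(i <- D) g i j)); first exact: blockD.
    by move=> j; rewrite big_cons.
  have := cross p pQ; have := amgm p.
  have : block p (fun j => \sum_(i <- i1 :: D) g i j) ^+ 2 <= (b1 p + bR p) ^+ 2.
    by rewrite ler_sqr ?nnegrE ?addr_ge0 ?block_ge0.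
  rewrite (_ : 2 / H%:R * hits p = 2 * (hits p / H%:R)); last by lra.
  set u := _ / _; lra.
(* Tally for the new vector: $C^2$ for its own square, $sC^2$ and $s^{-1}nC^2 \le sC^2$ from AM-GM,
   and 2 for the errors, in all at most $5sC^2$. *)
rewrite /sqsum big_seq (le_trans (ler_sum _ step))// -big_seq !big_split/= -!mulr_sumr.
have hh : 2 / H%:R * \sum_(p <- Q) hits p <= 2.
  by rewrite mulrAC ler_pdivrMr// ler_pM2l.
have hM : s^-1 * \sum_(p <- Q) M p ^+ 2 <= s * C ^+ 2.
  rewrite ler_pdivrMl// (le_trans sqM)//.
  have -> : s * (s * C ^+ 2) = s ^+ 2 * C ^+ 2 by lra.
  by rewrite ler_wpM2r ?sqr_ge0.
have h1 : s * \sum_(p <- Q) b1 p ^+ 2 <= s * C ^+ 2 by rewrite ler_pM2l.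
have C2 : 1 <= C ^+ 2 by rewrite exprn_ege1.
have sC : C ^+ 2 <= s * C ^+ 2 by rewrite ler_peMl// ltW// (lt_le_trans ltr01).
move: sqR; rewrite /sqsum -/bR -[n.+1%:R]natr1 => sqR.
have -> : (n%:R + 1) * (5 * C ^+ 2 * s) = n%:R * (5 * C ^+ 2 * s) + 5 * (s * C ^+ 2) by lra.
lra.
Qed.

(** With $n = 2^{8m^2}$ and $s = 2^{4m^2} = \sqrt n$, some sum of [width m] vectors has squared norm
    at most $5C^2\,2^{12m^2}$, whereas the lower estimate demands $2^{14m^2}$ up to a constant. *)
Theorem no_branch_image : False.
Proof.
have xinj : injective (fun l => pickle (mkseq x l)).
  by move=> l l' /(pcan_inj pickleK)/(congr1 size); rewrite !size_mkseq.
(* The clash is $(E/2)^2 < C^2K^2$ with $E = 2^{7m^2}$ and $K^2 = 5C^2\,2^{12m^2}$, that is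
   $2^{2m^2} < 20\,C^4$. *)
have [m0 hm0] := exists_pow2_gt (5 * C ^+ 4 * 4).
have [l _ ml] := injective_unbounded xinj m0.+1 0%N.
set m := pickle _ in ml.
have mE : m = pickle (mkseq x l) by [].
clearbody m.
have s1 : 1 <= 2 ^+ (4 * (m * m)) :> R by apply: exprn_ege1; lra.
have Pinf : unbounded (fun i => (l <= i)%N).
  by move=> b; exists (maxn l b); rewrite ?leq_maxl ?leq_maxr.
have [|D [uD sD Dl HD]] := unlinked_sums (n := width m) s1 _ Pinf.
  by rewrite /width natrX -exprM; apply: ler_weXn2l; [lra|lia].
pose K := Num.sqrt ((width m)%:R * (5 * C ^+ 2 * 2 ^+ (4 * (m * m)))) : R.
have K0 : 0 <= K by exact: sqrtr_ge0.
have W0 : 0 <= (width m)%:R * (5 * C ^+ 2 * 2 ^+ (4 * (m * m))) :> R.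
  by rewrite !mulr_ge0 ?(ltW C_gt0) ?exprn_ge0.
have := g_lower uD sD mE Dl K0; rewrite /tree_norm_le sqr_sqrtr// => /(_ HD) low.
have K2 : K ^+ 2 = 5 * C ^+ 2 * 2 ^+ (12 * (m * m)).
  rewrite sqr_sqrtr// mulrCA /width natrX -exprD; congr (_ * _ ^+ _).
  lia.
set E := 2 ^+ (7 * (m * m)) in low.
have E1 : 1 <= E by apply: exprn_ege1; lra.
have E2 : E ^+ 2 = 2 ^+ (12 * (m * m)) * 2 ^+ (2 * (m * m)).
  by rewrite /E -exprM -exprD; congr (_ ^+ _); lia.
have big : 5 * C ^+ 4 * 4 < 2 ^+ (2 * (m * m)).
  by apply: hm0; rewrite (leq_trans (ltnW ml))//; by case: (m) => // k; rewrite mulnA leq_pmull.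
have F0 : 0 < 2 ^+ (12 * (m * m)) :> R by rewrite exprn_gt0.
have CE : 2 * C < E.
  have hsq : (2 * C) ^+ 2 < E ^+ 2.
    have u1 : 1 <= 2 ^+ (12 * (m * m)) :> R by apply: exprn_ege1; lra.
    rewrite E2 (@lt_le_trans _ _ (2 ^+ (2 * (m * m))))//; last first.
      by rewrite ler_peMl// exprn_ge0.
    apply: le_lt_trans big; rewrite (_ : C ^+ 4 = C ^+ 2 * C ^+ 2); last by rewrite -exprD.
    by have := exprn_ege1 2 C_ge1; rewrite exprMn; move: (C ^+ 2) => c c1; have := sqr_ge0 (c - 1); lra.
  by rewrite -(@ltr_pXn2r _ 2)// ?nnegrE ?mulr_ge0 ?(ltW C_gt0)// (le_trans ler01).
have hlt : E / 2 < C * K by lra.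
have E20 : 0 <= E / 2 by lra.
have : (E / 2) ^+ 2 < (C * K) ^+ 2.
  by rewrite ltr_pXn2r// nnegrE (le_trans E20)// ltW.
rewrite expr_div_n exprMn K2 E2.
have -> : C ^+ 2 * (5 * C ^+ 2 * 2 ^+ (12 * (m * m))) = 5 * C ^+ 4 * 2 ^+ (12 * (m * m)) by lra.
move: big F0; move: (2 ^+ (12 * (m * m))) (2 ^+ (2 * (m * m))) (5 * C ^+ 4) => u v w.
nra.
Qed.


End Core.

(** * The Banach space defined by the tree norm *)

Section TreeSpace.
Variable R : realType.
Implicit Types (f g : nat -> R) (e K : R).

Definition tail n f : nat -> R := fun i => if (i < n)%N then 0 else f i.

Lemma tail_norm_le m n f e : (m <= n)%N -> tree_norm_le (tail m f) e ->
  tree_norm_le (tail n f) e.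
Proof.
move=> mn; apply: tree_norm_le_mono => i; rewrite /tail.
case: ltnP => [_|ni]; first by rewrite normr0.
by rewrite ltnNge (leq_trans mn ni).
Qed.

Lemma sum_squares_le_square (T : eqType) (s : seq T) (a : T -> R) :
  (forall q, 0 <= a q) -> \sum_(q <- s) a q ^+ 2 <= (\sum_(q <- s) a q) ^+ 2.
Proof.
move=> a0; elim: s => [|q s IH]; first by rewrite !big_nil expr0n.
rewrite !big_cons; have s0 : 0 <= \sum_(j <- s) a j by exact: sumr_ge0.
have := mulr_ge0 (a0 q) s0; lra.
Qed.

Lemma theta_le1 k : theta R k <= 1.
Proof. by rewrite /theta invf_le1 ?exprn_gt0// exprn_ege1//; lra. Qed.

(** Weights are at most 1 and blocks are disjoint, so the $\ell_1$ norm dominates. *)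
Lemma finite_support_norm_le n f : (forall i, (n <= i)%N -> f i = 0) ->
  tree_norm_le f (\sum_(i <- iota 0 n) `|f i|).
Proof.
move=> fn P [aP uP].
apply: (le_trans (sum_squares_le_square _ (fun p => block_ge0 p f))).
rewrite ler_sqr ?nnegrE ?sumr_ge0//; last by move=> p _; exact: block_ge0.
apply: (@le_trans _ _ (\sum_(p <- P) \sum_(i <- p.2) `|f i|)).
  by apply: ler_sum => p _; rewrite /block ler_piMl ?theta_le1// sumr_ge0.
rewrite -(big_map snd xpredT (fun F : seq nat => \sum_(i <- F) `|f i|)) -big_flatten/=.
rewrite (bigID (fun j => (j < n)%N))/= [X in _ + X]big1 ?addr0; last first.
  by move=> j; rewrite -leqNgt => /fn ->; rewrite normr0.
rewrite -big_filter [leRHS](bigID (fun j => j \in flatten (map snd P)))/= ler_wpDr ?sumr_ge0//.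
rewrite -[leRHS]big_filter le_eqVlt; apply/orP; left; apply/eqP; apply: perm_big.
apply: uniq_perm; rewrite ?filter_uniq ?iota_uniq//.
by move=> j; rewrite !mem_filter mem_iota add0n andbC.
Qed.

Lemma tail_bounded n f e : 0 <= e -> tree_norm_le (tail n f) e ->
  exists2 K, 0 <= K & tree_norm_le f K.
Proof.
move=> e0 fe; pose s := \sum_(i <- iota 0 n) `|if (i < n)%N then f i else 0|.
have s0 : 0 <= s by exact: sumr_ge0.
exists (s + e); first exact: addr_ge0.
apply: (tree_norm_le_mono (g := fun i => (if (i < n)%N then f i else 0) + tail n f i)).
  by move=> i; rewrite /tail; case: ifP; rewrite ?addr0 ?add0r.
apply: tree_norm_leD => //; apply: finite_support_norm_le => i.
by rewrite ltnNge => ->.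
Qed.

(* The closure of the finitely supported sequences under the tree norm. *)
Record tree_space := TreeSpace { tsval :> nat -> R ;
  tsvalP : forall e, 0 < e -> exists n, tree_norm_le (tail n tsval) e }.

Lemma tree_space_ext (v w : tree_space) : (forall i, v i = w i) -> v = w.
Proof.
case: v w => [v vP] [w wP] /= /funext vw; move: vP wP; rewrite vw => vP wP.
by congr TreeSpace; exact: Prop_irrelevance.
Qed.

HB.instance Definition _ := gen_eqMixin tree_space.
HB.instance Definition _ := gen_choiceMixin tree_space.

Lemma tree_zero_subproof e : 0 < e -> exists n, tree_norm_le (tail n (fun=> 0)) e.
Proof.
move=> e0; exists 0%N; apply: tree_norm_le_trans (lexx 0) (ltW e0) _.
by have := @finite_support_norm_le 0 (tail 0 (fun=> 0)); rewrite big_nil; apply=> i _.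
Qed.

Lemma tree_add_subproof (v w : tree_space) e :
  0 < e -> exists n, tree_norm_le (tail n (fun i => v i + w i)) e.
Proof.
move=> e0; have e20 : 0 < e / 2 by rewrite divr_gt0.
have [m hm] := tsvalP v e20; have [n hn] := tsvalP w e20.
exists (maxn m n); rewrite [e]splitr.
apply: (tree_norm_le_mono (g := fun i => tail (maxn m n) v i + tail (maxn m n) w i)).
  by move=> i; rewrite /tail; case: ifP; rewrite ?addr0.
apply: tree_norm_leD; rewrite ?ltW//.
  exact: tail_norm_le (leq_maxl _ _) hm.
exact: tail_norm_le (leq_maxr _ _) hn.
Qed.

Lemma tree_scale_subproof (a : R) (v : tree_space) e :
  0 < e -> exists n, tree_norm_le (tail n (fun i => a * v i)) e.
Proof.
move=> e0; have a0 : 0 < `|a| + 1 by rewrite ltr_wpDl.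
have [n hn] := tsvalP v (divr_gt0 e0 a0); exists n.
apply: (tree_norm_le_mono (g := fun i => a * tail n v i)).
  by move=> i; rewrite /tail; case: ifP; rewrite ?mulr0.
apply: tree_norm_le_trans (tree_norm_leZ a hn).
  by rewrite mulr_ge0// ltW// divr_gt0.
by rewrite mulrA ler_pdivrMr// mulrC ler_pM2l// lerDl.
Qed.

Definition tree_zero := TreeSpace tree_zero_subproof.
Definition tree_add v w := TreeSpace (tree_add_subproof v w).
Definition tree_scale a v := TreeSpace (tree_scale_subproof a v).

Lemma tree_addA : associative tree_add.
Proof. by move=> u v w; apply: tree_space_ext => i /=; rewrite addrA. Qed.
Lemma tree_addC : commutative tree_add.
Proof. by move=> u v; apply: tree_space_ext => i /=; rewrite addrC. Qed.
Lemma tree_add0 : left_id tree_zero tree_add.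
Proof. by move=> u; apply: tree_space_ext => i /=; rewrite add0r. Qed.
Lemma tree_addN : left_inverse tree_zero (tree_scale (-1)) tree_add.
Proof. by move=> u; apply: tree_space_ext => i /=; rewrite mulN1r addNr. Qed.

HB.instance Definition _ :=
  GRing.isZmodule.Build tree_space tree_addA tree_addC tree_add0 tree_addN.

Lemma tree_scaleA a b v : tree_scale a (tree_scale b v) = tree_scale (a * b) v.
Proof. by apply: tree_space_ext => i /=; rewrite mulrA. Qed.
Lemma tree_scale1 : left_id 1 tree_scale.
Proof. by move=> v; apply: tree_space_ext => i /=; rewrite mul1r. Qed.
Lemma tree_scaleDr : right_distributive tree_scale +%R.
Proof. by move=> a v w; apply: tree_space_ext => i /=; rewrite mulrDr. Qed.
Lemma tree_scaleDl v : {morph tree_scale^~ v : a b / a + b}.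
Proof. by move=> a b; apply: tree_space_ext => i /=; rewrite mulrDl. Qed.

HB.instance Definition _ := GRing.Zmodule_isLmodule.Build R tree_space
  tree_scaleA tree_scale1 tree_scaleDr tree_scaleDl.

Lemma tree_spaceD (v w : tree_space) i : (v + w) i = v i + w i. Proof. by []. Qed.
Lemma tree_spaceZ a (v : tree_space) i : (a *: v) i = a * v i. Proof. by []. Qed.
Lemma tree_spaceN (v : tree_space) i : (- v) i = - v i.
Proof. by rewrite -scaleN1r tree_spaceZ mulN1r. Qed.
Lemma tree_spaceB (v w : tree_space) i : (v - w) i = v i - w i.
Proof. by rewrite tree_spaceD tree_spaceN. Qed.
Lemma tree_space_sum (T : Type) (s : seq T) (P : pred T) (v : T -> tree_space) i :
  (\sum_(q <- s | P q) v q) i = \sum_(q <- s | P q) v q i.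
Proof. by elim/big_rec2: _ => // q a b _ <-. Qed.

Definition tree_norm (v : tree_space) : R :=
  sup [set Num.sqrt (sqsum P v) | P in disjoint_family].

Lemma disjoint_family_nil : disjoint_family [::]. Proof. by []. Qed.

Lemma tree_norm_has_sup (v : tree_space) :
  has_sup [set Num.sqrt (sqsum P v) | P in disjoint_family].
Proof.
split; first by exists (Num.sqrt (sqsum [::] v)), [::].
have [n hn] := tsvalP v ltr01.
have [K K0 hK] := tail_bounded ler01 hn.
exists K => _ [P fP <-].
by rewrite -(@ler_pXn2r _ 2)// ?nnegrE ?sqrtr_ge0// sqr_sqrtr ?sqsum_ge0// hK.
Qed.

Lemma le_tree_norm (v : tree_space) P : disjoint_family P ->
  Num.sqrt (sqsum P v) <= tree_norm v.
Proof. by move=> fP; apply: sup_upper_bound (tree_norm_has_sup v) _ _; exists P. Qed.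

Lemma tree_norm_ge0 v : 0 <= tree_norm v.
Proof. exact: le_trans (sqrtr_ge0 _) (le_tree_norm v disjoint_family_nil). Qed.

Lemma tree_normP (v : tree_space) : tree_norm_le v (tree_norm v).
Proof.
move=> P fP; rewrite -{1}(sqr_sqrtr (sqsum_ge0 P v)) ler_sqr ?nnegrE ?sqrtr_ge0 ?tree_norm_ge0//.
exact: le_tree_norm.
Qed.

Lemma tree_norm_leP (v : tree_space) K : 0 <= K ->
  tree_norm_le v K -> tree_norm v <= K.
Proof.
move=> K0 hK; apply: ge_sup; first by case: (tree_norm_has_sup v).
move=> _ [P fP <-].
by rewrite -(@ler_pXn2r _ 2)// ?nnegrE ?sqrtr_ge0// sqr_sqrtr ?sqsum_ge0// hK.
Qed.

Lemma tree_normD v w : tree_norm (v + w) <= tree_norm v + tree_norm w.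
Proof.
apply: tree_norm_leP; first by rewrite addr_ge0 ?tree_norm_ge0.
by apply: tree_norm_leD; rewrite ?tree_norm_ge0//; exact: tree_normP.
Qed.

Lemma tree_normZ (a : R) v : tree_norm (a *: v) = `|a| * tree_norm v.
Proof.
have le (b : R) w : tree_norm (b *: w) <= `|b| * tree_norm w.
  apply: tree_norm_leP; first by rewrite mulr_ge0 ?tree_norm_ge0.
  exact: tree_norm_leZ (tree_normP w).
apply/eqP; rewrite eq_le le/=.
have [->|a0] := eqVneq a 0; first by rewrite normr0 mul0r tree_norm_ge0.
rewrite -[in leLHS](scale1r v) -(mulVf a0) -scalerA mulrC -ler_pdivlMr ?normr_gt0//.
by rewrite mulrC -normfV le.
Qed.

Lemma tree_norm_eq0 v : tree_norm v = 0 -> v = 0.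
Proof.
move=> v0; apply: tree_space_ext => i; apply/eqP; rewrite -normr_le0.
by apply: tree_norm_le_coord => //; rewrite -v0; exact: tree_normP.
Qed.

HB.instance Definition _ := Lmodule_isNormed.Build R tree_space
  tree_normD tree_normZ tree_norm_eq0.

Lemma tree_space_normE (v : tree_space) : `|v| = tree_norm v. Proof. by []. Qed.

Lemma coord_le_norm (v : tree_space) i : `|v i| <= `|v|.
Proof. exact: tree_norm_le_coord (tree_norm_ge0 v) (tree_normP v). Qed.

(** The limit is taken coordinatewise. For a fixed family the square sum involves finitely many
    coordinates and passes to the limit; this gives closeness in norm and, through a nearby vector
    of the space, small tails. *)
Lemma tree_space_complete (F : set_system tree_space) :
  ProperFilter F -> cauchy F -> cvg F.
Proof.
move=> FF /cauchyP Fc.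
have Fe e : 0 < e -> exists x : tree_space, F [set y | `|x - y| < e].
  by move=> e0; have [x Fx] := Fc e e0; exists x; rewrite -ball_normE in Fx.
have evcvg i : cvg ((fun y : tree_space => y i) @ F).
  apply: cauchy_cvg; apply/cauchyP => e e0.
  have [x Fx] := Fe e e0; exists (x i).
  suff : F [set y : tree_space | ball (x i) e (y i)] by [].
  apply: filterS Fx => y /= h; rewrite -ball_normE /=.
  have := coord_le_norm (x - y) i; rewrite tree_spaceB => h'.
  exact: le_lt_trans h' h.
pose f i := lim ((fun y : tree_space => y i) @ F).
have close e x : 0 < e -> F [set y | `|x - y| < e] ->
    tree_norm_le (fun i => x i - f i) e.
  move=> e0 Fx P fP.
  have cv : (fun y : tree_space => sqsum P (fun i => x i - y i)) @ F -->
      sqsum P (fun i => x i - f i).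
    rewrite /sqsum; elim: P {fP} => [|p P IH].
      by under eq_fun do rewrite big_nil; rewrite big_nil; exact: cvg_cst.
    under eq_fun do rewrite big_cons; rewrite big_cons; apply: cvgD => //.
    have cb : (fun y : tree_space => block p (fun i => x i - y i)) @ F -->
        block p (fun i => x i - f i).
      apply: cvgMr; elim: (p.2) => [|i L IHL].
        by under eq_fun do rewrite big_nil; rewrite big_nil; exact: cvg_cst.
      under eq_fun do rewrite big_cons; rewrite big_cons; apply: cvgD => //.
      apply: cvg_norm; apply: cvgB; [exact: cvg_cst|exact: evcvg].
    by under eq_fun do rewrite expr2; rewrite expr2; exact: cvgM.
  rewrite -(cvg_lim _ cv)//; apply: limr_le; first by apply/cvg_ex; eexists; exact: cv.
  apply: filterS Fx => y /= xy.
  have := tree_normP (x - y) fP => h.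
  rewrite (le_trans (y := sqsum P (x - y)))//.
    by apply: sqsum_le => i; rewrite tree_spaceB.
  rewrite (le_trans h)// ler_sqr ?nnegrE ?tree_norm_ge0//; exact: ltW.
have fP e : 0 < e -> exists n, tree_norm_le (tail n f) e.
  move=> e0; have e20 : 0 < e / 2 by rewrite divr_gt0.
  have [x Fx] := Fe _ e20; have [n hn] := tsvalP x e20.
  exists n; rewrite [e]splitr.
  apply: (tree_norm_le_mono (g := fun i => tail n x i + -1 * tail n (fun i => x i - f i) i)).
    by move=> i; rewrite /tail; case: ifP; rewrite ?mulr0 ?addr0// mulN1r opprB addrC subrK.
  apply: tree_norm_leD; rewrite ?ltW//.
  have -> : e / 2 = `|-1 : R| * (e / 2) by rewrite normrN normr1 mul1r.
  apply: tree_norm_leZ; apply: tree_norm_le_mono (close _ _ e20 Fx) => i.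
  by rewrite /tail; case: ifP; rewrite ?normr0.
apply/cvg_ex; exists (TreeSpace fP); apply/cvgrPdist_le => e e0.
have e20 : 0 < e / 2 by rewrite divr_gt0.
have [x Fx] := Fe _ e20; apply: filterS (Fx) => y /= xy.
rewrite (_ : _ - y = (TreeSpace fP - x) + (x - y)); last by rewrite addrA subrK.
rewrite [e]splitr (le_trans (ler_normD _ _))// lerD//; last exact: ltW.
rewrite distrC; apply: tree_norm_leP; first exact: ltW.
apply: tree_norm_le_mono (close _ _ e20 Fx) => i.
by rewrite tree_spaceB.
Qed.

HB.instance Definition _ := Uniform_isComplete.Build tree_space tree_space_complete.

End TreeSpace.

(** * The unconditional basis and pullbacks along index maps *)

Section TreeBasis.
Variable R : realType.
Local Notation W := (tree_space R).

Lemma delta_subproof i (e : R) : 0 < e ->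
  exists n, tree_norm_le (tail n (fun j => (j == i)%:R)) e.
Proof.
move=> e0; exists i.+1; apply: tree_norm_le_trans (lexx 0) (ltW e0) _.
have := @finite_support_norm_le R 0 (tail i.+1 (fun j => (j == i)%:R)).
rewrite big_nil; apply=> j _; rewrite /tail; case: ltnP => // ij.
by case: eqP ij => // ->; rewrite ltnn.
Qed.

Definition tree_basis i : W := TreeSpace (delta_subproof i).

Lemma tree_basisE i j : tree_basis i j = (j == i)%:R. Proof. by []. Qed.

Lemma tree_basis_normalized : normalized tree_basis.
Proof.
move=> i; apply/eqP; rewrite eq_le; apply/andP; split; last first.
  by have := coord_le_norm (tree_basis i) i; rewrite tree_basisE eqxx normr1.
apply: tree_norm_leP => //.
have -> : 1 = \sum_(j <- iota 0 i.+1) `|tree_basis i j|.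
  rewrite (bigD1_seq i) ?iota_uniq ?mem_iota ?add0n ?ltnSn//= eqxx normr1 big1 ?addr0//.
  by move=> j /negPf ->; rewrite normr0.
apply: finite_support_norm_le => j ij; rewrite tree_basisE.
by case: eqP ij => // ->; rewrite ltnn.
Qed.

Lemma lincomb_tree_basisE (a : nat -> R) q j :
  lincomb a tree_basis q j = a q * (j == q)%:R.
Proof. by []. Qed.

Lemma series_tree_basisE (a : nat -> R) n j :
  series (lincomb a tree_basis) n j = if (j < n)%N then a j else 0.
Proof.
rewrite /series/= tree_space_sum.
under eq_bigr do rewrite lincomb_tree_basisE.
case: ltnP => jn.
  rewrite (bigD1_seq j) ?iota_uniq ?mem_index_iota//= eqxx mulr1 big1 ?addr0// => k kj.
  by rewrite eq_sym (negPf kj) mulr0.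
rewrite big_nat big1// => k /andP[_ kn]; case: eqP => [jk|_]; last by rewrite mulr0.
by move: kn; rewrite -jk ltnNge jn.
Qed.

Lemma cvg_tree_basis (v : W) : series (lincomb v tree_basis) @ \oo --> v.
Proof.
apply/cvgrPdist_le => e e0; have [m hm] := tsvalP v e0.
near=> n; apply: tree_norm_leP; first exact: ltW.
apply: tree_norm_le_mono (tail_norm_le (n := n) _ hm); last by near: n; exact: nbhs_infty_ge.
move=> i; rewrite tree_spaceB series_tree_basisE /tail.
by case: ifP; rewrite ?subrr ?subr0.
Unshelve. all: by end_near. Qed.

Lemma tree_basis_unique (a : nat -> R) (v : W) :
  series (lincomb a tree_basis) @ \oo --> v -> forall i, a i = v i.
Proof.
move=> av i; apply/eqP; rewrite -subr_eq0 -normr_le0; apply/ler_addgt0Pr => e e0.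
move/cvgrPdist_le: av => /(_ e e0)[N _ HN]; rewrite add0r.
have := HN (maxn N i.+1) (leq_maxl _ _) => /(le_trans (coord_le_norm _ i)).
by rewrite tree_spaceB series_tree_basisE leq_max ltnSn orbT distrC.
Qed.

(** The norm is monotone in the absolute values of the coordinates, so any partial sum containing
    the first $m$ terms is at least as close to [v] as the initial sum of length $m$. *)
Lemma tree_basis_rearrange (v : W) (s : nat -> nat) : bijective s ->
  series (lincomb v tree_basis \o s) @ \oo --> v.
Proof.
case=> t st ts; apply/cvgrPdist_le => e e0; have [m hm] := tsvalP v e0.
near=> n; apply: tree_norm_leP; first exact: ltW.
apply: tree_norm_le_mono hm => j; rewrite tree_spaceB /series/= tree_space_sum.
have -> : \sum_(0 <= q < n) (lincomb v tree_basis \o s) q j = if (t j < n)%N then v j else 0.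
  rewrite (eq_bigr (fun q => v (s q) * (j == s q)%:R))//.
  case: ltnP => jn.
    rewrite (bigD1_seq (t j)) ?iota_uniq ?mem_index_iota//= ts eqxx mulr1 big1 ?addr0// => k kj.
    by case: eqP => [jk|_]; rewrite ?mulr0//; rewrite jk st eqxx in kj.
  rewrite big_nat big1// => k /andP[_ kn]; case: eqP => [jk|_]; last by rewrite mulr0.
  by move: kn; rewrite -(st k) -jk ltnNge jn.
rewrite /tail; case: (ltnP j m) => jm; last by case: ifP; rewrite ?subrr ?subr0 ?normr0.
rewrite (_ : (t j < n)%N = true) ?subrr ?normr0//.
rewrite (@leq_trans (\max_(k < m) t k).+1)//.
  by rewrite ltnS (leq_bigmax (Ordinal jm)).
by near: n; exact: nbhs_infty_ge.
Unshelve. all: by end_near. Qed.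

Lemma tree_basis_unconditional : normalized_unconditional_basic tree_basis.
Proof.
split; first exact: tree_basis_normalized.
split; first split.
- move=> n; apply: subset_closure; exists n.+1, (fun i => (i == ord_max)%:R).
  rewrite big_ord_recr/= eqxx scale1r big1 ?add0r// => i _.
  by rewrite (_ : (_ == _) = false) ?scale0r//; apply/negbTE; rewrite -val_eqE/= neq_ltn ltn_ord.
- move=> z _; exists z; split; first exact: cvg_tree_basis.
  by move=> a az; apply/funext => i; rewrite (tree_basis_unique az).
- move=> z a _ az s bs; have -> : a = z by apply/funext => i; exact: tree_basis_unique az i.
  by apply/cvg_ex; exists z; exact: tree_basis_rearrange.
Qed.

(** Index [i] reads the entry at [h i], so entries move against the direction of [h]. *)
Definition pull (h : nat -> option nat) (f : nat -> R) : nat -> R :=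
  fun i => if h i is Some j then f j else 0.

Definition partial_embedding (h : nat -> option nat) :=
  (forall i j k, h i = Some k -> h j = Some k -> i = j) /\
  (forall p, admissible p -> admissible (p.1, pmap h p.2)).

Definition pull_bounded (h : nat -> option nat) (m : nat) :=
  forall (f : nat -> R) K, 0 <= K -> tree_norm_le f K -> tree_norm_le (pull h f) (m%:R * K).

(** The map [h] carries a disjoint family to one with the same scales, on which [f] has the square
    sum of its pullback; the pullback is therefore a contraction. *)
Lemma partial_embedding_bounded h : partial_embedding h -> pull_bounded h 1.
Proof.
move=> [hinj hadm] f K K0 fK P [aP uP].
rewrite mul1r; pose P' := [seq (p.1, pmap h p.2) | p <- P].
have -> : sqsum P (pull h f) = sqsum P' f.
  rewrite /sqsum big_map; apply: eq_bigr => p _; rewrite /block/=.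
  congr ((_ * _) ^+ 2); elim: (p.2) => [|i L IH] /=; first by rewrite !big_nil.
  by rewrite big_cons IH /pull; case: (h i) => [j|] /=; rewrite ?big_cons// normr0 add0r.
apply: fK; split.
  by move=> p /mapP[q /aP aq ->]; exact: hadm.
have -> : flatten (map snd P') = pmap h (flatten (map snd P)).
  rewrite -map_comp; elim: (P) => //= p L ->; rewrite pmap_cat//.
elim: (flatten _) uP => //= i L IH /andP[iL uL].
case hi: (h i) => [k|] /=; last exact: IH.
rewrite IH// andbT; apply: contra iL; rewrite mem_pmap => /mapP[j jL hj].
by rewrite (hinj _ _ _ hi (esym hj)).
Qed.

Lemma pull_boundedU h h1 h2 m1 m2 : pull_bounded h1 m1 -> pull_bounded h2 m2 ->
  (forall i, [\/ h i = None, h i = h1 i | h i = h2 i]) -> pull_bounded h (m1 + m2).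
Proof.
move=> b1 b2 hh f K K0 fK; rewrite natrD mulrDl.
have absK : tree_norm_le (fun i => `|f i|) K.
  by apply: tree_norm_le_mono fK => i; rewrite normr_id.
apply: (tree_norm_le_mono (g := fun i => pull h1 (fun i => `|f i|) i + pull h2 (fun i => `|f i|) i)).
  have p0 h' i : 0 <= pull h' (fun i => `|f i|) i by rewrite /pull; case: (h' i).
  move=> i; rewrite [leRHS]ger0_norm ?addr_ge0//.
  have pE h' : `|pull h' f i| = pull h' (fun i => `|f i|) i.
    by rewrite /pull; case: (h' i); rewrite ?normr0.
  have eqp h' : h i = h' i -> `|pull h f i| = pull h' (fun i => `|f i|) i.
    by move=> hi; rewrite -pE /pull hi.
  case: (hh i) => [hi|/eqp->|/eqp->]; last 2 first.
  - by rewrite lerDl.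
  - by rewrite lerDr.
  by rewrite {1}/pull hi normr0 addr_ge0.
by apply: tree_norm_leD; rewrite ?mulr_ge0//; [exact: b1|exact: b2].
Qed.

(** Finite fibres send small tails to small tails, which keeps pulled back vectors in the closure of
    the finitely supported ones. *)
Record pullback := Pullback { pmapping :> nat -> option nat; pbound : nat;
  pboundP : pull_bounded pmapping pbound;
  pfinite : forall j, exists b, forall i, (b <= i)%N -> pmapping i != Some j }.

Lemma pull_subproof (h : pullback) (v : W) e : 0 < e ->
  exists n, tree_norm_le (tail n (pull h v)) e.
Proof.
move=> e0; have m0 : 0 < (pbound h)%:R + 1 :> R by rewrite ltr_wpDl.
have [n hn] := tsvalP v (divr_gt0 e0 m0).
have [b hb] : exists b, forall i, (b <= i)%N -> forall j, (j < n)%N -> h i != Some j.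
  elim: (n) => [|k [b hb]]; first by exists 0%N.
  have [b' hb'] := pfinite h k; exists (maxn b b') => i.
  rewrite geq_max => /andP[bi b'i] j; rewrite ltnS leq_eqVlt => /orP[/eqP->|]; first exact: hb'.
  exact: hb.
exists b; apply: (tree_norm_le_mono (g := pull h (tail n v))).
  move=> i; rewrite {1}/tail; case: ltnP => bi; first by rewrite normr0.
  rewrite /pull; case hi: (h i) => [j|//]; rewrite /tail; case: ltnP => // jn.
  by have := hb i bi j jn; rewrite hi eqxx.
have K0 : 0 <= e / ((pbound h)%:R + 1) by rewrite ltW// divr_gt0.
apply: tree_norm_le_trans (pboundP h K0 hn); first by rewrite mulr_ge0.
by rewrite mulrA ler_pdivrMr// mulrC ler_pM2l// lerDl.
Qed.

Definition pull_op (h : pullback) (v : W) : W := TreeSpace (pull_subproof h v).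

Lemma pull_opE h v i : pull_op h v i = if h i is Some j then v j else 0.
Proof. by []. Qed.

Lemma pull_op_linear h : linear (pull_op h).
Proof.
move=> a v w; apply: tree_space_ext => i.
rewrite tree_spaceD tree_spaceZ !pull_opE; case: (h i) => [j|]; last by rewrite mulr0 addr0.
by rewrite tree_spaceD tree_spaceZ.
Qed.

Lemma pull_op_norm h v : `|pull_op h v| <= (pbound h)%:R * `|v|.
Proof.
apply: tree_norm_leP; first by rewrite mulr_ge0.
by apply: pboundP; rewrite ?tree_norm_ge0//; exact: tree_normP.
Qed.

End TreeBasis.

(** * Series in Banach spaces and the closed graph theorem *)

Lemma cvg_seqP (R : realType) (X : normedModType R) (s : nat -> X) (x : X) :
  s @ \oo --> x <-> forall e : R, 0 < e -> exists N, forall n, (N <= n)%N -> `|x - s n| <= e.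
Proof.
split=> [/cvgrPdist_le sx e /sx[N _ HN]|sx]; first by exists N => n Nn; exact: HN.
by apply/cvgrPdist_le => e /sx[N HN]; exists N.
Qed.

Lemma cvg_seq_unique (R : realType) (X : normedModType R) (s : nat -> X) (x y : X) :
  s @ \oo --> x -> s @ \oo --> y -> x = y.
Proof. by move=> sx sy; exact: (cvg_unique _ sx sy). Qed.

Lemma cauchy_seq_cvg (R : realType) (X : completeNormedModType R) (s : nat -> X) :
  (forall e : R, 0 < e -> exists N, forall m n, (N <= m)%N -> (m <= n)%N -> `|s n - s m| <= e) ->
  cvgn s.
Proof.
move=> sc; apply: cauchy_cvg; apply/cauchyP => e e0.
have e20 : 0 < e / 2 by rewrite divr_gt0.
have [N HN] := sc _ e20; exists (s N).
exists N => // n /= Nn; rewrite -ball_normE/= distrC (le_lt_trans (HN N n _ Nn))//.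
by rewrite ltr_pdivrMr// ltr_pMr// ltr1n.
Qed.

Lemma cvg_seq_cauchy (R : realType) (X : normedModType R) (s : nat -> X) (e : R) :
  cvgn s -> 0 < e -> exists N, forall m n, (N <= m)%N -> (N <= n)%N -> `|s n - s m| <= e.
Proof.
move=> /cvg_ex[x /cvg_seqP sx] e0; have e20 : 0 < e / 2 by rewrite divr_gt0.
have [N HN] := sx _ e20.
exists N => m n Nm Nn; rewrite (_ : s n - s m = (x - s m) - (x - s n)).
  by rewrite (le_trans (ler_normB _ _))// [e]splitr lerD// HN.
by rewrite opprB [RHS]addrC addrA subrK.
Qed.

Lemma cvg_norm_le (R : realType) (X : normedModType R) (s : nat -> X) (x : X) (K : R) :
  s @ \oo --> x -> (exists N, forall n, (N <= n)%N -> `|s n| <= K) -> `|x| <= K.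
Proof.
move=> /cvg_seqP sx [N HN]; apply/ler_addgt0Pr => e e0.
have [M HM] := sx e e0; rewrite -(subrK (s (maxn M N)) x) addrC.
rewrite (le_trans (ler_normD _ _))// lerD//; first by rewrite HN// leq_maxr.
by rewrite HM// leq_maxl.
Qed.

Lemma series_recr (R : realType) (X : normedModType R) (z : nat -> X) n :
  series z n.+1 = series z n + z n.
Proof. by rewrite /series/= big_nat_recr. Qed.

Lemma series_at0 (R : realType) (X : normedModType R) (z : nat -> X) : series z 0 = 0.
Proof. by rewrite /series/= big_geq. Qed.

Lemma bounded_sum_tail (R : realType) (a : nat -> R) (K e : R) :
  (forall n, 0 <= a n) -> (forall n, series a n <= K) -> 0 < e ->
  exists N, forall m n, (N <= m)%N -> (m <= n)%N -> \sum_(m <= k < n) a k <= e.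
Proof.
move=> a0 aK e0; have nd : {homo series a : m n / (m <= n)%N >-> m <= n}.
  by apply/nondecreasing_seqP => n; rewrite series_recr lerDl.
have : cvgn (series a).
  by apply: nondecreasing_is_cvgn nd _; exists K => _ [n _ <-].
move=> /cvg_seq_cauchy/(_ e0)[N HN]; exists N => m n Nm mn.
have := HN m n Nm (leq_trans Nm mn); rewrite -[_ n - _ m]/(_ - _) sub_series_geq//.
by rewrite ger0_norm// sumr_ge0.
Qed.

Section Zabreiko.
Variables (R : realType) (X : completeNormedModType R) (p : X -> R).
Hypothesis pZ : forall a x, p (a *: x) = `|a| * p x.
Hypothesis pD : forall x y, p (x + y) <= p x + p y.
Hypothesis pS : forall (z : nat -> X) x K, series z @ \oo --> x ->
  (forall n, \sum_(0 <= k < n) p (z k) <= K) -> p x <= K.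

(* Zabreiko's lemma: by Baire some sublevel set of [p] is dense in a ball around
   the origin, and successive approximation removes the closure. *)
Lemma seminorm_bounded : exists2 M, 0 < M & forall x, p x <= M * `|x|.
Proof.
have [n [r r0 Hr]] : exists n : nat, exists2 r, 0 < r &
    forall x, `|x| < r -> forall e, 0 < e -> exists2 a, p a <= n%:R & `|x - a| < e.
  pose A n := [set x | p x <= n%:R].
  have [n [D [x0 Dx0] [oD Dn]]] : exists n, exists2 D : set X, D !=set0 &
      open D /\ D `<=` closure (A n).
    apply: contrapT => H.
    have : forall i, open (~` closure (A i)) /\ dense (~` closure (A i)).
      move=> i; split; first by rewrite openC; exact: closed_closure.
      move=> D D0 oD; apply: contrapT => Di; apply: H; exists i, D => //; split=> //.
      by move=> x Dx; apply: contrapT => nx; apply: Di; exists x.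
    move=> /Baire/(_ setT) [||x [_ Hx]]; [by exists 0|exact: openT|].
    apply: (Hx (Num.truncn (p x)).+1 I); apply: subset_closure.
    by rewrite /A/= ltW// truncnS_gt.
  have /nbhs_ballP[r /= r0 xr] : nbhs x0 D by exact: open_nbhs_nbhs.
  (* A vector near the origin is a difference of two points near [x0], which doubles the level. *)
  exists (n + n)%N, r => // x xr' e e0; have e20 : 0 < e / 2 by rewrite divr_gt0.
  have app y : `|x0 - y| < r -> exists2 a, p a <= n%:R & `|y - a| < e / 2.
    move=> yr; have : closure (A n) y by apply: Dn; apply: xr; rewrite -ball_normE.
    move=> /(_ (ball y (e / 2)))[|a [Aa ya]]; first exact: nbhsx_ballx.
    by exists a => //; move: ya; rewrite -ball_normE.
  have [|a1 pa1 a1e] := app (x0 + x); first by rewrite opprD addrA subrr add0r normrN.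
  have [|a2 pa2 a2e] := app x0; first by rewrite subrr normr0.
  exists (a1 - a2).
    rewrite (le_trans (pD _ _))// -scaleN1r pZ normrN normr1 mul1r.
    by rewrite natrD lerD.
  have -> : x - (a1 - a2) = (x0 + x - a1) - (x0 - a2).
    by rewrite !opprB [RHS](AC (3*2) ((1*5)*(2*(4*3)))) /= subrr add0r.
  by rewrite (le_lt_trans (ler_normB _ _))// [e]splitr ltrD.
pose c := n%:R / (r / 2).
have c0 : 0 <= c by rewrite divr_ge0// ltW// divr_gt0.
have app x e : 0 < e -> exists a, p a <= c * `|x| /\ `|x - a| <= e.
  move=> e0; have [->|xn0] := eqVneq x 0.
    exists 0; rewrite subrr normr0 mulr0 (ltW e0) -(scale0r 0) pZ normr0 mul0r.
    by split.
  have x0 : 0 < `|x| by rewrite normr_gt0.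
  pose l := r / 2 / `|x|; have l0 : 0 < l by rewrite !divr_gt0.
  have le0 : 0 < l * e by rewrite mulr_gt0.
  have lx : `|l *: x| < r.
    by rewrite normrZ gtr0_norm// divfK ?gt_eqF// ltr_pdivrMr// ltr_pMr// ltr1n.
  have [a pa ae] := Hr _ lx _ le0.
  exists (l^-1 *: a); split.
    rewrite pZ gtr0_norm ?invr_gt0// invf_div mulrAC /c.
    rewrite [leRHS]mulrAC ler_pM2r ?invr_gt0 ?divr_gt0// mulrC ler_wpM2r//.
  have -> : x - l^-1 *: a = l^-1 *: (l *: x - a).
    by rewrite scalerBr scalerA mulVf ?gt_eqF// scale1r.
  rewrite normrZ gtr0_norm ?invr_gt0//.
  by rewrite ler_pdivrMl// ltW.
have /choice[nx nxP] : forall y : X * R, exists a, 0 < y.2 -> p a <= c * `|y.1| /\ `|y.1 - a| <= y.2.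
  move=> [x e]; have [e0|e0] := ltP 0 e; last by exists 0.
  by have [a ?] := app x e e0; exists a.
exists (2 * c + 1); first by rewrite ltr_wpDl// mulr_ge0.
move=> x; have [->|xn0] := eqVneq x 0.
  have p00 : p 0 = 0 by rewrite -[X in p X](scale0r 0) pZ normr0 mul0r.
  by rewrite p00 normr0 mulr0.
have x0 : 0 < `|x| by rewrite normr_gt0.
(* Each correction halves the remainder, so the costs [c * ek k] add up to at most $2c\|x\|$. *)
pose ek k : R := `|x| / 2 ^+ k.
have ek0 k : 0 < ek k by rewrite divr_gt0// exprn_gt0.
pose y := fix y k := if k is k'.+1 then y k' - nx (y k', ek k) else x.
pose z k := nx (y k, ek k.+1).
have yS k : y k.+1 = y k - z k by [].
have yle k : `|y k| <= ek k.
  case: k => [|k]; first by rewrite /ek expr0 divr1.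
  by rewrite yS; have [] := nxP (y k, ek k.+1) (ek0 _).
have sz n' : series z n' = x - y n'.
  elim: n' => [|k IH]; first by rewrite series_at0 /= subrr.
  by rewrite series_recr IH yS opprB addrA addrAC.
apply: (@le_trans _ _ (2 * c * `|x|)); last by rewrite ler_pM2r// lerDl.
apply: (pS (z := z)).
  apply/cvg_seqP => e e0.
  have [N HN] : exists N, forall n', (N <= n')%N -> `|x| / e < 2 ^+ n'.
    exists (Num.truncn (`|x| / e)).+1 => n' hn'.
    by rewrite (lt_le_trans (truncnS_gt _))// -natrX ler_nat (leq_trans hn')// ltnW// ltn_expl.
  exists N => n' /HN h; rewrite sz opprB addrC subrK (le_trans (yle _))// /ek.
  by rewrite ler_pdivrMr ?exprn_gt0// mulrC -ler_pdivrMr// ltW.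
move=> n'; rewrite (@le_trans _ _ (c * \sum_(0 <= k < n') ek k))//.
  rewrite mulr_sumr; apply: ler_sum => k _.
  have [pz _] := nxP (y k, ek k.+1) (ek0 _).
  by apply: le_trans pz _; apply: ler_wpM2l => //; exact: yle.
rewrite [leRHS](_ : _ = c * (2 * `|x|)); last by lra.
apply: ler_wpM2l => //.
have -> : \sum_(0 <= k < n') ek k = 2 * `|x| - 2 * ek n'.
  elim: n' => [|k IH]; first by rewrite big_geq// /ek expr0 divr1 subrr.
  have -> : ek k.+1 = ek k / 2 by rewrite /ek exprS invfM mulrA mulrAC.
  by rewrite big_nat_recr//= IH; lra.
by rewrite gerBl mulr_ge0// ltW.
Qed.

End Zabreiko.

(** The seminorm $\|Lx\|$ is countably subadditive: if the sums of $\|L z_k\|$ stay bounded, the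
    series of the $L z_k$ converges, and the closed graph identifies its sum. *)
Lemma closed_graph_bounded (R : realType) (X Y : completeNormedModType R) (L : X -> Y) :
  linear L ->
  (forall (s : nat -> X) x y, s @ \oo --> x -> (L \o s) @ \oo --> y -> y = L x) ->
  exists2 M, 0 < M & forall x, `|L x| <= M * `|x|.
Proof.
move=> linL cg; pose L' : {linear X -> Y} := HB.pack L (GRing.isLinear.Build _ _ _ _ L linL).
have LE x : L x = L' x by [].
apply: seminorm_bounded => [a x|x y|z x K zx zK].
- by rewrite !LE linearZ normrZ.
- by rewrite !LE linearD ler_normD.
have Ls n : L (series z n) = series (L \o z) n by rewrite LE -[series z n]/(\sum_(0 <= k < n) z k) linear_sum.
have cy : cvgn (series (L \o z)).
  apply: cauchy_seq_cvg => e e0.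
  have [N HN] := bounded_sum_tail (a := fun k => `|L (z k)|) (fun=> normr_ge0 _) zK e0.
  exists N => m n Nm mn; rewrite -[_ n - _ m]/(_ - _) sub_series_geq//.
  by rewrite (le_trans (ler_norm_sum _ _ _))// HN.
have Ly : (L \o series z) @ \oo --> limn (series (L \o z)).
  by rewrite (_ : L \o series z = series (L \o z))//; apply/funext => n /=; rewrite Ls.
rewrite -(cg _ _ _ zx Ly); apply: (cvg_norm_le cy); exists 0%N => n _.
by rewrite (le_trans (ler_norm_sum _ _ _)).
Qed.

Lemma subACA (V : zmodType) (a b c d : V) : (a - b) - (c - d) = (a - c) - (b - d).
Proof. by rewrite !opprB addrACA [RHS]addrACA [- b + _]addrC. Qed.

(** * Coefficient functionals of a Schauder basis *)

Section Coefficients.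
Variables (R : realType) (X : completeNormedModType R) (u : nat -> X).
Hypothesis u1 : normalized u.
Hypothesis ub : schauder_basis_of setT u.

Lemma coef_exists (z : X) : exists a : nat -> R, series (lincomb a u) @ \oo --> z.
Proof. by have [_ /(_ z I)[a [az _]]] := ub; exists a. Qed.

Definition coef (z : X) : nat -> R := projT1 (cid (coef_exists z)).

Lemma coefP z : series (lincomb (coef z) u) @ \oo --> z.
Proof. exact: (projT2 (cid (coef_exists z))). Qed.
Arguments coefP : clear implicits.

Lemma coef_unique (z : X) (a : nat -> R) : series (lincomb a u) @ \oo --> z -> coef z = a.
Proof.
have [_ /(_ z I)[b [_ bU]]] := ub; move=> az.
by rewrite -(bU _ az) -(bU _ (coefP z)).
Qed.

Lemma series_lincombD a b c n : series (lincomb (fun i => c * a i + b i) u) n =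
  c *: series (lincomb a u) n + series (lincomb b u) n.
Proof.
elim: n => [|n IH]; first by rewrite !series_at0 scaler0 addr0.
by rewrite !series_recr IH /lincomb scalerDr scalerDl scalerA addrACA.
Qed.

Lemma coef_linear c z w i : coef (c *: z + w) i = c * coef z i + coef w i.
Proof.
rewrite (@coef_unique _ (fun i => c * coef z i + coef w i))//.
have -> : series (lincomb (fun i => c * coef z i + coef w i) u) =
    (fun n => c *: series (lincomb (coef z) u) n + series (lincomb (coef w) u) n).
  by apply/funext => n; rewrite series_lincombD.
apply: cvgD; last exact: coefP.
by apply: cvgZr; exact: coefP.
Qed.

Lemma coef0 i : coef 0 i = 0.
Proof. by have := coef_linear 1 0 0 i; rewrite scale1r addr0 mul1r => /eqP; rewrite -subr_eq0 opprD addrA subrr sub0r oppr_eq0 => /eqP. Qed.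

Lemma coefD z w i : coef (z + w) i = coef z i + coef w i.
Proof. by rewrite -[z]scale1r coef_linear mul1r scale1r. Qed.

Lemma coefZ c z i : coef (c *: z) i = c * coef z i.
Proof. by rewrite -[c *: z]addr0 coef_linear coef0 addr0. Qed.

Lemma coefN z i : coef (- z) i = - coef z i.
Proof. by rewrite -scaleN1r coefZ mulN1r. Qed.

Definition partial_sum n z := series (lincomb (coef z) u) n.

Lemma partial_sumD n z w : partial_sum n (z + w) = partial_sum n z + partial_sum n w.
Proof.
rewrite -[z in LHS]scale1r -[partial_sum n z]scale1r -series_lincombD.
by congr (series (lincomb _ u) n); apply/funext => i; rewrite coef_linear.
Qed.

Lemma partial_sumZ n c z : partial_sum n (c *: z) = c *: partial_sum n z.
Proof.
rewrite /partial_sum; elim: n => [|n IH]; first by rewrite !series_at0 scaler0.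
by rewrite !series_recr IH scalerDr /lincomb coefZ scalerA.
Qed.

Lemma partial_sum_bounded z : has_ubound [set `|partial_sum n z| | n in setT].
Proof.
have : cvgn (series (lincomb (coef z) u)) by apply/cvg_ex; exists z; exact: coefP.
move=> /cvg_seq_cauchy/(_ ltr01)[N HN].
exists (\sum_(i < N.+1) `|partial_sum i z| + 1) => _ [n _ <-].
have [nN|/ltnW Nn] := leqP n N.
  rewrite (@le_trans _ _ (\sum_(i < N.+1) `|partial_sum i z|))//; last by rewrite lerDl.
  by rewrite (bigD1 (Ordinal (nN : (n < N.+1)%N)))//= lerDl sumr_ge0.
rewrite -(subrK (partial_sum N z) (partial_sum n z)) addrC (le_trans (ler_normD _ _))// lerD//.
  by rewrite big_ord_recr/= lerDr sumr_ge0.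
exact: HN.
Qed.

Let p z := sup [set `|partial_sum n z| | n in setT].

Let p_sup z : has_sup [set `|partial_sum n z| | n in setT].
Proof. by split; [exists `|partial_sum 0 z|, 0%N|exact: partial_sum_bounded]. Qed.

Let le_p n z : `|partial_sum n z| <= p z.
Proof. by apply: sup_upper_bound (p_sup z) _ _; exists n. Qed.

Let p_le z K : (forall n, `|partial_sum n z| <= K) -> p z <= K.
Proof. by move=> zK; apply: ge_sup; [case: (p_sup z)|move=> _ [n _ <-]]. Qed.

Let p_ge0 z : 0 <= p z.
Proof. exact: le_trans (normr_ge0 _) (le_p 0 z). Qed.

Lemma coef_le_sup z i : `|coef z i| <= 2 * p z.
Proof.
have -> : `|coef z i| = `|partial_sum i.+1 z - partial_sum i z|.
  by rewrite /partial_sum series_recr addrC addKr /lincomb normrZ u1 mulr1.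
by rewrite (le_trans (ler_normB _ _))// mulr_natl mulr2n lerD.
Qed.

(** The seminorm $\sup_n \|P_n z\|$ is countably subadditive: along a series with bounded sums of
    seminorms the $P_n$ are Cauchy uniformly in $n$, the limits of the coefficients still expand the
    sum of the series, and uniqueness makes them its coefficients. *)
Lemma partial_sums_uniform : exists2 M, 0 < M & forall n z, `|partial_sum n z| <= M * `|z|.
Proof.
suff [M M0 HM] : exists2 M, 0 < M & forall z, p z <= M * `|z|.
  by exists M => // n z; exact: le_trans (le_p n z) (HM z).
apply: seminorm_bounded => [a z|z w|zz x K zx zK].
- have le b y : p (b *: y) <= `|b| * p y.
    apply: p_le => n; rewrite partial_sumZ normrZ ler_wpM2l//; exact: le_p.
  apply/eqP; rewrite eq_le le/=; have [->|a0] := eqVneq a 0; first by rewrite normr0 mul0r.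
  rewrite -[z in leLHS](scalerK a0) mulrC -ler_pdivlMr ?normr_gt0// mulrC -normfV.
  exact: le.
- apply: p_le => n; rewrite partial_sumD (le_trans (ler_normD _ _))// lerD//; exact: le_p.
have pz n : partial_sum n (series zz 0) = 0 by rewrite series_at0 -[X in partial_sum n X](scale0r 0) partial_sumZ scale0r.
pose s N := series zz N.
have psB n m N : (m <= N)%N ->
    `|partial_sum n (s N) - partial_sum n (s m)| <= \sum_(m <= k < N) p (zz k).
  elim: N => [|N IH]; first by rewrite leqn0 => /eqP->; rewrite subrr normr0 big_geq.
  rewrite leq_eqVlt => /orP[/eqP<-|mN]; first by rewrite subrr normr0 big_geq.
  rewrite big_nat_recr//= /s series_recr partial_sumD addrAC (le_trans (ler_normD _ _))// lerD//.
  exact: IH.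
have tails e : 0 < e -> exists N, forall m n, (N <= m)%N -> (m <= n)%N ->
    forall k, `|partial_sum k (s n) - partial_sum k (s m)| <= e.
  move=> e0; have [N HN] := bounded_sum_tail (a := p \o zz) (fun=> p_ge0 _) zK e0.
  by exists N => m n Nm mn k; rewrite (le_trans (psB _ _ _ mn))// HN.
have coefcv i : cvgn (fun N => coef (s N) i).
  apply: cauchy_seq_cvg => e e0; have e20 : 0 < e / 2 by rewrite divr_gt0.
  have [N HN] := tails _ e20; exists N => m n Nm mn.
  have cE y : coef y i *: u i = partial_sum i.+1 y - partial_sum i y.
    by rewrite /partial_sum series_recr addrC addKr.
  have -> : `|coef (s n) i - coef (s m) i| = `|(coef (s n) i - coef (s m) i) *: u i|.
    by rewrite normrZ u1 mulr1.
  rewrite scalerBl !cE.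
  rewrite (subACA (partial_sum _ _)).
  by rewrite (le_trans (ler_normB _ _))// [e]splitr lerD// HN.
pose b i := limn (fun N => coef (s N) i).
have pscv n : (fun N => partial_sum n (s N)) @ \oo --> series (lincomb b u) n.
  rewrite /partial_sum; elim: n => [|n IH].
    by rewrite series_at0; under eq_fun do rewrite series_at0; exact: cvg_cst.
  rewrite series_recr; under eq_fun do rewrite series_recr; apply: cvgD => //.
  by apply: cvgZl; exact: coefcv.
have pb n N e : (forall k, (N <= k)%N -> `|partial_sum n (s k) - partial_sum n (s N)| <= e) ->
    `|series (lincomb b u) n - partial_sum n (s N)| <= e.
  move=> H; apply: (@cvg_norm_le _ _ (fun k => partial_sum n (s k) - partial_sum n (s N))).
    by apply: cvgB; [exact: pscv|exact: cvg_cst].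
  by exists N.
(* Exchange of limits: [N] is fixed first, uniformly in [n], and only then [n] is taken large for
   the vector [s N]. *)
have bx : series (lincomb b u) @ \oo --> x.
  apply/cvg_seqP => e e0; have e30 : 0 < e / 3 by rewrite divr_gt0.
  have [N1 HN1] := tails _ e30; have [N2 HN2] := (cvg_seqP _ _).1 zx _ e30.
  pose N := maxn N1 N2.
  have [N3 HN3] := (cvg_seqP _ _).1 (coefP (s N)) _ e30.
  exists N3 => n N3n.
  have h1 : `|series (lincomb b u) n - partial_sum n (s N)| <= e / 3.
    by apply: pb => k Nk; apply: HN1; rewrite // leq_maxl.
  have h2 : `|x - s N| <= e / 3 by apply: HN2; rewrite leq_maxr.
  have h3 : `|s N - partial_sum n (s N)| <= e / 3 by exact: HN3.
  rewrite (_ : x - _ = (x - s N) + (s N - partial_sum n (s N)) -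
     (series (lincomb b u) n - partial_sum n (s N))); last first.
    by rewrite opprB addrA [in RHS]addrA !subrK.
  rewrite (le_trans (ler_normB _ _))// (_ : e = e / 3 + e / 3 + e / 3); last by lra.
  by rewrite lerD// (le_trans (ler_normD _ _))// lerD.
have bE := coef_unique bx.
apply: p_le => n; rewrite /partial_sum bE; apply: (cvg_norm_le (pscv n)).
exists 0%N => N _; have := psB n 0%N N (leq0n _).
by rewrite /s pz subr0 => /le_trans; apply.
Qed.

Lemma coef_bounded : exists2 M, 0 < M & forall z i, `|coef z i| <= M * `|z|.
Proof.
have [M M0 HM] := partial_sums_uniform; exists (2 * M); first by rewrite mulr_gt0.
move=> z i; rewrite (le_trans (coef_le_sup _ _))// -mulrA ler_pM2l//.
by apply: p_le => n; exact: HM.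
Qed.

Lemma coef_cvg (s : nat -> X) x i : s @ \oo --> x -> (fun n => coef (s n) i) @ \oo --> coef x i.
Proof.
move=> sx; apply/cvg_seqP => e e0; have [M M0 HM] := coef_bounded.
have [N HN] := (cvg_seqP _ _).1 sx _ (divr_gt0 e0 M0); exists N => n /HN.
rewrite ler_pdivlMr// mulrC => h; rewrite -coefN -coefD.
exact: le_trans (HM _ _) h.
Qed.

End Coefficients.

(** * Unconditional convergence of subseries *)

Arguments coefP {R X u} ub z.

(* If arbitrarily late finite sums stay large, move each of them to the front of
   a block of a rearrangement; the blocks [Fs N] come from the failure of
   unordered summability. *)
Lemma rearrangement_of_blocks (Fs : nat -> seq nat) :
  (forall N, uniq (Fs N)) -> (forall N i, i \in Fs N -> (N <= i)%N) ->
  exists2 s : nat -> nat, bijective s &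
    forall N, exists m n, [/\ (N <= m)%N, (m <= n)%N &
      exists M, [seq s i | i <- iota m (n - m)] = Fs M].
Proof.
move=> Fu Fge.
pose nx m := maxn m.+1 (\max_(i <- Fs m) i).+1.
pose blk m := Fs m ++ [seq i <- iota m (nx m - m) | i \notin Fs m].
pose st := fix st j := if j is j'.+1 then nx (st j') else 0%N.
pose S := fix S j := if j is j'.+1 then S j' ++ blk (st j') else [::].
have nxgt m : (m < nx m)%N by rewrite leq_max ltnSn.
have stS j : st j.+1 = nx (st j) by [].
have stge j : (j <= st j)%N by elim: j => // j IH; rewrite (leq_ltn_trans IH)// stS nxgt.
have blkP m : perm_eq (blk m) (iota m (nx m - m)).
  apply: uniq_perm; rewrite ?iota_uniq//.
    rewrite cat_uniq Fu filter_uniq ?iota_uniq// andbT.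
    by apply/hasPn => i; rewrite mem_filter => /andP[].
  move=> i; rewrite mem_cat mem_filter; case iF: (i \in Fs m) => //=.
  rewrite mem_iota (Fge _ _ iF) subnKC ?(ltnW (nxgt _))//=; apply/esym.
  by rewrite leq_max !ltnS (big_rem i)//= leq_maxl orbT.
have SP j : perm_eq (S j) (iota 0 (st j)).
  elim: j => // j IH /=.
  rewrite -[nx _](subnKC (ltnW (nxgt (st j)))) iotaD add0n.
  exact: perm_cat IH (blkP _).
have sizeS j : size (S j) = st j by rewrite (perm_size (SP j)) size_iota.
have uS j : uniq (S j) by rewrite (perm_uniq (SP j)) iota_uniq.
have memS j i : (i \in S j) = (i < st j)%N by rewrite (perm_mem (SP j)) mem_iota add0n.
have Spre j k : (j <= k)%N -> exists r, S k = S j ++ r.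
  elim: k => [|k IH]; first by rewrite leqn0 => /eqP->; exists [::]; rewrite cats0.
  rewrite leq_eqVlt => /orP[/eqP->|/IH[r /= ->]]; first by exists [::]; rewrite cats0.
  by exists (r ++ blk (st k)); rewrite catA.
pose s n := nth 0%N (S n.+1) n.
have ltst n : (n < st n.+1)%N by exact: stge.
have sE n j : (n < st j)%N -> s n = nth 0%N (S j) n.
  move=> nj; rewrite /s; have [/Spre[r ->]|/ltnW/Spre[r ->]] := leqP n.+1 j.
    by rewrite nth_cat sizeS ltst.
  by rewrite nth_cat sizeS nj.
pose t v := index v (S v.+1).
have tst v : (t v < st v.+1)%N by rewrite -sizeS index_mem memS ltst.
exists s.
  exists t => n.
    have [J nJ vJ] : exists2 J, (n < J)%N & (s n < J)%N.
      by exists (maxn n (s n)).+1; rewrite ltnS ?leq_maxl ?leq_maxr.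
    have nj : (n < st J)%N by exact: leq_trans (stge _).
    have [r Sr] := Spre _ _ vJ.
    have : index (s n) (S J) = n by rewrite (sE _ _ nj) index_uniq ?sizeS.
    by rewrite Sr index_cat memS ltst.
  by rewrite (sE _ n.+1 (tst n)) nth_index// memS ltst.
move=> N; exists (st N), (st N + size (Fs (st N)))%N; split=> //; first exact: leq_addr.
exists (st N); rewrite addnC addnK.
apply: (@eq_from_nth _ 0%N); rewrite size_map size_iota// => i iF.
rewrite (nth_map 0%N) ?size_iota// nth_iota// (sE _ N.+1); last first.
  rewrite stS -[nx _](subnKC (ltnW (nxgt (st N)))) ltn_add2l.
  by rewrite -(size_iota (st N) (nx _ - _)) -(perm_size (blkP _)) size_cat ltn_addr.
by rewrite /= nth_cat sizeS ltnNge leq_addr/= addnC addnK nth_cat iF.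
Qed.

(** Sums over late finite sets are small; otherwise some rearrangement would list infinitely many
    bad sets contiguously and fail the Cauchy criterion. Blocks of the subseries are such finite
    sums. *)
Lemma subseries_cvg (R : realType) (X : completeNormedModType R) (z : nat -> X) (k : nat -> nat) :
  (forall s : nat -> nat, bijective s -> cvgn (series (z \o s))) ->
  {homo k : m n / (m < n)%N} -> cvgn (series (z \o k)).
Proof.
move=> zs kmono.
have kge n : (n <= k n)%N by elim: n => // n IH; rewrite (leq_ltn_trans IH)// kmono.
have kinj : injective k.
  move=> m n kmn; apply/eqP; apply: contraT; rewrite neq_ltn.
  by move=> /orP[/kmono|/kmono]; rewrite kmn ltnn.
suff H (e : R) : 0 < e -> exists N, forall F : seq nat, uniq F -> (forall i, i \in F -> (N <= i)%N) ->
    `|\sum_(i <- F) z i| <= e.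
  apply: cauchy_seq_cvg => e /H[N HN]; exists N => m n Nm mn.
  rewrite -[_ n - _ m]/(_ - _) sub_series_geq//.
  have := HN [seq k i | i <- index_iota m n]; rewrite big_map; apply.
    by rewrite map_inj_uniq ?iota_uniq.
  move=> _ /mapP[i + ->]; rewrite mem_index_iota => /andP[mi _].
  by rewrite (leq_trans Nm)// (leq_trans mi).
move=> e0; apply: contrapT => H.
have /choice[Fs FsP] : forall N, exists F : seq nat, [/\ uniq F,
    forall i, i \in F -> (N <= i)%N & e < `|\sum_(i <- F) z i|].
  move=> N; apply: contrapT => HF; apply: H; exists N => F uF FN.
  by rewrite leNgt; apply/negP => eF; apply: HF; exists F.
have [||s bs Hs] := @rearrangement_of_blocks Fs; first by move=> N; have [] := FsP N.
  by move=> N; have [] := FsP N.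
have [N HN] := cvg_seq_cauchy (zs s bs) e0.
have [m [n [Nm mn [M sM]]]] := Hs N; have [_ _] := FsP M.
have := HN m n Nm (leq_trans Nm mn); rewrite -[_ n - _ m]/(_ - _) sub_series_geq//.
rewrite -sM big_map => h1 h2; have := lt_le_trans h2 h1.
by rewrite ltxx.
Qed.

(** * A complemented copy of the tree space in [U] *)

Section ComplementedCopy.
Variables (R : realType) (U : completeNormedModType R) (u : nat -> U).
Variables (k : nat -> nat).
Local Notation W := (tree_space R).
Hypothesis u1 : normalized u.
Hypothesis ub : unconditional_basis_of setT u.
Hypothesis kmono : {homo k : m n / (m < n)%N}.
Hypothesis ke : equivalent_sequences (@tree_basis R) (u \o k).

Let sb : schauder_basis_of setT u := ub.1.
Local Notation coef := (coef sb).

Let kmonoE m n : (k m < k n)%N = (m < n)%N.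
Proof.
apply/idP/idP; last exact: kmono.
by apply: contraTT; rewrite -!leqNgt leq_eqVlt => /orP[/eqP->//|/kmono/ltnW].
Qed.

Let kinj : injective k.
Proof.
move=> m n kmn; apply/eqP; apply: contraT; rewrite neq_ltn.
by move=> /orP[/kmono|/kmono]; rewrite kmn ltnn.
Qed.

Lemma copy_cvg (w : W) : cvgn (series (lincomb w (u \o k))).
Proof. by apply/ke; apply/cvg_ex; exists w; exact: cvg_tree_basis. Qed.
Arguments copy_cvg : clear implicits.

Definition copy (w : W) : U := limn (series (lincomb w (u \o k))).

Lemma copy_linear : linear copy.
Proof.
move=> a v w; rewrite /copy.
have -> : series (lincomb (a *: v + w) (u \o k)) =
    (fun n => a *: series (lincomb v (u \o k)) n + series (lincomb w (u \o k)) n).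
  by apply/funext => n; rewrite -series_lincombD.
apply: cvg_lim => //; apply: cvgD; last exact: copy_cvg.
by apply: cvgZr; exact: copy_cvg.
Qed.

(** Counts the [i] with [k i < n]; thus [k (below n)] is the only value of [k] that can equal
    [n]. *)
Definition below := fix c n := if n is n'.+1 then
  if k (c n') == n' then (c n').+1 else c n' else 0%N.

Lemma belowP n i : (i < below n)%N = (k i < n)%N.
Proof.
elim: n i => //= n IH i; have nc : (n <= k (below n))%N by rewrite leqNgt -IH ltnn.
have [kc|kc] := eqVneq.
  rewrite !ltnS -[in RHS]kc; have := kmonoE (below n) i; case: (ltngtP i (below n)) => [ic|ci|->] h.
  - by rewrite ltnW// kmono.
  - by apply/esym/negbTE; rewrite -ltnNge h.
  - by rewrite leqnn.
rewrite IH ltnS [RHS]leq_eqVlt; case: eqP => //= kin.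
have : (i < below n)%N = false by rewrite IH kin ltnn.
move=> /negbT; rewrite -leqNgt leq_eqVlt => /orP[/eqP ci|/kmono].
  by rewrite ci kin eqxx in kc.
by rewrite kin ltnNge nc.
Qed.

Lemma below_k i : below (k i) = i.
Proof.
apply/eqP; rewrite eqn_leq; apply/andP; split; rewrite leqNgt.
  by rewrite belowP ltnn.
apply/negP => h; have := belowP (k i) (below (k i)); rewrite ltnn kmonoE h //.
Qed.

Lemma coef_copy (w : W) n : coef (copy w) n = if k (below n) == n then w (below n) else 0.
Proof.
rewrite (@coef_unique _ _ _ sb (copy w)
  (fun n => if k (below n) == n then w (below n) else 0))//.
have sE m : series (lincomb (fun n => if k (below n) == n then w (below n) else 0) u) m =
    series (lincomb w (u \o k)) (below m).
  elim: m => [|m IH]; first by rewrite !series_at0.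
  rewrite series_recr IH /= /lincomb; case: eqP => [kE|_]; last by rewrite scale0r addr0.
  by rewrite series_recr /lincomb /= kE.
apply/cvg_seqP => e e0.
have [N HN] := (cvg_seqP _ _).1 (copy_cvg w : _ @ \oo --> copy w) _ e0.
exists (k N).+1 => m km; rewrite sE; apply: HN.
by rewrite ltnW// belowP.
Qed.

Lemma coef_copy_k w i : coef (copy w) (k i) = w i.
Proof. by rewrite coef_copy below_k eqxx. Qed.

Lemma coef_inj (x y : U) : (forall i, coef x i = coef y i) -> x = y.
Proof.
move=> xy; have {}xy : coef x = coef y by apply/funext.
apply: cvg_seq_unique (coefP sb x) _.
by rewrite xy; exact: coefP.
Qed.

(** Unconditionality makes the subseries along [k] converge in [U], and equivalence of the bases
    transfers the convergence to [W]. *)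
Lemma cocopy_exists (z : U) : exists w : W, forall i, w i = coef z (k i).
Proof.
have cz : cvgn (series (lincomb (coef z \o k) (u \o k))).
  apply: (subseries_cvg (z := lincomb (coef z) u)) kmono => s.
  exact: (ub.2 z (coef z) I (coefP sb z)).
move/ke: cz => /cvg_ex[w cw]; exists w => i.
by rewrite -(tree_basis_unique cw).
Qed.

Definition cocopy (z : U) : W := projT1 (cid (cocopy_exists z)).

Lemma cocopyE z i : cocopy z i = coef z (k i).
Proof. exact: (projT2 (cid (cocopy_exists z))). Qed.

Lemma cocopy_linear : linear cocopy.
Proof.
move=> a z w; apply: tree_space_ext => i.
by rewrite tree_spaceD tree_spaceZ !cocopyE coef_linear.
Qed.

Lemma copyK w : cocopy (copy w) = w.
Proof. by apply: tree_space_ext => i; rewrite cocopyE coef_copy_k. Qed.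

Lemma coord_cvg (s : nat -> W) (w : W) i : s @ \oo --> w -> (fun n => s n i) @ \oo --> w i.
Proof.
move=> sw; apply/cvg_seqP => e e0; have [N HN] := (cvg_seqP _ _).1 sw _ e0.
exists N => n /HN; apply: le_trans; rewrite -tree_spaceB; exact: coord_le_norm.
Qed.

(** Coefficients are continuous on both sides and separate points, so the graph is closed. *)
Lemma copy_bounded : exists2 M, 0 < M & forall w, `|copy w| <= M * `|w|.
Proof.
apply: closed_graph_bounded; first exact: copy_linear.
move=> s w y sw sy; apply: coef_inj => i.
have sy' := @coef_cvg _ _ _ u1 sb _ _ i sy.
have sw' : (fun n => coef ((copy \o s) n) i) @ \oo --> coef (copy w) i.
  rewrite coef_copy; under eq_fun do rewrite /= coef_copy.
  by case: eqP => _; [exact: coord_cvg|exact: cvg_cst].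
exact: cvg_seq_unique sy' sw'.
Qed.

Lemma cocopy_bounded : exists2 M, 0 < M & forall z, `|cocopy z| <= M * `|z|.
Proof.
apply: closed_graph_bounded; first exact: cocopy_linear.
move=> s z y sz sy; apply: tree_space_ext => i.
have sy' := @coord_cvg _ _ i sy.
have sz' : (fun n => (cocopy \o s) n i) @ \oo --> cocopy z i.
  rewrite cocopyE; under eq_fun do rewrite /= cocopyE.
  exact: (coef_cvg u1).
exact: cvg_seq_unique sy' sz'.
Qed.

End ComplementedCopy.

(** * Measurable predicates with countable quantifiers *)

Section MeasurablePredicates.
Context d (T : measurableType d).
Implicit Types P Q : T -> Prop.

Lemma measurable_and P Q : measurable [set x | P x] -> measurable [set x | Q x] ->
  measurable [set x | P x /\ Q x].
Proof. exact: measurableI. Qed.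

Lemma measurable_not P : measurable [set x | P x] -> measurable [set x | ~ P x].
Proof. exact: measurableC. Qed.

Lemma measurable_const (A : Prop) : measurable [set x : T | A].
Proof.
have [a|na] := pselect A.
  by rewrite (_ : [set _ | _] = setT); [exact: measurableT|apply/seteqP; split].
by rewrite (_ : [set _ | _] = set0); [exact: measurable0|apply/seteqP; split].
Qed.

Lemma measurable_imply P Q : measurable [set x | P x] -> measurable [set x | Q x] ->
  measurable [set x | P x -> Q x].
Proof.
move=> mP mQ; rewrite (_ : [set _ | _] = ~` [set x | P x] `|` [set x | Q x]).
  by apply: measurableU => //; exact: measurableC.
apply/seteqP; split=> x /=; last by case=> // /[apply].
by move=> PQ; have [/PQ|] := pselect (P x); [right|left].
Qed.

Lemma measurable_iff P Q : measurable [set x | P x] -> measurable [set x | Q x] ->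
  measurable [set x | P x <-> Q x].
Proof. by move=> mP mQ; apply: measurable_and; exact: measurable_imply. Qed.

Lemma measurable_exists (I : countType) (P : I -> T -> Prop) :
  (forall i, measurable [set x | P i x]) -> measurable [set x | exists i, P i x].
Proof.
move=> mP; rewrite (_ : [set _ | _] =
    \bigcup_n (if @unpickle I n is Some i then [set x | P i x] else set0)).
  by apply: bigcupT_measurable => n; case: (unpickle n) => // ; exact: measurable0.
apply/seteqP; split=> x /=; first by move=> [i Pi]; exists (pickle i) => //; rewrite pickleK.
by move=> [n _]; case: (unpickle n) => // i; exists i.
Qed.

Lemma measurable_forall (I : countType) (P : I -> T -> Prop) :
  (forall i, measurable [set x | P i x]) -> measurable [set x | forall i, P i x].
Proof.
move=> mP; rewrite (_ : [set _ | _] = ~` [set x | exists i, ~ P i x]).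
  by apply: measurableC; apply: measurable_exists => i; exact: measurable_not (mP i).
apply/seteqP; split=> x /=; first by move=> H [i]; apply; exact: H.
by move=> H i; apply: contrapT => nP; apply: H; exists i.
Qed.

End MeasurablePredicates.

(** * Borel codes in Cantor space *)

Definition cylinders : set (set (nat -> bool)) := [set [set a : nat -> bool | a n] | n in setT].

Notation bits := (g_sigma_algebraType cylinders).

Lemma measurable_bit n : measurable [set a : bits | a n].
Proof. by apply: sub_sigma_algebra; exists n. Qed.

Lemma bits_measurable d (T : measurableType d) (f : T -> nat -> bool) :
  (forall n, measurable [set x | f x n]) ->
  forall B : set bits, measurable B -> measurable (f @^-1` B).
Proof.
move=> mf B mB; suff : preimage_set_system setT f <<s cylinders>> `<=` measurable.
  by move=> /(_ (setT `&` f @^-1` B)); rewrite setTI; apply; exists B; rewrite // setTI.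
rewrite -(g_sigma_preimageE setT f cylinders); apply: smallest_sub.
  exact: sigma_algebra_measurable.
by move=> _ [_ [n _ <-] <-]; rewrite setTI; exact: mf.
Qed.

Lemma sigma_preimageE (aT rT : pointedType) (f : aT -> rT) (G : set (set rT)) :
  preimage_set_system setT f <<s G>> = <<s preimage_set_system setT f G>>.
Proof. by rewrite g_sigma_preimageE. Qed.

(** A Borel isomorphism onto a Borel subset of Cantor space. Such codes pass to products by
    interleaving and can be exhibited for operators without naming a Polish topology. *)
Definition borel_code d (E : measurableType d) (f : E -> nat -> bool) :=
  [/\ injective f, @measurable d E = preimage_set_system setT f <<s cylinders>>
    & <<s cylinders>> (range f)].

Definition coded d (E : measurableType d) := exists f : E -> nat -> bool, borel_code f.

Lemma measurable_code d (E : measurableType d) (f : E -> nat -> bool) n :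
  borel_code f -> measurable [set x | f x n].
Proof.
move=> [_ mf _]; rewrite mf; exists [set a : nat -> bool | a n]; last by rewrite setTI.
exact: measurable_bit.
Qed.

Section PolishCoded.
Variables (R : realType) (P : completePseudoMetricType R).
Hypothesis Phaus : hausdorff_space P.
Hypothesis Pcount : @second_countable P.

Lemma countable_base : exists Ob : nat -> set P, (forall n, open (Ob n)) /\
  forall x V, nbhs x V -> exists2 n, Ob n x & Ob n `<=` V.
Proof.
have [B /countable_injP[f finj] [Bo Bb]] := Pcount.
exists (fun n => \bigcup_(b in [set b | B b /\ f b = n]) b); split.
  by move=> n; apply: bigcup_open => b [Bb' _]; exact: Bo.
move=> x V /Bb[U [BU Ux] UV].
have UE : \bigcup_(b in [set b | B b /\ f b = f U]) b = U.
  apply/seteqP; split; last by move=> y Uy; exists U.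
  by move=> y [b [Bb' /finj bU] by']; rewrite -(bU (mem_set Bb') (mem_set BU)).
by exists (f U); rewrite UE.
Qed.

(** A point is coded by the basic open sets containing it. The codes are the families satisfying
    [good], namely fine, directed, upward closed and regular ones: each generates a Cauchy filter
    and codes its limit. These conditions quantify over numbers, and the topology enters only
    through relations independent of the code. *)
Lemma polish_coded : exists f : P -> nat -> bool,
  [/\ injective f, <<s @open P>> = preimage_set_system setT f <<s cylinders>>
    & <<s cylinders>> (range f)].
Proof.
have [Ob [Oopen Obase]] := countable_base.
pose f x n := `[< Ob n x >].
exists f; split.
- move=> x y fxy; apply: Phaus => A B /Obase[n Onx OnA] yB.
  have Ony : Ob n y by apply/asboolP; rewrite -[`[< _ >]]/(f y n) -fxy; exact/asboolP.
  by exists y; split; [exact: OnA|exact: nbhs_singleton].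
- rewrite sigma_preimageE; apply/seteqP; split.
    apply: smallest_sub; first exact: smallest_sigma_algebra.
    move=> V oV; have -> : V = \bigcup_(n in [set n | Ob n `<=` V]) Ob n.
      apply/seteqP; split=> [x Vx|x [n On /On//]].
      by have [n Onx OnV] := Obase x V (open_nbhs_nbhs (conj oV Vx)); exists n.
    rewrite bigcup_mkcond; apply: sigma_algebra_bigcup => n.
    case: ifP => _; last exact: sigma_algebra0.
    apply: sub_sigma_algebra; exists [set a : nat -> bool | a n]; first by exists n.
    by rewrite setTI; apply/seteqP; split=> x /= /asboolP.
  apply: smallest_sub; first exact: smallest_sigma_algebra.
  move=> _ [_ [n _ <-] <-]; apply: sub_sigma_algebra; rewrite setTI.
  rewrite (_ : _ @^-1` _ = Ob n)//.
  by apply/seteqP; split=> x /= /asboolP.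
pose small k (A : set P) := exists y, A `<=` ball y (k.+1%:R^-1 : R).
pose good (a : nat -> bool) := [/\ forall k, exists n, a n /\ small k (Ob n),
  forall n m, a n -> a m -> exists l, a l /\ (Ob l `<=` Ob n `&` Ob m /\ Ob l !=set0),
  forall n m, a m -> Ob m `<=` Ob n -> a n
  & forall n, a n -> exists m, a m /\ closure (Ob m) `<=` Ob n].
have -> : range f = good.
  apply/seteqP; split=> [_ [x _ <-]|a [g1 g2 g3 g4]].
    split.
    - move=> k; have [|n Onx Ons] := Obase x (ball x (k.+1%:R^-1 : R)).
        exact: nbhsx_ballx.
      by exists n; split; [exact/asboolP|exists x].
    - move=> n m /asboolP Onx /asboolP Omx.
      have [|l Olx Ol] := Obase x (Ob n `&` Ob m).
        by apply: filterI; apply: open_nbhs_nbhs; split.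
      by exists l; split; [exact/asboolP|split=> //; exists x].
    - by move=> n m /asboolP Omx mn; apply/asboolP; exact: mn.
    - move=> n /asboolP Onx.
      have /nbhs_ballP[e /= e0 he] : nbhs x (Ob n) by apply: open_nbhs_nbhs; split.
      have e20 : 0 < e / 2 by rewrite divr_gt0.
      have [|m Omx Om] := Obase x (ball x (e / 2)); first exact: nbhsx_ballx.
      exists m; split; first exact/asboolP.
      move=> z /(_ (ball z (e / 2)))[|w [Omw zw]]; first exact: nbhsx_ballx.
      apply: he; rewrite [e]splitr; apply: ball_triangle (Om _ Omw) _.
      exact: ball_sym.
  pose F := filter_from [set n | a n] Ob.
  have FF : ProperFilter F.
    apply: filter_from_proper.
      apply: filter_from_filter; first by have [n [an _]] := g1 0%N; exists n.
      by move=> n m an am; have [l [al [Ol _]]] := g2 n m an am; exists l.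
    move=> n an; have [l [_ [Ol [y /Ol[Ony _]]]]] := g2 n n an an.
    by exists y.
  have Fcv : cvg F.
    apply: cauchy_cvg; apply/cauchyP => e e0.
    have [n [an [y Ony]]] := g1 (Num.truncn e^-1); exists y; exists n => //.
    move=> z /Ony; apply: le_ball.
    by rewrite invf_ple ?posrE// ltW// truncnS_gt.
  exists (lim F) => //; apply/funext => n.
  apply/idP/idP => [/asboolP Onx|an].
    have : F (Ob n) by apply: Fcv; apply: open_nbhs_nbhs; split.
    by move=> [m am Omn]; exact: g3 am Omn.
  (* The limit lies in the closure of [Ob m], which regularity places inside [Ob n]. *)
  apply/asboolP; have [m [am Om]] := g4 n an; apply: Om => A /Fcv FA.
  have FOm : F (Ob m) by exists m.
  exact: filter_ex (filterI FOm FA).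
rewrite (_ : good = [set a : bits | (forall k, exists n, a n /\ small k (Ob n)) /\
  (forall n m, a n -> a m -> exists l, a l /\ (Ob l `<=` Ob n `&` Ob m /\ Ob l !=set0)) /\
  (forall n m, a m -> Ob m `<=` Ob n -> a n) /\
  (forall n, a n -> exists m, a m /\ closure (Ob m) `<=` Ob n)]); last first.
  by apply/seteqP; split=> a; [case|case=> ? [? []]].
rewrite -[_ _]/(measurable (_ : set bits)).
repeat apply: measurable_and.
- apply: measurable_forall => k; apply: measurable_exists => n.
  by apply: measurable_and; [exact: measurable_bit|exact: measurable_const].
- apply: measurable_forall => n; apply: measurable_forall => m.
  apply: measurable_imply; first exact: measurable_bit.
  apply: measurable_imply; first exact: measurable_bit.
  apply: measurable_exists => l.
  by apply: measurable_and; [exact: measurable_bit|exact: measurable_const].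
- apply: measurable_forall => n; apply: measurable_forall => m.
  apply: measurable_imply; first exact: measurable_bit.
  by apply: measurable_imply; [exact: measurable_const|exact: measurable_bit].
- apply: measurable_forall => n; apply: measurable_imply; first exact: measurable_bit.
  apply: measurable_exists => m.
  by apply: measurable_and; [exact: measurable_bit|exact: measurable_const].
Qed.

End PolishCoded.

Lemma standard_borel_coded (R : realType) d (E : measurableType d) :
  standard_borel_type R E -> coded E.
Proof.
move=> [P [Ph Pc [g [gbij mE]]]]; have [f [finj fE frange]] := polish_coded Ph Pc.
exists (f \o g); split.
- exact: inj_comp finj (bij_inj gbij).
- by rewrite mE fE preimage_set_system_comp.
- rewrite (_ : range (f \o g) = range f)//; apply/seteqP; split=> _ [x _ <-].
    by exists (g x).
  by case: gbij => h _ hg; exists (h x) => //=; rewrite hg.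
Qed.

Definition interleave (a b : nat -> bool) : nat -> bool :=
  fun n => if odd n then b n./2 else a n./2.
Definition evens T (c : nat -> T) : nat -> T := fun n => c n.*2.
Definition odds T (c : nat -> T) : nat -> T := fun n => c n.*2.+1.

Lemma evens_interleave a b : evens (interleave a b) = a.
Proof. by apply/funext => n; rewrite /evens /interleave odd_double doubleK. Qed.

Lemma odds_interleave a b : odds (interleave a b) = b.
Proof. by apply/funext => n; rewrite /odds /interleave /= odd_double/= uphalf_double. Qed.

Lemma interleaveK c : interleave (evens c) (odds c) = c.
Proof.
apply/funext => n; rewrite /interleave /evens /odds.
by rewrite -[n in RHS]odd_double_half; case: (odd n).
Qed.

Lemma borel_code_prod d1 d2 (E1 : measurableType d1) (E2 : measurableType d2)
    (f1 : E1 -> nat -> bool) (f2 : E2 -> nat -> bool) :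
  borel_code f1 -> borel_code f2 ->
  borel_code (fun x : (E1 * E2)%type => interleave (f1 x.1) (f2 x.2)).
Proof.
move=> c1 c2; have [inj1 m1 r1] := c1; have [inj2 m2 r2] := c2; split.
- move=> [x1 x2] [y1 y2] /= h; congr (_, _).
    by apply: inj1; have := congr1 (@evens bool) h; rewrite !evens_interleave.
  by apply: inj2; have := congr1 (@odds bool) h; rewrite !odds_interleave.
- have mb1 n := measurable_code n c1; have mb2 n := measurable_code n c2.
  apply/seteqP; split.
    apply: smallest_sub; first exact/sigma_algebra_preimage/smallest_sigma_algebra.
    move=> A [] [B]; rewrite ?m1 ?m2 => -[B' mB' <-] <-; rewrite !setTI.
      exists (@evens bool @^-1` B').
        apply: (bits_measurable (T := bits) (f := @evens bool)) mB' => n.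
        exact: measurable_bit.
      by rewrite setTI; apply/seteqP; split=> x /=; rewrite evens_interleave.
    exists (@odds bool @^-1` B').
      apply: (bits_measurable (T := bits) (f := @odds bool)) mB' => n.
      exact: measurable_bit.
    by rewrite setTI; apply/seteqP; split=> x /=; rewrite odds_interleave.
  move=> _ [B mB <-]; rewrite setTI.
  apply: (bits_measurable (T := (E1 * E2)%type)) mB => n.
  rewrite /interleave; case: (odd n).
    by rewrite -[X in measurable X]setTI; exact: (@measurable_snd _ _ E1 E2 measurableT _ (mb2 _)).
  by rewrite -[X in measurable X]setTI; exact: (@measurable_fst _ _ E1 E2 measurableT _ (mb1 _)).
- have -> : range (fun x : E1 * E2 => interleave (f1 x.1) (f2 x.2)) =
      [set c : bits | range f1 (evens c) /\ range f2 (odds c)].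
    apply/seteqP; split=> [_ [x _ <-]|c [[x1 _ e1] [x2 _ e2]]] /=.
      by rewrite evens_interleave odds_interleave; split; [exists x.1|exists x.2].
    by exists (x1, x2) => //=; rewrite e1 e2 interleaveK.
  rewrite -[_ _]/(measurable (_ : set bits)); apply: measurable_and.
    apply: (bits_measurable (T := bits) (f := @evens bool)) r1 => n.
    exact: measurable_bit.
  apply: (bits_measurable (T := bits) (f := @odds bool)) r2 => n.
  exact: measurable_bit.
Qed.

(** * Borel sets as injective projections of closed sets *)

Definition agree T (n : nat) (a b : nat -> T) := forall i, (i < n)%N -> a i = b i.

Lemma agree_le T m n (a b : nat -> T) : (m <= n)%N -> agree n a b -> agree m a b.
Proof. by move=> mn ab i im; apply: ab; exact: leq_trans mn. Qed.

Definition seq_closed (C : (nat -> bool) -> (nat -> nat) -> Prop) :=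
  forall a b, (forall n, exists a' b', [/\ C a' b', agree n a a' & agree n b b']) -> C a b.

(* A Borel set of Cantor space is the injective projection of a closed subset of
   Cantor x Baire space, the unique witness [beta a] depending measurably on [a]. *)
Definition witnessed (B : set (nat -> bool)) :=
  exists (C : (nat -> bool) -> (nat -> nat) -> Prop) (beta : (nat -> bool) -> nat -> nat),
    [/\ seq_closed C, forall n k, <<s cylinders>> [set a | beta a n = k]
      & forall a b, C a b <-> B a /\ b = beta a].

Lemma bits_const (A : Prop) : <<s cylinders>> [set a : nat -> bool | A].
Proof. exact: (@measurable_const _ bits A). Qed.

Lemma witnessed_bit i (p : pred bool) : witnessed [set a | p (a i)].
Proof.
exists (fun a b => p (a i) /\ b = fun=> 0%N), (fun=> fun=> 0%N); split=> //.
  move=> a b ab; split.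
    by have [a' [b' [[pa _] aa _]]] := ab i.+1; rewrite aa.
  by apply/funext => n; have [a' [b' [[_ b0] _ bb]]] := ab n.+1; rewrite bb// b0.
by move=> n k; exact: bits_const.
Qed.

(** The witnesses for all [B n] are packed into one sequence by pairing. Slots coding no pair are
    forced to 0 by [join], which keeps the witness unique. *)
Lemma witnessed_bigcap (B : nat -> set (nat -> bool)) :
  (forall n, witnessed (B n)) -> witnessed (\bigcap_n B n).
Proof.
move=> /choice[C /choice[beta H]].
have Ccl n : seq_closed (C n) by have [] := H n.
have mb n : forall m k, <<s cylinders>> [set a | beta n a m = k] by have [] := H n.
have CE n : forall a b, C n a b <-> B n a /\ b = beta n a by have [] := H n.
pose slice (b : nat -> nat) (n m : nat) := b (pickle (n, m)).
pose join (bs : nat -> nat -> nat) (j : nat) := if pickle_inv j is Some (n, m) then bs n m else 0%N.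
have joinK bs n : slice (join bs) n = bs n.
  by apply/funext => m; rewrite /slice /join pickleK_inv.
exists (fun a b => b = join (slice b) /\ forall n, C n a (slice b n)),
  (fun a => join (fun n => beta n a)); split.
- move=> a b ab; split.
    apply/funext => j; have [a' [b' [[bE _] _ bb]]] := ab j.+1.
    rewrite bb// bE /join; have := @pickle_invK (nat * nat)%type j.
    by case: (pickle_inv j) => [[n m] /= pj|//]; rewrite /slice pj bb.
  move=> n; apply: Ccl => k.
  pose N := \max_(m < k) pickle (n, m : nat).
  have [a' [b' [[_ Ca] aa bb]]] := ab (maxn k N.+1).
  exists a', (slice b' n); split; first exact: Ca.
    by apply: agree_le aa; exact: leq_maxl.
  move=> m mk; apply: bb; rewrite leq_max ltnS; apply/orP; right.
  by rewrite /N (bigD1 (Ordinal mk))//= leq_maxl.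
- move=> j k; rewrite /join; case: (pickle_inv j) => [[n m]|]; first exact: mb.
  exact: bits_const.
- move=> a b; split=> [[-> Ca]|[Ba ->]].
    split; first by move=> n _; have /CE[] := Ca n.
    by congr join; apply/funext => n; have /CE[_ <-] := Ca n; rewrite joinK.
  split; first by congr join; apply/funext => n; rewrite joinK.
  by move=> n; rewrite joinK; apply/CE; split=> //; exact: Ba.
Qed.

(** The witness starts with the index of the member containing the point; disjointness makes this
    index unique. *)
Lemma witnessed_bigcup (B : nat -> set (nat -> bool)) :
  (forall n, <<s cylinders>> (B n)) -> (forall n, witnessed (B n)) ->
  trivIset setT B -> witnessed (\bigcup_n B n).
Proof.
move=> mB /choice[C /choice[beta H]] tB.
have Ccl n : seq_closed (C n) by have [] := H n.
have mb n : forall m k, <<s cylinders>> [set a | beta n a m = k] by have [] := H n.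
have CE n : forall a b, C n a b <-> B n a /\ b = beta n a by have [] := H n.
have uniqB a m n : B m a -> B n a -> m = n.
  by move=> Bm Bn; apply: (tB m n) => //; exists a.
have /choice[idx idxP] : forall a, exists n, (B n a \/ (n = 0%N /\ forall n, ~ B n a)).
  move=> a; have [[n Bn]|nB] := pselect (exists n, B n a); first by exists n; left.
  by exists 0%N; right; split=> // n Bn; apply: nB; exists n.
have idxE a n : B n a -> idx a = n.
  by move=> Bn; have [Bi|[_ /(_ n)]] := idxP a; [exact: uniqB Bi Bn|].
have midx n : <<s cylinders>> [set a | idx a = n].
  rewrite (_ : [set a | _] = [set a : bits | B n a \/ (0%N = n /\ forall m, ~ B m a)]).
    rewrite -[_ _]/(measurable (_ : set bits)).
    apply: measurableU; first exact: mB.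
    apply: measurable_and; first exact: measurable_const.
    apply: measurable_forall => m; apply: measurable_not; exact: mB.
  apply/seteqP; split=> a /=.
    by move=> <-; have [?|[-> ?]] := idxP a; [left|right].
  move=> [/idxE//|[<- nB]]; by have [/nB//|[]] := idxP a.
exists (fun a b => C (b 0%N) a (fun i => b i.+1)),
  (fun a i => if i is j.+1 then beta (idx a) a j else idx a); split.
- move=> a b ab; apply: Ccl => k; have [a' [b' [Ca aa bb]]] := ab k.+1.
  exists a', (fun i => b' i.+1); split.
  + by rewrite bb.
  + exact: agree_le aa.
  + by move=> i ik; exact: bb.
- move=> [|n] k; first exact: midx.
  rewrite (_ : [set a | _] = [set a : bits | exists m, idx a = m /\ beta m a n = k]).
    rewrite -[_ _]/(measurable (_ : set bits)).
    apply: measurable_exists => m; apply: measurable_and; [exact: midx|exact: mb].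
  by apply/seteqP; split=> [a <-|a [m [<- <-]]] //=; exists (idx a).
- move=> a b; split=> [/CE[Bb bE]|[[n _ Bn] ->]].
    split; first by exists (b 0%N).
    have iE := idxE _ _ Bb; apply/funext => -[|j] //.
    by rewrite iE -bE.
  by apply/CE; rewrite (idxE _ _ Bn).
Qed.

Lemma witnessed_setT : witnessed setT.
Proof.
by have := witnessed_bit 0 predT; rewrite (_ : [set a | _] = setT)//; apply/seteqP; split.
Qed.

(** Borel sets witnessed together with their complements form a sigma-algebra: a union is first made
    disjoint, each piece being the intersection of one [F n] with complements of earlier ones. *)
Lemma witnessed_borel B : <<s cylinders>> B -> witnessed B.
Proof.
pose good B := [/\ <<s cylinders>> B, witnessed B & witnessed (~` B)].
suff H : <<s cylinders>> `<=` good by move=> /H[].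
apply: smallest_sub; last first.
  move=> _ [n _ <-]; split; first by apply: sub_sigma_algebra; exists n.
    exact: (witnessed_bit n id).
  rewrite (_ : ~` _ = [set a : nat -> bool | negb (a n)]).
    exact: (witnessed_bit n negb).
  by apply/seteqP; split=> a /= /negP.
split.
- split; first exact: sigma_algebra0.
    rewrite (_ : set0 = [set a : nat -> bool | pred0 (a 0%N)]); last by apply/seteqP; split.
    exact: witnessed_bit.
  by rewrite setC0; exact: witnessed_setT.
- move=> A [mA wA wC]; rewrite setTD; split; rewrite ?setCK//.
  exact: (measurableC (mA : measurable (A : set bits))).
- move=> F FP.
  have mF n : <<s cylinders>> (F n) by have [] := FP n.
  split; first exact: sigma_algebra_bigcup.
    rewrite seqDU_bigcup_eq; apply: witnessed_bigcup; last exact: trivIset_seqDU.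
      move=> n; apply: (measurableD (T := bits)); first exact: mF.
      by apply: bigsetU_measurable => k _; exact: mF.
    move=> n; rewrite (_ : seqDU F n = \bigcap_k (if k is m.+1 then
      (if (m < n)%N then ~` F m else setT) else F n)).
      apply: witnessed_bigcap => -[|m]; first by have [] := FP n.
      by case: ifP => _; [have [] := FP m|exact: witnessed_setT].
    apply/seteqP; split=> [a [Fa nF] [_//|m _]|a H].
      case: ifP => // mn Fm; apply: nF; rewrite -bigcup_mkord.
      by exists m.
    split; first exact: (H 0%N I).
    rewrite -bigcup_mkord => -[m /= mn Fm].
    by have := H m.+1 I; rewrite mn; exact.
  rewrite setC_bigcup; apply: witnessed_bigcap => n; by have [] := FP n.
Qed.

(** * Closed subsets of Baire space as Polish spaces *)

Section BaireSubspace.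
Variables (R : realType) (C : set (nat -> nat)) (w0 : nat -> nat).
Hypothesis C_w0 : C w0.
Hypothesis C_closed : forall w, (forall n, exists2 w', C w' & agree n w w') -> C w.

Record baire_point := BairePoint { bval : nat -> nat; bvalP : C bval }.

(** The base point and the closedness are recorded in the type, so that the instances declared on it
    can use them. *)
Definition baire_space of C w0 & (forall w, (forall n, exists2 w', C w' & agree n w w') -> C w) :=
  baire_point.

Local Notation T := (baire_space C_w0 C_closed).

Lemma bval_inj (x y : T) : bval x = bval y -> x = y.
Proof.
case: x y => [x xP] [y yP] /= xy; move: xP yP; rewrite xy => xP yP.
by congr BairePoint; exact: Prop_irrelevance.
Qed.

HB.instance Definition _ := gen_eqMixin T.
HB.instance Definition _ := gen_choiceMixin T.
HB.instance Definition _ := isPointed.Build T (BairePoint C_w0).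

(** Radius $1/(k+1)$ stands for agreement on the first $k+1$ values; a radius above 1 imposes
    nothing. *)
Definition baire_ball (x : T) (e : R) (y : T) : Prop :=
  0 < e /\ forall n, e * n.+1%:R <= 1 -> bval x n = bval y n.

Definition baire_ent : set_system (T * T) := entourage_ baire_ball.
Definition baire_nbhs (x : T) : set_system T := nbhs_ baire_ent x.

HB.instance Definition _ := hasNbhs.Build T baire_nbhs.

Lemma baire_ball_center (x : T) (e : R) : 0 < e -> baire_ball x e x.
Proof. by []. Qed.

Lemma baire_ball_sym (x y : T) (e : R) : baire_ball x e y -> baire_ball y e x.
Proof. by move=> [e0 xy]; split=> // n /xy. Qed.

Lemma baire_ball_triangle (x y z : T) (e1 e2 : R) :
  baire_ball x e1 y -> baire_ball y e2 z -> baire_ball x (e1 + e2) z.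
Proof.
move=> [e10 xy] [e20 yz]; split; first exact: addr_gt0.
have n0 n : 0 <= n.+1%:R :> R by [].
move=> n; rewrite mulrDl => en; rewrite xy ?yz//.
  by rewrite (le_trans _ en)// lerDr mulr_ge0// ltW.
by rewrite (le_trans _ en)// lerDl mulr_ge0// ltW.
Qed.

HB.instance Definition _ := @Nbhs_isPseudoMetric.Build R T
  baire_ent erefl baire_ball baire_ball_center baire_ball_sym baire_ball_triangle erefl.

Lemma baire_ball_agree (x y : T) k : ball x (k.+1%:R^-1 : R) y <-> agree k.+1 (bval x) (bval y).
Proof.
have k0 : 0 < k.+1%:R :> R by rewrite ltr0n.
split=> [[_ xy] i ik|xy]; first by apply: xy; rewrite mulrC ler_pdivrMr// mul1r ler_nat.
split; first by rewrite invr_gt0.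
by move=> n; rewrite mulrC ler_pdivrMr// mul1r ler_nat => nk; exact: xy.
Qed.

Lemma baire_ball_small (x y : T) (e : R) : 0 < e -> agree (Num.truncn e^-1).+1 (bval x) (bval y) ->
  ball x e y.
Proof.
move=> e0 xy; split=> // n; rewrite mulrC -ler_pdivlMr// mul1r => ne; apply: xy.
have : n.+1%:R < (Num.truncn e^-1).+1%:R :> R by exact: le_lt_trans ne (truncnS_gt _).
by rewrite ltr_nat => /ltnW.
Qed.

Lemma baire_complete (F : set_system T) : ProperFilter F -> cauchy F -> cvg F.
Proof.
move=> FF /cauchyP Fc.
have /choice[y yP] : forall k, exists y : T, F [set z | agree k.+1 (bval y) (bval z)].
  move=> k; have [|y Fy] := Fc (k.+1%:R^-1 : R); first by rewrite invr_gt0 ltr0n.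
  by exists y; apply: filterS Fy => z /baire_ball_agree.
pose w n := bval (y n) n.
have wy k : agree k.+1 w (bval (y k)).
  move=> n nk; have [z [zk zn]] := filter_ex (filterI (yP k) (yP n)).
  by rewrite /w zn// -zk.
have wC : C w.
  apply: C_closed => n; have [z zn] := filter_ex (yP n).
  exists (bval z); first exact: bvalP.
  by move=> i ni; rewrite (wy n) ?zn// ltnS ltnW.
apply/cvg_ex; exists (BairePoint wC : T) => A /nbhs_ballP[e /= e0 eA].
apply: filterS (yP (Num.truncn e^-1)) => z hz; apply: eA.
apply: baire_ball_small => // i ik /=; by rewrite (wy (Num.truncn e^-1))//; exact: hz.
Qed.

HB.instance Definition _ := Uniform_isComplete.Build T baire_complete.

Lemma baire_hausdorff : hausdorff_space T.
Proof.
move=> x y xy; apply: bval_inj; apply/funext => n.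
have n0 : 0 < n.+1%:R^-1 :> R by rewrite invr_gt0 ltr0n.
have [z [/baire_ball_agree xz /baire_ball_agree yz]] :=
  xy _ _ (nbhsx_ballx x _ n0) (nbhsx_ballx y _ n0).
by rewrite xz// yz.
Qed.

Definition baire_cylinder (s : seq nat) : set T :=
  [set x | forall i, (i < size s)%N -> bval x i = nth 0%N s i].

Lemma baire_cylinder_open s : open (baire_cylinder s).
Proof.
rewrite openE => x xs; apply/nbhs_ballP; exists ((size s).+1%:R^-1 : R).
  by rewrite /= invr_gt0 ltr0n.
by move=> y /baire_ball_agree xy i si; rewrite -xy ?xs// ltnW.
Qed.

Lemma baire_cylinder_basis (x : T) V : nbhs x V ->
  exists s, baire_cylinder s x /\ baire_cylinder s `<=` V.
Proof.
move=> /nbhs_ballP[e /= e0 eV]; exists (mkseq (bval x) (Num.truncn e^-1).+1); split.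
  by move=> i; rewrite size_mkseq => ik; rewrite nth_mkseq.
move=> y ys; apply: eV; apply: baire_ball_small => // i ik.
by rewrite ys ?size_mkseq// nth_mkseq.
Qed.

Lemma baire_second_countable : @second_countable T.
Proof.
exists (range baire_cylinder).
  by apply: card_le_trans (card_image_le _ _) _; exact: countableP.
split=> [_ [s _ <-]|x V /baire_cylinder_basis[s [xs sV]]]; first exact: baire_cylinder_open.
by exists (baire_cylinder s) => //; split=> //; exists s.
Qed.

End BaireSubspace.

(** The codes interleaved with their unique witnesses form a closed subset of Baire space. Its Borel
    sets are those of [E]: the bits are the even coordinates, and the witness depends measurably on
    them. *)
Lemma coded_standard_borel (R : realType) d (E : measurableType d) :
  coded E -> standard_borel_type R E.
Proof.
move=> [f [finj mE rf]]; have [C [beta [Ccl mbeta CE]]] := witnessed_borel rf.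
pose code (a : nat -> bool) (b : nat -> nat) n := if odd n then b n./2 else nat_of_bool (a n./2).
have code_even a b n : code a b n.*2 = a n by rewrite /code odd_double doubleK.
have code_odd a b n : code a b n.*2.+1 = b n.
  by rewrite /code /= odd_double /= uphalf_double.
pose Cl : set (nat -> nat) := [set w | exists a b, C a b /\ w = code a b].
have Clf x : Cl (code (f x) (beta (f x))).
  by exists (f x), (beta (f x)); split=> //; apply/CE; split=> //; exists x.
have Ccl' w : (forall n, exists2 w', Cl w' & agree n w w') -> Cl w.
  move=> wC; exists (fun i => w i.*2 == 1%N), (odds w); split.
    apply: Ccl => n; have [w' [a [b [Cab w'E]]] ww'] := wC n.*2.+1.
    exists a, b; split=> // i ni.
      by rewrite ww' ?ltnS ?leq_double 1?ltnW// w'E code_even; case: (a i).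
    by rewrite /odds ww' ?w'E ?code_odd// ltnS ltn_double.
  apply/funext => n; have [w' [a [b [_ w'E]]] ww'] := wC n.+1.
  rewrite /code /odds; case: ifP => nodd.
    by congr w; rewrite -[LHS]odd_double_half nodd.
  have wn : w n = a n./2.
    by rewrite ww'// w'E /code nodd.
  have -> : n./2.*2 = n by rewrite -[RHS]odd_double_half nodd.
  by rewrite wn; case: (a _).
pose P := baire_space (Clf point) Ccl' .
pose phi x : P := BairePoint (Clf x).
have phi_even x n : bval (phi x) n.*2 = f x n by rewrite /= code_even.
exists P; split; [exact: baire_hausdorff|exact: baire_second_countable|].
exists phi; split.
  have phi_inj : injective phi.
    move=> x y xy; apply: finj; apply/funext => n.
    by have := phi_even x n; rewrite xy phi_even; case: (f x n); case: (f y n).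
  have phi_surj (w : P) : exists x, phi x = w.
    case: w => w wP; have [a [b [/CE[[x _ fx] bE] wE]]] := wP.
    by exists x; apply: bval_inj; rewrite /= fx -bE wE.
  have /choice[psi psiP] := phi_surj.
  exists psi; last exact: psiP.
  by move=> x; apply: phi_inj; rewrite psiP.
rewrite mE; apply/seteqP; split.
  rewrite sigma_preimageE; apply: smallest_sub.
    exact/sigma_algebra_preimage/smallest_sigma_algebra.
  move=> _ [_ [n _ <-] <-]; exists [set w : P | bval w n.*2 = 1%N].
    apply: sub_sigma_algebra; rewrite openE => w wn; apply/nbhs_ballP.
    exists (n.*2.+1%:R^-1 : R); first by rewrite /= invr_gt0 ltr0n.
    by move=> w' /baire_ball_agree ww'; rewrite /= -ww'.
  by rewrite !setTI; apply/seteqP; split=> x /=; rewrite code_even; case: (f x n).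
rewrite sigma_preimageE; apply: smallest_sub.
  exact/sigma_algebra_preimage/smallest_sigma_algebra.
have mcoord i k : <<s cylinders>> [set a | code a (beta a) i = k].
  rewrite /code; case: (odd i); first exact: mbeta.
  case: k => [|[|k]]; rewrite -[_ _]/(measurable (_ : set bits)).
  - rewrite (_ : [set _ | _] = [set a : bits | ~ a i./2]); last first.
      by apply/seteqP; split=> a /=; case: (a _).
    by apply: measurable_not; exact: measurable_bit.
  - rewrite (_ : [set _ | _] = [set a : bits | a i./2]); last first.
      by apply/seteqP; split=> a /=; case: (a _).
    exact: measurable_bit.
  - rewrite (_ : [set _ | _] = [set a : bits | False]); first exact: measurable_const.
    by apply/seteqP; split=> a //=; case: (a _).
move=> _ [V oV <-]; rewrite setTI.
pose B := [set a : bits | exists s : seq nat,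
  @baire_cylinder _ _ (Clf point) Ccl' s `<=` V /\
  forall i, (i < size s)%N -> code a (beta a) i = nth 0%N s i].
exists B.
  rewrite -[_ _]/(measurable (_ : set bits)).
  apply: measurable_exists => s; apply: measurable_and; first exact: measurable_const.
  apply: measurable_forall => i; apply: measurable_imply; first exact: measurable_const.
  exact: mcoord.
rewrite setTI; apply/seteqP; split=> x.
  by move=> [s [sV xs]]; apply: sV.
move=> Vx; have [s [xs sV]] := baire_cylinder_basis (open_nbhs_nbhs (conj oV Vx)).
by exists s.
Qed.

(** * Compactness and the additive tree of an analytic relation *)

Lemma agree_sym T n (a b : nat -> T) : agree n a b -> agree n b a.
Proof. by move=> ab i /ab. Qed.

Lemma agree_trans T n (a b c : nat -> T) : agree n a b -> agree n b c -> agree n a c.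
Proof. by move=> ab bc i ni; rewrite ab ?bc. Qed.

(** An initial segment extending to solutions of all orders has a one-value prolongation with the
    same property, as only the finitely many values in [L k] compete. *)
Lemma konig (X : eqType) (P : nat -> (nat -> X) -> Prop) (L : nat -> seq X) :
  (forall n g g', P n g -> agree n g g' -> P n g') ->
  (forall m n g, (m <= n)%N -> P n g -> P m g) ->
  (forall n g i, P n g -> (i < n)%N -> g i \in L i) ->
  (forall n, exists g, P n g) -> exists g, forall n, P n g.
Proof.
move=> Pagree Pmono PL Pn.
pose big k g := forall n, (k <= n)%N -> exists2 g', agree k g g' & P n g'.
have bigS k g : big k g -> exists2 g', agree k g g' & big k.+1 g'.
  move=> gk; apply: contrapT => H.
  pose upd x := fun i => if i == k then x else g i.
  have gupd x : agree k g (upd x) by move=> i ik; rewrite /upd ltn_eqF.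
  have /choice[N NP] : forall x, exists N, (k < N)%N /\ forall g', agree k.+1 (upd x) g' -> ~ P N g'.
    move=> x; apply: contrapT => HN; apply: H; exists (upd x) => // n kn.
    apply: contrapT => Hn; apply: HN; exists n; split=> // g' gg' Pg'.
    by apply: Hn; exists g'.
  pose M := \max_(x <- L k) N x.
  have [g' gg' Pg'] := gk (maxn M k.+1) (leq_trans (leqnSn k) (leq_maxr _ _)).
  have gL : g' k \in L k by apply: PL Pg' _; rewrite leq_max ltnSn orbT.
  have [_] := NP (g' k); apply; last first.
    by apply: Pmono Pg'; rewrite leq_max /M (big_rem (g' k))//= leq_maxl.
  move=> i; rewrite ltnS leq_eqVlt /upd => /orP[/eqP->|ik]; first by rewrite eqxx.
  by rewrite ltn_eqF// gg'.
have [g0 Pg0] := Pn 0%N.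
have /choice[nx nxP] : forall q : nat * (nat -> X), exists g', big q.1 q.2 ->
    agree q.1 q.2 g' /\ big q.1.+1 g'.
  move=> [k g]; have [/bigS[g' ? ?]|?] := pselect (big k g); first by exists g'.
  by exists g.
pose st := fix st k := if k is k'.+1 then nx (k', st k') else g0.
have stbig k : big k (st k).
  elim: k => [|k IH]; first by move=> n _; have [g Pg] := Pn n; exists g.
  by have [_] := nxP (k, st k) IH.
have stagree k m : agree k (st k) (st (k + m)%N).
  elim: m => [|m IH]; first by rewrite addn0.
  apply: agree_trans IH _; rewrite addnS.
  have [h _] := nxP (k + m, st (k + m))%N (stbig _).
  by apply: agree_le h; exact: leq_addr.
exists (fun n => st n.+1 n) => n.
have [g gn Pg] := stbig n n (leqnn n).
apply: Pagree Pg _; apply: agree_trans (agree_sym gn) _ => i ni.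
have := stagree i.+1 (n - i.+1)%N i (ltnSn i); by rewrite subnKC// => ->.
Qed.

Section AdditiveTree.
Variable C : (nat -> bool) -> (nat -> bool) -> (nat -> nat) -> Prop.

Definition approx n a b w := exists a' b' w',
  [/\ C a' b' w', agree n a a', agree n b b' & agree n w w'].

Hypothesis C_closed : forall a b w, (forall n, approx n a b w) -> C a b w.

Let r a b := exists w, C a b w.
Hypothesis r_trans : forall a b c, r a b -> r b c -> r a c.

(* Louveau-Rosendal: chains of approximate [C]-steps, each of positive cost at
   every coordinate.  Costs add up along concatenation, and the value [alpha 0]
   bounds the number of steps, so that a compactness argument applies. *)
Inductive chain n : (nat -> bool) -> (nat -> bool) -> (nat -> nat) -> Prop :=
| chain_refl a b alpha : agree n a b -> chain n a b alpha
| chain_step a c b w s alpha : approx n a c w ->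
    (forall i, (i < n)%N -> (w i < s i <= alpha i)%N) ->
    chain n c b (fun i => alpha i - s i)%N -> chain n a b alpha.

Lemma approx_le m n a b w : (m <= n)%N -> approx n a b w -> approx m a b w.
Proof.
move=> mn [a' [b' [w' [Cw aa bb ww]]]]; exists a', b', w'.
by split=> //; apply: agree_le mn _.
Qed.

Lemma approx_agree n a b w a' b' w' : agree n a a' -> agree n b b' -> agree n w w' ->
  approx n a b w -> approx n a' b' w'.
Proof.
move=> aa bb ww [a2 [b2 [w2 [Cw aa2 bb2 ww2]]]]; exists a2, b2, w2.
by split=> //; [apply: agree_trans aa2|apply: agree_trans bb2|apply: agree_trans ww2];
  apply: agree_sym.
Qed.

Lemma chain_mono m n a b alpha : (m <= n)%N -> chain n a b alpha -> chain m a b alpha.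
Proof.
move=> mn; elim=> {a b alpha} [a b alpha ab|a c b w s alpha acw ws _ IH].
  by apply: chain_refl; exact: agree_le ab.
apply: chain_step IH; first exact: approx_le acw.
by move=> i im; apply: ws; exact: leq_trans mn.
Qed.

Lemma chain_agree_le n a b alpha : chain n a b alpha -> forall a' b' beta,
  agree n a a' -> agree n b b' -> (forall i, (i < n)%N -> (alpha i <= beta i)%N) ->
  chain n a' b' beta.
Proof.
elim=> {a b alpha} [a b alpha ab|a c b w s alpha acw ws _ IH] a' b' beta aa bb ab'.
  apply: chain_refl; apply: agree_trans (agree_sym aa) _; exact: agree_trans ab bb.
apply: (@chain_step n a' c b' w s beta).
- by apply: approx_agree acw.
- by move=> i ni; have /andP[-> h] := ws i ni; rewrite (leq_trans h)// ab'.
- apply: IH => // i ni; rewrite leq_sub2r// ab'//.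
Qed.

Lemma chain_trans n a b c alpha beta : chain n a b alpha -> chain n b c beta ->
  chain n a c (fun i => alpha i + beta i)%N.
Proof.
move=> ab; elim: ab beta => {a b alpha} [a b alpha ab|a d b w s alpha adw ws _ IH] beta bc.
  apply: chain_agree_le bc _ _ _ (agree_sym ab) _ _ => // i _; exact: leq_addl.
apply: (@chain_step n a d c w s) => //.
  by move=> i ni; have /andP[-> h] := ws i ni; rewrite (leq_trans h)// leq_addr.
apply: chain_agree_le (IH _ bc) _ _ _ _ _ _ => // i ni.
by have /andP[_ h] := ws i ni; rewrite addnBAC.
Qed.

Lemma chain_complete a b : r a b -> exists alpha, forall n, chain n a b alpha.
Proof.
move=> [w Cw]; exists (fun i => (w i).+1) => n.
apply: (@chain_step n a b b w (fun i => (w i).+1)); last exact: chain_refl.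
  by exists a, b, w.
by move=> i _; rewrite ltnSn.
Qed.

(** If [a] and [b] differ at place [l], chains of precision above [l] have a first step, whose data
    are bounded by [alpha]; compactness extracts one step valid at all precisions, and closedness
    makes it exact. The cost left at place 0 has dropped, so induction on [alpha 0] applies and
    transitivity composes the steps. *)
Lemma chain_sound a b alpha : (forall n, chain n a b alpha) -> a = b \/ r a b.
Proof.
have [m] := ubnP (alpha 0%N); elim: m a alpha => // m IH a alpha am ab.
have [->|neq] := pselect (a = b); first by left.
have [l al] : exists l, a l <> b l by apply/existsNP => h; apply: neq; apply/funext.
pose L i : seq (bool * nat * nat) :=
  [seq (p, s) | p <- [seq (c, w) | c <- [:: true; false], w <- iota 0 (alpha i).+1],
                s <- iota 0 (alpha i).+1].
pose P n (g : nat -> bool * nat * nat) := [/\ approx n a (fun i => (g i).1.1) (fun i => (g i).1.2),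
  forall i, (i < n)%N -> ((g i).1.2 < (g i).2 <= alpha i)%N
  & chain n (fun i => (g i).1.1) b (fun i => alpha i - (g i).2)%N].
have [|||n|g gP] := @konig _ P L.
- move=> n g g' [acw ws ch] gg'; split.
  + by apply: approx_agree acw => // i ni; rewrite gg'.
  + by move=> i ni; rewrite -gg'//; exact: ws.
  + by apply: chain_agree_le ch _ _ _ _ _ _ => // i ni; rewrite gg'.
- move=> k n g kn [acw ws ch]; split.
  + exact: approx_le acw.
  + by move=> i ik; apply: ws; exact: leq_trans kn.
  + exact: chain_mono ch.
- move=> n g i [_ ws _] /ws/andP[h1 h2].
  apply/allpairsP; exists ((g i).1, (g i).2); split; last by case: (g i).
    apply/allpairsP; exists ((g i).1.1, (g i).1.2); split; last by case: (g i) => -[].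
      by rewrite !inE; case: (g i).1.1.
    by rewrite mem_iota add0n ltnS (leq_trans (ltnW h1) h2).
  by rewrite mem_iota add0n ltnS.
- suff [g gP] : exists g, P (maxn n l.+1) g.
    exists g; have [acw ws ch] := gP; have nl : (n <= maxn n l.+1)%N by exact: leq_maxl.
    split; [exact: approx_le acw|by move=> i ik; apply: ws; exact: leq_trans nl|].
    exact: chain_mono ch.
  have := ab (maxn n l.+1); move E: (maxn n l.+1) => k ch.
  have lk : (l < k)%N by rewrite -E leq_maxr.
  rewrite /P; case: ch lk al => [a0 b0 alpha0|a0 c b0 w s alpha0].
    by move=> ab0 lk /(_ (ab0 _ lk)).
  by move=> acw ws ch lk _; exists (fun i => (c i, w i, s i)).
pose c i := (g i).1.1.
have rac : r a c.
  by exists (fun i => (g i).1.2); apply: C_closed => n; have [] := gP n.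
have [||cb|rcb] := IH c (fun i => alpha i - (g i).2)%N.
- have [_ /(_ 0%N (ltnSn 0)) /andP[h1 h2] _] := gP 1%N.
  by rewrite -ltnS (leq_trans _ am)// ltnS ltn_subrL (leq_ltn_trans _ h1)//= (leq_trans _ h2)// (leq_ltn_trans _ h1).
- by move=> n; have [] := gP n.
- by right; rewrite -cb.
- by right; exact: r_trans rac rcb.
Qed.

End AdditiveTree.

(* The tree of pairs (initial segments of) [(v, alpha)] such that a chain of
   cost [alpha] leads from [v] to [a]. *)
Definition chain_tree C (a : nat -> bool) : set (seq (bool * nat)) :=
  [set t | chain C (size t) (nth false (unzip1 t)) a (nth 0%N (unzip2 t))].

Section AnalyticTree.
Context (R : realType) d (E : measurableType d).
Variables (D : set E) (r : E -> E -> Prop).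
Hypothesis Dr : analytic_equivalence R D r.

(** In codes the relation is the projection of a Borel set, hence, with witnesses, of a closed one.
    Injectivity of the codes turns transitivity of [r] into that of the projection. *)
Lemma analytic_chain : exists (f : E -> nat -> bool) C,
  (forall n, measurable [set x | f x n]) /\
  forall x y, D x -> D y -> (r x y <-> exists alpha, forall n, chain C n (f x) (f y) alpha).
Proof.
have [[[sE mD] [rxx rsym rtr]] [d' [Z [sZ [B mB EB]]]]] := Dr.
have [f cf] := standard_borel_coded sE; have [g cg] := standard_borel_coded sZ.
have [finj _ _] := cf; have [hinj mh rh] := borel_code_prod (borel_code_prod cf cf) cg.
set h := fun x : E * E * Z => _ in hinj mh rh.
have : <<s cylinders>> (h @` B).
  have [B' mB' EB'] : preimage_set_system setT h <<s cylinders>> B by rewrite -mh.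
  rewrite (_ : h @` B = B' `&` range h); first exact: (@measurableI _ bits).
  apply/seteqP; split=> [_ [x Bx <-]|a [B'x [x _ xE]]].
    by split; [move: Bx; rewrite -EB' => -[]|exists x].
  by exists x => //; rewrite -EB'; split=> //; rewrite /= xE.
move=> /witnessed_borel[C0 [beta [C0cl _ C0E]]].
(* The even places of [w] hold the bits of the auxiliary point, the odd places the witness. *)
pose C a b w := C0 (interleave (interleave a b) (fun n => evens w n == 1%N)) (odds w) /\
  forall n, (evens w n <= 1)%N.
exists f, C; split; first by move=> n; exact: measurable_code cf.
have rE a b : (exists w, C a b w) <-> exists x y, [/\ a = f x, b = f y, D x, D y & r x y].
  split=> [[w [/C0E[[[[x y] z] Bxyz exyz] _] _]]|[x [y [-> -> Dx Dy rxy]]]].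
    have [ex ey] : a = f x /\ b = f y.
      have e1 := congr1 (@evens bool) exyz; rewrite !evens_interleave /= in e1.
      have e2 := congr1 (@evens bool) e1; rewrite !evens_interleave /= in e2.
      by have e3 := congr1 (@odds bool) e1; rewrite !odds_interleave /= in e3.
    have : [set xy : E * E | [/\ D xy.1, D xy.2 & r xy.1 xy.2]] (x, y).
      by rewrite EB; exists (x, y, z).
    by move=> [Dx Dy rxy]; exists x, y.
  have : (fst @` B) (x, y) by rewrite -EB.
  move=> [[[x' y'] z] Bz [ex ey]]; move: Bz; rewrite ex ey => Bz.
  pose e := h (x, y, z); exists (fun n => if odd n then beta e n./2 else nat_of_bool (g z n./2)).
  have ev n : evens (fun n => if odd n then beta e n./2 else nat_of_bool (g z n./2)) n = g z n.
    by rewrite /evens odd_double doubleK.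
  split; last by move=> n; rewrite ev; case: (g z n).
  apply/C0E; rewrite (_ : interleave _ _ = e).
    split; first by exists (x, y, z).
    by apply/funext => n; rewrite /odds /= odd_double/= uphalf_double.
  by rewrite /e /h/=; congr interleave; apply/funext => n; rewrite ev; case: (g z n).
have Ccl a b w : (forall n, approx C n a b w) -> C a b w.
  move=> H; split; last first.
    move=> n; have [a' [b' [w' [[_ w1] _ _ ww]]]] := H n.*2.+1.
    by rewrite /evens ww ?ltnSn//; exact: w1.
  apply: C0cl => n; have [a' [b' [w' [[Cw _] aa bb ww]]]] := H n.*2.+2.
  exists (interleave (interleave a' b') (fun n => evens w' n == 1%N)), (odds w'); split=> //.
    move=> i ni; rewrite /interleave /evens.
    by case: ifP => oi; [rewrite ww//|case: ifP => oi2; [rewrite bb|rewrite aa]] => //;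
      have := odd_double_half i; have := odd_double_half i./2; rewrite -!addnn; lia.
  by move=> i ni; rewrite /odds ww// -!addnn; lia.
have Ctr a b c : (exists w, C a b w) -> (exists w, C b c w) -> exists w, C a c w.
  move=> /rE[x [y [-> -> Dx Dy rxy]]] /rE[y' [z [/finj <- -> _ Dz ryz]]].
  by apply/rE; exists x, z; split=> //; exact: rtr ryz.
move=> x y Dx Dy; split=> [rxy|[alpha ab]].
  by apply: chain_complete; apply/rE; exists x, y.
(* The case of equal codes is the one covered by reflexivity. *)
have [/finj <-|/rE[x' [y' [/finj <- /finj <- _ _]]]//] := chain_sound Ccl Ctr ab.
exact: rxx.
Qed.

End AnalyticTree.

(** * The tree attached to a point and its translations *)

Section ChainTree.
Variable C : (nat -> bool) -> (nat -> bool) -> (nat -> nat) -> Prop.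

Lemma chain_tree_prefix a s t : prefix s t -> chain_tree C a t -> chain_tree C a s.
Proof.
move=> /prefixP[u ->]; rewrite /chain_tree /= => /(chain_mono (m := size s)).
rewrite size_cat leq_addr => /(_ isT) h.
apply: chain_agree_le h _ _ _ _ _ _ => // i si; rewrite /unzip1 /unzip2 !map_cat nth_cat size_map si //.
Qed.

Lemma chain_tree_branch a v alpha :
  (forall n, chain_tree C a (mkseq (fun j => (v j, alpha j)) n)) <->
  forall n, chain C n v a alpha.
Proof.
rewrite /chain_tree /=; split=> h n; have := h n.
  rewrite size_mkseq => {}h; apply: chain_agree_le h _ _ _ _ _ _ => // i ni;
  by rewrite /unzip1 /unzip2 -map_comp nth_mkseq.
rewrite size_mkseq => {}h; apply: chain_agree_le h _ _ _ _ _ _ => // i ni;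
  by rewrite /unzip1 /unzip2 -map_comp nth_mkseq.
Qed.

Lemma chain_tree_self a n : chain_tree C a (mkseq (fun j => (a j, 0%N)) n).
Proof. by apply (chain_tree_branch a a (fun=> 0%N)) => k; exact: chain_refl. Qed.

Definition shift_node (alpha : nat -> nat) (t : seq (bool * nat)) : seq (bool * nat) :=
  mkseq (fun j => ((nth (false, 0%N) t j).1, (nth (false, 0%N) t j).2 + alpha j)%N) (size t).

(** A chain ending in [a] is prolonged by one from [a] to [b]. Costs add, so the integers of the
    node move by [alpha] and its bits stay. *)
Lemma chain_tree_shift a b alpha t : (forall n, chain C n a b alpha) ->
  chain_tree C a t -> chain_tree C b (shift_node alpha t).
Proof.
move=> ab; rewrite /chain_tree /= size_mkseq => ta.
apply: chain_agree_le (chain_trans ta (ab _)) _ _ _ _ _ _ => // i it.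
  by rewrite /unzip1 -map_comp nth_mkseq//= (nth_map (false, 0%N)).
by rewrite /unzip2 -map_comp nth_mkseq//= (nth_map (false, 0%N)).
Qed.

End ChainTree.

(** * Bounded operators and the strong operator topology *)

Lemma bop_ext (R : realType) (Y X : completeNormedModType R) (T T' : bounded_op Y X) :
  (forall y, T y = T' y) -> T = T'.
Proof.
case: T => f fb; case: T' => g gb /= fg.
have e : f = g.
  case: f g fg {fb gb} => [f [[f1] [f2]]] [g [[g1] [g2]]] /= /funext fg; subst g.
  by rewrite (Prop_irrelevance f1 g1) (Prop_irrelevance f2 g2).
by subst g; congr BoundedOp; exact: Prop_irrelevance.
Qed.

Section OperatorAlgebra.
Context {R : realType}.

Lemma bop_bound (Y X : completeNormedModType R) (T : bounded_op Y X) :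
  exists2 M, 0 < M & forall y, `|T y| <= M * `|y|.
Proof.
have [M TM] := bop_bounded T; exists (Num.max M 1); first by rewrite lt_max ltr01 orbT.
by move=> y; apply: le_trans (TM y) _; rewrite ler_wpM2r// le_max lexx.
Qed.

Variable X : completeNormedModType R.
Implicit Types A B : bounded_op X X.

Lemma bop_comp_bounded A B : exists M : R, forall y, `|(A \o B) y| <= M * `|y|.
Proof.
have [M M0 AM] := bop_bound A; have [N N0 BN] := bop_bound B; exists (M * N) => y /=.
by apply: le_trans (AM _) _; rewrite -mulrA ler_pM2l.
Qed.

Definition bop_comp A B : bounded_op X X := @BoundedOp R X X (A \o B) (bop_comp_bounded A B).

Lemma bop_id_bounded : exists M : R, forall y : X, `|(@idfun X : {linear X -> X}) y| <= M * `|y|.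
Proof. by exists 1 => y; rewrite mul1r. Qed.

Definition bop_id : bounded_op X X := BoundedOp bop_id_bounded.

Lemma bop_compE A B x : bop_comp A B x = A (B x).
Proof. by []. Qed.

Lemma sot_ball_open (z z0 : X) (e : R) : sot_open [set T : bounded_op X X | `|T z - z0| < e].
Proof.
exists [set f : {ptws X -> X} | `|f z - z0| < e]; last by [].
have -> : [set f : {ptws X -> X} | `|f z - z0| < e] = (fun f : {ptws X -> X} => f z) @^-1` (ball z0 e).
  by apply/seteqP; split=> f /=; rewrite -ball_normE /= distrC.
apply: open_comp; last exact: ball_open.
by move=> f _; apply: (@proj_continuous _ (fun=> X)).
Qed.

Lemma measurable_sot_ball (z z0 : X) (e : R) :
  measurable [set T : bounded_op X X | `|T z - z0| < e].
Proof. by apply: sub_sigma_algebra; exact: sot_ball_open. Qed.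

Lemma sot_open_basic (O : set (bounded_op X X)) T : sot_open O -> O T ->
  exists (ys : seq X) (e : R), 0 < e /\
    forall T' : bounded_op X X, (forall y, y \in ys -> `|T' y - T y| < e) -> O T'.
Proof.
case=> O' oO' <- O'T.
pose B (p : seq X * R) := [set g : X -> X | forall y, y \in p.1 -> `|g y - T y| < p.2].
pose F := filter_from [set p : seq X * R | 0 < p.2] B.
have FF : Filter F.
  apply: filter_from_filter; first by exists ([::], 1) => /=.
  move=> [s e] [s' e'] /= e0 e'0; exists (s ++ s', Num.min e e'); first by rewrite /= lt_min e0.
  move=> g /= gB; split=> y /= ys; have := gB y; rewrite mem_cat ys ?orbT => /(_ isT);
    by rewrite lt_min => /andP[].
have : {ptws, F --> (T : X -> X)}.
  apply/pointwise_cvgP => y V /nbhs_ballP[e /= e0 eV].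
  exists ([:: y], e) => //= g /(_ y); rewrite mem_head => /(_ isT) gy.
  by apply: eV; rewrite -ball_normE /= distrC.
move=> /(_ O') H; have [|p p0 pO'] := H; first exact: open_nbhs_nbhs.
by exists p.1, p.2; split=> // T' HT'; apply: pO'.
Qed.

End OperatorAlgebra.

(** * A countable dense set of rational combinations *)

Section DenseSequence.
Variables (R : realType) (U : completeNormedModType R) (u : nat -> U).
Hypothesis u1 : normalized u.
Hypothesis ub : schauder_basis_of setT u.

Definition rcomb (s : seq rat) : U := \sum_(i < size s) ratr s`_i *: u i.

Definition rlin (c : rat) (s t : seq rat) : seq rat :=
  mkseq (fun i => c * s`_i + t`_i) (maxn (size s) (size t)).

Lemma rcomb_widen n s : (size s <= n)%N -> rcomb s = \sum_(i < n) ratr s`_i *: u i.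
Proof.
move=> sn; rewrite /rcomb (big_ord_widen _ (fun i => ratr s`_i *: u i) sn) big_mkcond /=.
by apply: eq_bigr => i _; case: ltnP => // si; rewrite nth_default// rmorph0 scale0r.
Qed.

Lemma rcomb_lin c s t : rcomb (rlin c s t) = ratr c *: rcomb s + rcomb t.
Proof.
rewrite (@rcomb_widen (maxn (size s) (size t)) s) ?leq_maxl//.
rewrite (@rcomb_widen (maxn (size s) (size t)) t) ?leq_maxr//.
rewrite /rcomb size_mkseq scaler_sumr -big_split /=; apply: eq_bigr => i _.
by rewrite nth_mkseq// rmorphD rmorphM scalerDl scalerA.
Qed.

Lemma rat_near (x e : R) : 0 < e -> exists q : rat, `|x - ratr q| < e.
Proof.
move=> e0; have [|q] := @rat_in_itvoo R (x - e) (x + e).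
  by rewrite ltrBlDr -addrA ltrDl addr_gt0.
rewrite in_itv /= => /andP[q1 q2]; exists q; rewrite ltr_norml; lra.
Qed.

Lemma rcomb_dense z (e : R) : 0 < e -> exists s, `|z - rcomb s| < e.
Proof.
move=> e0; have e20 : 0 < e / 2 by rewrite divr_gt0.
have [n /(_ _ (leqnn n)) nz] := (cvg_seqP _ _).1 (coefP ub z) _ e20.
have d0 : 0 < e / 2 / n.+1%:R by rewrite divr_gt0.
have /choice[q qP] : forall i, exists q : rat, `|coef ub z i - ratr q| < e / 2 / n.+1%:R.
  by move=> i; exact: rat_near.
exists (mkseq q n); rewrite (rcomb_widen (n := n)) ?size_mkseq//.
have -> : \sum_(i < n) ratr (mkseq q n)`_i *: u i = \sum_(i < n) ratr (q i) *: u i.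
  by apply: eq_bigr => i _; rewrite nth_mkseq.
rewrite -(subrKA (series (lincomb (coef ub z) u) n)).
apply: le_lt_trans (ler_normD _ _) _.
rewrite [ltRHS](splitr e); apply: ler_ltD => //.
rewrite /series /= big_mkord -sumrB; apply: le_lt_trans (ler_norm_sum _ _ _) _.
apply: (@le_lt_trans _ _ (\sum_(i < n) (e / 2 / n.+1%:R))).
  by apply: ler_sum => i _; rewrite /lincomb -scalerBl normrZ u1 mulr1 ltW.
by rewrite sumr_const card_ord -[_ *+ _]mulr_natr -mulrA gtr_pMr// mulrC ltr_pdivrMr// mul1r ltr_nat.
Qed.

End DenseSequence.

(* [lra] treats [ratr] as a morphism and fails on its values. *)
Ltac hide_ratr :=
  repeat match goal with H : context [@ratr ?F ?q] |- _ => revert H end;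
  repeat match goal with |- context [@ratr ?F ?q] =>
    let x := fresh in pose (x := @ratr F q);
    repeat match goal with |- context [@ratr ?G q] => change (@ratr G q) with x end;
    clearbody x
  end;
  intros.

Section Reciprocals.
Variable R : realType.

Definition recip (j : nat) : R := j.+1%:R^-1.

Lemma recip_gt0 j : 0 < recip j.
Proof. by rewrite invr_gt0 ltr0n. Qed.

Lemma recip_small (e : R) : 0 < e -> exists N, forall j, (N <= j)%N -> recip j < e.
Proof.
move=> e0; exists (Num.truncn e^-1) => j Nj.
rewrite invf_plt ?posrE ?ltr0n//; apply: lt_le_trans (truncnS_gt _) _.
by rewrite ler_nat.
Qed.

Lemma ratr_recip j : ratr (j.+1%:R^-1) = recip j.
Proof. by rewrite fmorphV rmorph_nat. Qed.

Lemma rat_recip_gt0 j : 0 < j.+1%:R^-1 :> rat.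
Proof. by rewrite invr_gt0 ltr0n. Qed.

Lemma eps_rat (e : R) : 0 < e -> exists2 q : rat, 0 < q & ratr q < e.
Proof.
move=> e0; have [q] := rat_in_itvoo e0; rewrite in_itv /= => /andP[q1 q2].
by exists q => //; move: q1; rewrite ltr0q.
Qed.

End Reciprocals.

(** * Operators reconstructed from rational approximations *)

Section OperatorFromBits.
Variables (R : realType) (U : completeNormedModType R) (u : nat -> U).
Hypothesis u1 : normalized u.
Hypothesis ub : schauder_basis_of setT u.
Local Notation dd := (rcomb u).
Variable b : seq rat -> seq rat -> rat -> Prop.

(** Axioms for the relation $\|T d_s - d_t\| < q$ of a bounded operator: approximability, triangle
    inequality, openness, rational linearity up to error, and an integer bound. All quantifiers are
    countable, so the codes obeying them form a Borel set. *)
Definition operator_bits :=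
  [/\ forall s q, 0 < q -> exists t, b s t q,
      forall s t t' q q', b s t q -> b s t' q' -> `|dd t - dd t'| < ratr q + ratr q',
      forall s t q, b s t q <-> exists t' q', b s t' q' /\ `|dd t - dd t'| + ratr q' < ratr q,
      forall c s t q, 0 < q -> exists s' t' r', [/\ b s s' q, b t t' q, b (rlin c s t) r' q
        & `|dd r' - (ratr c *: dd s' + dd t')| < ratr q]
    & exists M : nat, forall s q, 0 < q -> exists t, b s t q /\ `|dd t| <= M%:R * `|dd s| + ratr q].

Hypothesis bb : operator_bits.

(** The image is the limit of vectors approximating it within $1/(j+1)$. The triangle axiom gives
    non-strict inequalities for the limit, and openness makes them strict. *)
Let L_exists s : exists y : U, forall t q, b s t q <-> `|y - dd t| < ratr q.
Proof.
have [b1 b2 b3 _ _] := bb.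
have /choice[t tP] : forall j, exists t, b s t (j.+1%:R^-1) by move=> j; apply: b1; exact: rat_recip_gt0.
have /cvg_ex[y /= yt] : cvgn (dd \o t).
  apply: cauchy_seq_cvg => e e0; have [|N Ne] := @recip_small R (e / 2); first by rewrite divr_gt0.
  exists N => m n Nm mn; apply/ltW/(lt_trans (b2 _ _ _ _ _ (tP n) (tP m))).
  by rewrite !ratr_recip [ltRHS]splitr ltrD// Ne// (leq_trans Nm).
have near t' q' : b s t' q' -> `|y - dd t'| <= ratr q'.
  move=> bt; apply/ler_addgt0Pr => e e0.
  have [|N Ne] := @recip_small R (e / 2); first by rewrite divr_gt0.
  have [|N' N'e] := (cvg_seqP _ _).1 yt (e / 2); first by rewrite divr_gt0.
  pose n := maxn N N'.
  rewrite -(subrKA (dd (t n))); apply: le_trans (ler_normD _ _) _.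
  have := b2 _ _ _ _ _ (tP n) bt; have := N'e n (leq_maxr _ _).
  have := Ne n (leq_maxl _ _); rewrite ratr_recip /=; hide_ratr; lra.
exists y => t' q; split=> [/b3[t2 [q2 [b22 lt2]]]|yq].
  apply: le_lt_trans lt2; rewrite -(subrKA (dd t2)); apply: le_trans (ler_normD _ _) _.
  by rewrite addrC lerD ?near// distrC.
have [|N Ne] := @recip_small R ((ratr q - `|y - dd t'|) / 2); first by rewrite divr_gt0 ?subr_gt0.
apply/b3; exists (t N), (N.+1%:R^-1); split; first exact: tP.
have := near _ _ (tP N); rewrite ratr_recip; have := Ne N (leqnn _).
have := ler_normD (dd t' - y) (y - dd (t N)); rewrite subrKA (distrC (dd t') y); hide_ratr; lra.
Qed.

Let L s : U := projT1 (cid (L_exists s)).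
Let LP s t q : b s t q <-> `|L s - dd t| < ratr q.
Proof. by rewrite /L; case: cid => y /= yP; exact: yP. Qed.

Let L_lin c s t : L (rlin c s t) = ratr c *: L s + L t.
Proof.
have [_ _ _ b4 _] := bb; apply/eqP; rewrite -subr_eq0 -normr_le0; apply/ler_addgt0Pr => e e0.
have c0 : 0 < `|ratr c| + 3 :> R by rewrite ltr_wpDl.
have [q q0 qe] := eps_rat (divr_gt0 e0 c0).
have [s' [t' [r' [/LP sq /LP tq /LP rq dq]]]] := b4 c s t q q0.
have -> : L (rlin c s t) - (ratr c *: L s + L t) = (L (rlin c s t) - dd r') +
    (dd r' - (ratr c *: dd s' + dd t')) - (ratr c *: (L s - dd s') + (L t - dd t')).
  rewrite subrKA scalerBr (addrACA (ratr c *: L s)) -opprD opprB addrA subrK.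
  by [].
apply: le_trans (ler_normB _ _) _; rewrite add0r.
have h1 := ler_normD (L (rlin c s t) - dd r') (dd r' - (ratr c *: dd s' + dd t')).
have h2 := ler_normD (ratr c *: (L s - dd s')) (L t - dd t').
have h3 : `|ratr c *: (L s - dd s')| <= `|ratr c| * ratr q :> R.
  by rewrite normrZ ler_wpM2l// ltW.
move: qe; rewrite ltr_pdivlMr// => qe; hide_ratr; nra.
Qed.

Let L_bound : exists2 M : R, 0 < M & forall s, `|L s| <= M * `|dd s|.
Proof.
have [_ _ _ _ [M MP]] := bb; exists (M%:R + 1); first by rewrite ltr_wpDl.
move=> s; apply: (@le_trans _ _ (M%:R * `|dd s|)); last by rewrite ler_wpM2r// lerDl.
apply/ler_addgt0Pr => e e0.
have [|q q0 qe] := @eps_rat R (e / 2); first by rewrite divr_gt0.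
have [t [/LP bt tM]] := MP s q q0.
have := ler_normD (L s - dd t) (dd t); rewrite subrK; hide_ratr; lra.
Qed.

Let L_lip : exists2 M : R, 0 < M & forall s t, `|L s - L t| <= M * `|dd s - dd t|.
Proof.
have [M M0 LM] := L_bound; exists M => // s t.
by have := LM (rlin (-1) t s); rewrite L_lin rcomb_lin rmorphN1 !scaleN1r ![- _ + _]addrC.
Qed.

(** Extension by density: [L] is Lipschitz with respect to the vectors [dd s], although these do not
    determine [s]. *)
Let T_exists z : exists y : U, forall e : R, 0 < e -> exists s, `|z - dd s| < e /\ `|y - L s| < e.
Proof.
have [M M0 LM] := L_lip.
have /choice[s sP] : forall j, exists s, `|z - dd s| < recip R j.
  by move=> j; apply: (rcomb_dense u1 ub); exact: recip_gt0.
have /cvg_ex[y /= yt] : cvgn (L \o s).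
  apply: cauchy_seq_cvg => e e0.
  have [|N Ne] := @recip_small R (e / M / 2); first by rewrite !divr_gt0.
  exists N => m n Nm mn; apply: le_trans (LM _ _) _.
  rewrite -ler_pdivlMl// mulrC.
  have := sP n; have := sP m; have := Ne m Nm; have := Ne n (leq_trans Nm mn).
  have := ler_normB (z - dd (s m)) (z - dd (s n)); rewrite opprB addrC subrKA; lra.
exists y => e e0; have [N Ne] := @recip_small R e e0.
have [|N' N'e] := (cvg_seqP _ _).1 yt (e / 2); first by rewrite divr_gt0.
exists (s (maxn N N')); split; first by apply: lt_trans (sP _) (Ne _ (leq_maxl _ _)).
by apply: le_lt_trans (N'e _ (leq_maxr _ _)) _; rewrite ltr_pdivrMr// ltr_pMr// ltr1n.
Qed.

Let T z : U := projT1 (cid (T_exists z)).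
Let TP z (e : R) : 0 < e -> exists s, `|z - dd s| < e /\ `|T z - L s| < e.
Proof. by rewrite /T; case: cid => y /= yP; exact: yP. Qed.

Let T_unique z y : (exists2 M : R, 0 < M & forall e : R, 0 < e -> exists s, `|z - dd s| <= M * e /\ `|y - L s| <= M * e) ->
  T z = y.
Proof.
move=> [K K0 H]; have [M M0 LM] := L_lip.
apply/eqP; rewrite -subr_eq0 -normr_le0; apply/ler_addgt0Pr => e e0; rewrite add0r.
have d0 : 0 < e / ((1 + M) * (1 + K)) by rewrite divr_gt0// mulr_gt0// addr_gt0.
have [s [s1 s2]] := TP z d0; have [t [t1 t2]] := H _ d0.
have h1 := ler_normD (T z - L s) (L s - L t); rewrite subrKA in h1.
have h2 := ler_normB (T z - L t) (y - L t); rewrite opprB subrKA in h2.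
have h3 := ler_normB (z - dd t) (z - dd s); rewrite opprB [X in `|X|]addrC subrKA in h3.
have h4 := LM s t.
set x := e / _ in s1 s2 t1 t2 d0.
have -> : e = x * ((1 + M) * (1 + K)) by rewrite divfK// gt_eqF// mulr_gt0// addr_gt0.
nra.
Qed.

Let T_linear : linear T.
Proof.
move=> c z w; apply: T_unique; exists (`|c| + `|z| + `|T z| + 4).
  by rewrite ltr_wpDl// !addr_ge0.
move=> e e0; pose d := Num.min e 1; have d0 : 0 < d by rewrite lt_min e0 ltr01.
have [de d1] : d <= e /\ d <= 1 by rewrite /d !ge_min !lexx orbT.
have [q qc] := rat_near c d0; have [s [s1 s2]] := TP z d0; have [t [t1 t2]] := TP w d0.
exists (rlin q s t); rewrite L_lin rcomb_lin.
have est (x y x' y' : U) : `|x - x'| < d -> `|y - y'| < d ->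
    `|c *: x + y - (ratr q *: x' + y')| <= (`|c| + `|x| + 2) * d.
  move=> xx yy.
  have -> : c *: x + y - (ratr q *: x' + y') =
      c *: (x - x') + ((c - ratr q) *: x' + (y - y')).
    by rewrite scalerBr scalerBl opprD addrACA [RHS]addrA subrKA.
  apply: le_trans (ler_normD _ _) _; rewrite normrZ.
  apply: le_trans (lerD (lexx _) (ler_normD _ _)) _; rewrite normrZ.
  have := ler_normB x (x - x'); rewrite opprB addrC subrK.
  have := normr_ge0 c; have := normr_ge0 x; have := normr_ge0 x'; have := normr_ge0 (x - x').
  have := normr_ge0 (c - ratr q); hide_ratr; nra.
have c0 := normr_ge0 c; have z0 := normr_ge0 z; have Tz0 := normr_ge0 (T z).
split; apply: le_trans (est _ _ _ _ _ _) _ => //; nra.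
Qed.

Let T_bounded : exists M : R, forall z, `|T z| <= M * `|z|.
Proof.
have [M M0 LM] := L_bound; exists M => z; apply/ler_addgt0Pr => e e0.
have M1 : 0 < 1 + M by rewrite addr_gt0.
have [s [s1 s2]] := TP z (divr_gt0 e0 M1).
have h1 := ler_normD (T z - L s) (L s); rewrite subrK in h1.
have h2 := ler_normB z (z - dd s); rewrite opprB addrC subrK in h2.
have h3 := LM s; have -> : e = e / (1 + M) * (1 + M) by rewrite divfK// gt_eqF.
nra.
Qed.

Let Tlin : {linear U -> U} := HB.pack T (GRing.isLinear.Build R U U _ T T_linear).

Lemma operator_of_bits :
  exists T : bounded_op U U, forall s t q, b s t q <-> `|T (dd s) - dd t| < ratr q.
Proof.
exists (@BoundedOp R U U Tlin T_bounded) => s t q; rewrite -[_ (dd s)]/(T (dd s)).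
have -> : T (dd s) = L s; last exact: LP.
apply: T_unique; exists 1 => // e e0; exists s; rewrite !subrr normr0 mul1r; split; exact: ltW.
Qed.

End OperatorFromBits.

(** * Borel structure and coding of the space of operators *)

Section OperatorSpace.
Variables (R : realType) (U : completeNormedModType R) (u : nat -> U).
Hypothesis u1 : normalized u.
Hypothesis ub : schauder_basis_of setT u.
Local Notation dd := (rcomb u).
Local Notation bop := (bounded_op U U).

Definition opbit (p : seq rat * seq rat * rat) : set bop :=
  [set T | `|T (dd p.1.1) - dd p.1.2| < ratr p.2].

Definition opcode (T : bop) (n : nat) : bool :=
  if unpickle n is Some p then `[< opbit p T >] else false.

Lemma opcodeE T p : opcode T (pickle p) = `[< opbit p T >].
Proof. by rewrite /opcode pickleK. Qed.

Definition opball (k : nat) : set bop := [set T | forall z, `|T z| <= k%:R * `|z|].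

Lemma opballE k : opball k = [set T | forall (s : seq rat) (j : nat), exists t, opbit (s, t, j.+1%:R^-1) T /\
  `|dd t| <= k%:R * `|dd s| + recip R j].
Proof.
apply/seteqP; split=> T /= Tk.
  move=> s j; have [t Tt] := rcomb_dense u1 ub (T (dd s)) (recip_gt0 R j).
  exists t; split; first by rewrite /opbit /= ratr_recip.
  have := ler_normB (T (dd s)) (T (dd s) - dd t); rewrite opprB addrC subrK.
  by have := Tk (dd s); lra.
move=> z; apply/ler_addgt0Pr => e e0; have [M M0 TM] := bop_bound T.
pose c := M + k%:R + 3; have c0 : 0 < c by rewrite /c ltr_wpDl// addr_ge0// ltW.
have [s zs] := rcomb_dense u1 ub z (divr_gt0 e0 c0).
have [N /(_ N (leqnn N)) Ne] := recip_small (divr_gt0 e0 c0).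
have [t [+ tk]] := Tk s N; rewrite /opbit /= ratr_recip => Tt.
have h1 := TM (z - dd s); rewrite linearB in h1.
have h2 := ler_normD (T z - T (dd s)) (T (dd s)); rewrite subrK in h2.
have h3 := ler_normD (T (dd s) - dd t) (dd t); rewrite subrK in h3.
have h4 := ler_normB z (z - dd s); rewrite opprB addrC subrK in h4.
have k0 : 0 <= k%:R :> R by [].
have -> : e = e / c * c by rewrite divfK// gt_eqF.
move: (e / c) (divr_gt0 e0 c0) zs Ne => x x0 zs Ne; rewrite /c.
move: (k%:R : R) (recip R N) k0 tk Tt Ne h3 => K r K0 tk Tt Ne h3.
nra.
Qed.

Lemma opball_ex T : exists k, opball k T.
Proof.
have [M M0 TM] := bop_bound T; exists (Num.truncn M).+1 => z.
by apply: le_trans (TM z) _; rewrite ler_wpM2r// ltW// truncnS_gt.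
Qed.

Local Notation bitspace := (g_sigma_algebraType (range opbit)).

Lemma measurable_opball k : measurable (opball k : set bitspace).
Proof.
rewrite opballE; apply: measurable_forall => s; apply: measurable_forall => j.
apply: measurable_exists => t; apply: measurable_and; last exact: measurable_const.
by apply: sub_sigma_algebra; exists (s, t, j.+1%:R^-1).
Qed.

(** On a norm ball finitely many rational conditions suffice to force membership in a strong
    neighbourhood, and the balls [opball k] exhaust the space; hence an open set is a countable
    union of bits cut by balls. *)
Lemma sot_open_bits (O : set bop) : sot_open O -> measurable (O : set bitspace).
Proof.
move=> oO.
pose N (l : seq (seq rat * seq rat * rat)) : set bop := [set T | forall p, p \in l -> opbit p T].
have -> : O = [set T | exists k l, (N l `&` opball k `<=` O) /\ ((forall p, p \in l -> opbit p T) /\ opball k T)].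
  apply/seteqP; split=> [T OT|T [k [l [NO [NT bT]]]]]; last exact: NO.
  have [ys [e [e0 yO]]] := sot_open_basic oO OT.
  have [k Tk] := opball_ex T.
  (* Replacing [y] by a rational vector costs $kq$ for each of the two operators, and approximating
     the images costs $q$ for each. *)
  have k0 : 0 < 2 * k%:R + 2 :> R by rewrite ltr_wpDl.
  have [q q0 qe] := eps_rat (divr_gt0 e0 k0).
  have qR : 0 < ratr q :> R by rewrite ltr0q.
  have /choice[f fP] : forall y, exists p : seq rat * seq rat, `|y - dd p.1| < ratr q /\ `|T (dd p.1) - dd p.2| < ratr q.
    move=> y; have [s ys'] := rcomb_dense u1 ub y qR.
    by have [t yt] := rcomb_dense u1 ub (T (dd s)) qR; exists (s, t).
  exists k, [seq (f y, q) | y <- ys]; split; last first.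
    by split=> // _ /mapP[y _ ->]; case: (fP y).
  move=> T' [NT' T'k]; apply: yO => y ys'.
  have := NT' (f y, q) (map_f _ ys'); rewrite /opbit /= => h1.
  have [h2 h3] := fP y.
  have h4 := T'k (y - dd (f y).1); have h5 := Tk (y - dd (f y).1).
  rewrite linearB in h4; rewrite linearB in h5.
  have h6 := ler_normB (T' y - dd (f y).2) (T y - dd (f y).2); rewrite opprB subrKA in h6.
  have h7 := ler_normD (T' y - T' (dd (f y).1)) (T' (dd (f y).1) - dd (f y).2); rewrite subrKA in h7.
  have h8 := ler_normD (T y - T (dd (f y).1)) (T (dd (f y).1) - dd (f y).2); rewrite subrKA in h8.
  move: qe; rewrite ltr_pdivlMr// => qe; have kk : 0 <= k%:R :> R by [].
  move: (k%:R : R) kk h4 h5 qe {k0 T'k Tk} => K kk h4 h5 qe; hide_ratr; nra.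
apply: measurable_exists => k; apply: measurable_exists => l; apply: measurable_and; first exact: measurable_const.
apply: measurable_and; last exact: measurable_opball.
apply: measurable_forall => p; apply: measurable_imply; first exact: measurable_const.
by apply: sub_sigma_algebra; exists p.
Qed.

Lemma bop_measurableE : @measurable _ bop = <<s range opbit>>.
Proof.
apply/seteqP; split; apply: smallest_sub; try exact: smallest_sigma_algebra.
  by move=> O; exact: sot_open_bits.
move=> _ [p _ <-]; exact: measurable_sot_ball.
Qed.

Lemma measurable_bop d (O : measurableType d) (T : O -> bop) :
  (forall s t (q : rat), measurable [set w | `|T w (dd s) - dd t| < ratr q]) -> measurable_fun setT T.
Proof.
move=> H; apply: (@measurability _ _ _ _ setT T (range opbit)); first exact: bop_measurableE.
move=> _ [_ [p _ <-] <-]; rewrite setTI; exact: H.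
Qed.

Lemma operator_bitsP T : operator_bits u (fun s t q => opbit (s, t, q) T).
Proof.
have near s (q : rat) : 0 < q -> exists t, opbit (s, t, q) T.
  move=> q0; have [|t Tt] := rcomb_dense u1 ub (T (dd s)) (e := ratr q); first by rewrite ltr0q.
  by exists t.
split=> //.
- move=> s t t' q q'; rewrite /opbit /= => h1 h2.
  have := ler_normB (T (dd s) - dd t') (T (dd s) - dd t); rewrite opprB [X in `|X|]addrC subrKA.
  hide_ratr; lra.
- move=> s t q; split=> [h|[t' [q' []]]]; rewrite /opbit /=; last first.
    have := ler_normD (T (dd s) - dd t') (dd t' - dd t); rewrite subrKA (distrC (dd t')).
    hide_ratr; lra.
  have [|q' q'0 q'q] := @eps_rat R ((ratr q - `|T (dd s) - dd t|) / 2).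
    by rewrite divr_gt0 ?subr_gt0.
  have [t' Tt'] := near s q' q'0; exists t', q'; split=> //; move: Tt'; rewrite /opbit /=.
  have := ler_normB (T (dd s) - dd t') (T (dd s) - dd t); rewrite opprB [X in `|X|]addrC subrKA.
  hide_ratr; lra.
- move=> c s t q q0.
  have k0 : 0 < `|ratr c| + 3 :> R by rewrite ltr_wpDl.
  have qR : 0 < ratr q :> R by rewrite ltr0q.
  have [q' q'0 q'q] := eps_rat (divr_gt0 qR k0).
  have q'q1 : q' <= q.
    rewrite -(ler_rat R) (le_trans (ltW q'q))// ler_pdivrMr// ler_peMr// ?ltW// ltr_wpDl//; lra.
  have le_bit s1 t1 : opbit (s1, t1, q') T -> opbit (s1, t1, q) T.
    by rewrite /opbit /= => h; apply: lt_le_trans h _; rewrite ler_rat.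
  have [s' ss'] := near s q' q'0; have [t' tt'] := near t q' q'0.
  have [r' rr'] := near (rlin c s t) q' q'0; exists s', t', r'.
  split; try exact: le_bit.
  move: q'q; rewrite ltr_pdivlMr// => q'q; move: ss' tt' rr'; rewrite /opbit /= rcomb_lin linearP.
  have -> : dd r' - (ratr c *: dd s' + dd t') = (ratr c *: (T (dd s) - dd s') + (T (dd t) - dd t'))
      - (ratr c *: T (dd s) + T (dd t) - dd r').
    by rewrite scalerBr addrACA -opprD subACA subrr sub0r opprB.
  have h1 := ler_normB (ratr c *: (T (dd s) - dd s') + (T (dd t) - dd t')) (ratr c *: T (dd s) + T (dd t) - dd r').
  have h2 := ler_normD (ratr c *: (T (dd s) - dd s')) (T (dd t) - dd t').
  rewrite normrZ in h2; have c0 := normr_ge0 (ratr c : R); move: h1 h2.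
  move=> h1 h2 ss'; have := ler_wpM2l c0 (ltW ss').
  have := normr_ge0 (T (dd t) - dd t'); hide_ratr; lra.
- have [k Tk] := opball_ex T; exists k => s q q0; have [t Tt] := near s q q0; exists t; split=> //.
  move: Tt; rewrite /opbit /=; have := ler_normB (T (dd s)) (T (dd s) - dd t); rewrite opprB addrC subrK.
  have := Tk (dd s); hide_ratr; lra.
Qed.

Lemma opcode_inj : injective opcode.
Proof.
move=> T T' TT'.
have bE p : opbit p T <-> opbit p T'.
  have := congr1 (fun f => f (pickle p)) TT'; rewrite /= !opcodeE => h.
  by split=> /asboolP; [rewrite h|rewrite -h] => /asboolP.
have TD s : T (dd s) = T' (dd s).
  apply/eqP; rewrite -subr_eq0 -normr_le0; apply/ler_addgt0Pr => e e0; rewrite add0r.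
  have [|q q0 qe] := @eps_rat R (e / 2); first by rewrite divr_gt0.
  have [|t Tt] := rcomb_dense u1 ub (T (dd s)) (e := ratr q); first by rewrite ltr0q.
  have /bE : opbit (s, t, q) T by [].
  rewrite /opbit /= => T't.
  have := ler_normB (T (dd s) - dd t) (T' (dd s) - dd t); rewrite opprB subrKA.
  hide_ratr; lra.
apply: bop_ext => z; apply/eqP; rewrite -subr_eq0 -normr_le0; apply/ler_addgt0Pr => e e0; rewrite add0r.
have [M M0 TM] := bop_bound T; have [M' M'0 TM'] := bop_bound T'.
have c0 : 0 < M + M' by rewrite addr_gt0.
have [s zs] := rcomb_dense u1 ub z (divr_gt0 e0 c0).
have h1 := TM (z - dd s); have h2 := TM' (z - dd s); rewrite !linearB -/(dd s) in h1 h2.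
have := ler_normB (T z - T (dd s)) (T' z - T' (dd s)); rewrite -TD opprB subrKA in h2 *.
move: zs; rewrite ltr_pdivlMr//; nra.
Qed.

Lemma opcode_range : range opcode = [set a : bits |
  (forall n, a n = if @unpickle (seq rat * seq rat * rat)%type n is Some p then a (pickle p) else false) /\
  operator_bits u (fun s t q => a (pickle (s, t, q)))].
Proof.
apply/seteqP; split=> [_ [T _ <-]|a [aE ab]].
  split; first by move=> n; rewrite /opcode; case: unpickle => // p; rewrite pickleK.
  have -> : (fun s t q => is_true (opcode T (pickle (s, t, q)))) = fun s t q => opbit (s, t, q) T.
    by apply/funext => s; apply/funext => t; apply/funext => q; rewrite opcodeE; exact: asboolE.
  exact: operator_bitsP.
have [T TP] := operator_of_bits u1 ub ab; exists T => //; apply/funext => n.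
rewrite aE /opcode; case: unpickle => // -[[s t] q].
by apply/asboolP/idP => /TP.
Qed.

Lemma coded_bop : coded bop.
Proof.
exists opcode; split; first exact: opcode_inj.
  rewrite bop_measurableE sigma_preimageE; apply/seteqP; split; apply: smallest_sub;
    try exact: smallest_sigma_algebra.
    move=> _ [p _ <-]; apply: sub_sigma_algebra; exists [set a : nat -> bool | a (pickle p)].
      by exists (pickle p).
    by apply/seteqP; split=> T; rewrite /= opcodeE; [move=> [_ /asboolP]|move=> ?; split=> //; exact/asboolP].
  move=> _ [_ [n _ <-] <-]; rewrite setTI -[_ _]/(measurable (_ : set bitspace)).
  rewrite (_ : _ @^-1` _ = [set T | opcode T n])//.
  rewrite /opcode; case: unpickle => [p|]; last exact: measurable_const.
  rewrite (_ : [set T | _] = opbit p); first by apply: sub_sigma_algebra; exists p.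
  by apply/seteqP; split=> T /asboolP.
rewrite opcode_range -[_ _]/(measurable (_ : set bits)); apply: measurable_and.
  apply: measurable_forall => n; case: unpickle => [p|].
    rewrite (_ : [set a | _] = [set a : bits | a n <-> a (pickle p)]).
      by apply: measurable_iff; exact: measurable_bit.
    by apply/seteqP; split=> a /= => [->//|/Bool.eq_iff_eq_true].
  rewrite (_ : [set a | _] = [set a : bits | ~ a n]); first by apply: measurable_not; exact: measurable_bit.
  by apply/seteqP; split=> a /=; [move=> ->|move=> /negP/negbTE].
rewrite (_ : [set a | _] = [set a : bits |
  (forall (s : seq rat) (q : rat), 0 < q -> exists t : seq rat, a (pickle (s, t, q))) /\
  (forall (s t t' : seq rat) (q q' : rat), a (pickle (s, t, q)) -> a (pickle (s, t', q')) -> `|dd t - dd t'| < ratr q + ratr q') /\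
  (forall (s t : seq rat) (q : rat), a (pickle (s, t, q)) <-> exists (t' : seq rat) (q' : rat), a (pickle (s, t', q')) /\ `|dd t - dd t'| + ratr q' < ratr q) /\
  (forall (c : rat) (s t : seq rat) (q : rat), 0 < q -> exists s' t' r' : seq rat, a (pickle (s, s', q)) /\ a (pickle (t, t', q)) /\ a (pickle (rlin c s t, r', q))
        /\ `|dd r' - (ratr c *: dd s' + dd t')| < ratr q) /\
   exists M : nat, forall (s : seq rat) (q : rat), 0 < q -> exists t : seq rat, a (pickle (s, t, q)) /\ `|dd t| <= M%:R * `|dd s| + ratr q]).
  do !(apply: measurable_forall => ? || apply: measurable_exists => ? || apply: measurable_and ||
    apply: measurable_iff || apply: measurable_imply || exact: measurable_const || exact: measurable_bit).
apply/seteqP; split=> a /=.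
  move=> [b1 b2 b3 b4 b5]; do 3!split=> //; split=> // c s t q q0.
  by have [s' [t' [r' [? ? ? ?]]]] := b4 c s t q q0; exists s', t', r'.
move=> [b1 [b2 [b3 [b4 b5]]]]; split=> // c s t q q0.
by have [s' [t' [r' [? [? [? ?]]]]]] := b4 c s t q q0; exists s', t', r'.
Qed.

Lemma standard_borel_bop : standard_borel_type R bop.
Proof. exact: coded_standard_borel coded_bop. Qed.

End OperatorSpace.

(** * Closed subspaces and linear relations *)

Section ClosedSubspaces.
Variables (R : realType) (U : completeNormedModType R).

Lemma closed_seq (Y : set U) :
  (forall (s : nat -> U) y, (forall j, Y (s j)) -> s @ \oo --> y -> Y y) -> closed Y.
Proof.
move=> H y Yy.
have /choice[s sP] : forall j, exists z, Y z /\ `|y - z| < recip R j.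
  move=> j; have [|z [Yz yz]] := Yy (ball y (recip R j)); first by apply: nbhsx_ballx; exact: recip_gt0.
  by exists z; split=> //; move: yz; rewrite -ball_normE.
apply: (H s) => [j|]; first by have [] := sP j.
apply/cvg_seqP => e /recip_small[N Ne]; exists N => n /Ne ne.
by have [_ /lt_trans /(_ ne)/ltW] := sP n.
Qed.

Lemma closed_cvg_mem (Y : set U) (s : nat -> U) y :
  closed Y -> (forall j, Y (s j)) -> s @ \oo --> y -> Y y.
Proof.
move=> Yc Ys sy; apply: Yc => V /nbhs_ballP[e /= e0 eV].
have [|N /(_ N (leqnn N)) sN] := (cvg_seqP _ _).1 sy (e / 2); first by rewrite divr_gt0.
exists (s N); split=> //; apply: eV; rewrite -ball_normE /=; apply: le_lt_trans sN _.
by rewrite ltr_pdivrMr// ltr_pMr// ltr1n.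
Qed.

Lemma closed_dist (Y : set U) z : closed Y -> ~ Y z ->
  exists2 d : R, 0 < d & forall y, Y y -> d <= `|z - y|.
Proof.
move=> Yc nYz; apply: contrapT => H; apply: nYz; apply: Yc => V /nbhs_ballP[e /= e0 eV].
apply: contrapT => H2; apply: H; exists e => // y Yy; rewrite leNgt; apply/negP => yz.
by apply: H2; exists y; split=> //; apply: eV; rewrite -ball_normE.
Qed.

Section AddLine.
Variables (Y : set U) (z : U) (d : R).
Hypothesis Y_lin : forall c x y, Y x -> Y y -> Y (c *: x + y).
Hypothesis Y_closed : closed Y.
Hypothesis d_gt0 : 0 < d.
Hypothesis d_le : forall y, Y y -> d <= `|z - y|.

Lemma line_norm_ge y t : Y y -> d * `|t| <= `|y + t *: z|.
Proof.
move=> Yy; have [->|t0] := eqVneq t 0; first by rewrite normr0 mulr0.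
have Y0 : Y 0 by have := Y_lin (-1) Yy Yy; rewrite scaleN1r addNr.
have -> : y + t *: z = t *: (z - ((- t^-1) *: y + 0)).
  by rewrite addr0 scaleNr opprK scalerDr scalerA divff// scale1r addrC.
by rewrite normrZ mulrC ler_pM2l ?normr_gt0//; apply: d_le; exact: Y_lin.
Qed.

(** The distance from [z] to [Y] controls the coefficient of [z]; along a convergent sequence the
    coefficients therefore converge, and so do the components in [Y]. *)
Lemma closed_add_line : closed [set x | exists y t, Y y /\ x = y + t *: z].
Proof.
apply: closed_seq => s x /choice[y /choice[t yt]] sx.
have Y0 : Y 0 by have [Yy _] := yt 0%N; have := Y_lin (-1) Yy Yy; rewrite scaleN1r addNr.
have /cvg_ex[t' /= tt'] : cvgn (t : nat -> R^o).
  apply: cauchy_seq_cvg => e e0.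
  have sc : cvgn s by apply/cvg_ex; exists x.
  have [N Ne] := cvg_seq_cauchy sc (mulr_gt0 d_gt0 e0).
  exists N => m n Nm mn; have := Ne m n Nm (leq_trans Nm mn).
  have [Yn ->] := yt n; have [Ym ->] := yt m.
  rewrite opprD addrACA -scalerBl => h; rewrite -(ler_pM2l d_gt0); apply: le_trans h.
  by apply: line_norm_ge; have := Y_lin (-1) Ym Yn; rewrite scaleN1r addrC.
exists (x - t' *: z), t'; split; last by rewrite subrK.
have yE : y = fun j => s j - t j *: z by apply/funext => j; have [_ ->] := yt j; rewrite addrK.
apply: (closed_cvg_mem Y_closed (s := y)); first by move=> j; have [] := yt j.
by rewrite yE; apply: cvgB => //; apply: cvgZr_tmp.
Qed.

End AddLine.
End ClosedSubspaces.

Lemma left_kernel (R : realType) n (M : 'M[R]_(n.+1, n)) :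
  exists s : 'rV[R]_n.+1, s != 0 /\ s *m M = 0.
Proof.
have : kermx M != 0.
  rewrite kermx_eq0 /row_free neq_ltn; apply/orP; left.
  by rewrite ltnS rank_leq_col.
by move=> /rowV0Pn[s /sub_kermxP sM s0]; exists s.
Qed.

(** * Embeddings of infinite codimension form a Borel set *)

Section MeasurableEmbeddings.
Variables (R : realType) (U : completeNormedModType R) (u : nat -> U).
Hypothesis u1 : normalized u.
Hypothesis ub : schauder_basis_of setT u.
Local Notation dd := (rcomb u).
Local Notation bop := (bounded_op U U).

Implicit Types T : bop.

Definition bounded_below (T : bop) := exists j : nat, forall s : seq rat,
  recip R j * `|dd s| <= `|T (dd s)|.

Definition combo (v : seq (seq rat)) (s : nat -> R) : U :=
  \sum_(l < size v) s l *: dd (nth [::] v l).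

(** Infinite codimension in countable form: arbitrarily many vectors of the dense set are
    independent modulo the range, with a lower bound for each coefficient that survives
    approximation. *)
Definition independent (T : bop) := forall n : nat, exists v : seq (seq rat), size v = n /\
  exists j : nat, forall (a s : seq rat) (i : nat), (i < n)%N ->
    recip R j * `|ratr s`_i| <= `|T (dd a) + combo v (fun l => ratr s`_l)|.

Definition strong_below (T : bop) (c : R) := forall z, c * `|z| <= `|T z|.
Definition strong_independent (T : bop) (v : seq (seq rat)) (c : R) :=
  forall z (s : nat -> R) i, (i < size v)%N -> c * `|s i| <= `|T z + combo v s|.

Lemma bounded_belowP T : bounded_below T <-> exists2 c, 0 < c & strong_below T c.
Proof.
split=> [[j Tj]|[c c0 Tc]]; last first.
  have [j /(_ j (leqnn j)) jc] := recip_small c0; exists j => s.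
  by apply: le_trans (Tc _); rewrite ler_wpM2r// ltW.
exists (recip R j); first exact: recip_gt0.
move=> z; apply/ler_addgt0Pr => e e0; have [M M0 TM] := bop_bound T.
have c0 : 0 < M + recip R j by rewrite addr_gt0// recip_gt0.
have [s zs] := rcomb_dense u1 ub z (divr_gt0 e0 c0).
have h1 := TM (z - dd s); rewrite linearB in h1.
have h2 := ler_normB (T z) (T z - T (dd s)); rewrite opprB addrC subrK in h2.
have h3 := ler_normD (dd s) (z - dd s); rewrite addrC subrK in h3.
have := Tj s; have := recip_gt0 R j; move: zs; rewrite ltr_pdivlMr//; nra.
Qed.

Lemma combo_near v s (e : R) : 0 < e -> exists q : seq rat,
  (forall i, (i < size v)%N -> `|s i - ratr q`_i| < e) /\ `|combo v s - combo v (fun l => ratr q`_l)| < e.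
Proof.
move=> e0; pose K := \sum_(l < size v) `|dd (nth [::] v l)|.
have K0 : 0 <= K by apply: sumr_ge0.
have K1 : 0 < K + 1 by rewrite ltr_wpDl.
pose d := Num.min e (e / (K + 1)); have d0 : 0 < d by rewrite lt_min e0 divr_gt0.
have /choice[q qP] : forall i, exists q : rat, `|s i - ratr q| < d by move=> i; exact: rat_near.
exists (mkseq q (size v)); split=> [i iv|].
  by rewrite nth_mkseq//; apply: lt_le_trans (qP i) _; rewrite /d ge_min lexx.
rewrite /combo -sumrB.
have : \sum_(l < size v) `|dd (nth [::] v l)| * d < e.
  rewrite -mulr_suml -/K; apply: le_lt_trans (_ : K * (e / (K + 1)) < e).
    by rewrite ler_wpM2l// /d ge_min lexx orbT.
  by rewrite mulrCA gtr_pMr// ltr_pdivrMr// mul1r ltrDl.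
apply: le_lt_trans; apply: le_trans (ler_norm_sum _ _ _) _; apply: ler_sum => l _.
by rewrite nth_mkseq// -scalerBl normrZ mulrC ler_wpM2l// ltW.
Qed.

Lemma independentP T v (j : nat) :
  (forall (a s : seq rat) (i : nat), (i < size v)%N ->
    recip R j * `|ratr s`_i| <= `|T (dd a) + combo v (fun l => ratr s`_l)|) ->
  strong_independent T v (recip R j).
Proof.
move=> Tj z s i iv; apply/ler_addgt0Pr => e e0; have [M M0 TM] := bop_bound T.
have r0 := recip_gt0 R j; have c0 : 0 < M + recip R j + 1 by rewrite !addr_gt0.
have d0 := divr_gt0 e0 c0.
have [a za] := rcomb_dense u1 ub z d0; have [q [qi qc]] := combo_near v s d0.
have := Tj a q i iv; have {qi} := qi i iv.
have h1 := TM (z - dd a); rewrite linearB in h1.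
have -> : T (dd a) + combo v (fun l => ratr q`_l) = (T z + combo v s) -
    ((T z - T (dd a)) + (combo v s - combo v (fun l => ratr q`_l))).
  by rewrite opprD !opprB addrACA [T z + _]addrC [combo v s + _]addrC !subrK.
move=> h2.
have h3 := ler_normB (T z + combo v s) ((T z - T (dd a)) + (combo v s - combo v (fun l => ratr q`_l))).
have h4 := ler_normD (T z - T (dd a)) (combo v s - combo v (fun l => ratr q`_l)).
have h5 := ler_normD (s i - ratr q`_i) (ratr q`_i); rewrite subrK in h5.
move=> /le_trans/(_ h3) h6.
have -> : e = e / (M + recip R j + 1) * (M + recip R j + 1) by rewrite divfK// gt_eqF.
move: (e / _) d0 za qc h2 => d d0 za qc h2; hide_ratr; nra.
Qed.

Lemma below_injective T c : 0 < c -> strong_below T c -> injective T.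
Proof.
move=> c0 Tc x y xy; apply/eqP; rewrite -subr_eq0 -normr_le0 -(ler_pM2l c0) mulr0.
by apply: le_trans (Tc _) _; rewrite linearB xy subrr normr0.
Qed.

Lemma below_closed T c : 0 < c -> strong_below T c -> closed (range T).
Proof.
move=> c0 Tc; apply: closed_seq => s y sT sy.
have /choice[x xs] : forall j, exists x, T x = s j by move=> j; have [x _ <-] := sT j; exists x.
have [M M0 TM] := bop_bound T.
have sc : cvgn s by apply/cvg_ex; exists y.
have /cvg_ex[z /= xz] : cvgn x.
  apply: cauchy_seq_cvg => e e0; have [N Ne] := cvg_seq_cauchy sc (mulr_gt0 c0 e0).
  exists N => m n Nm mn; rewrite -(ler_pM2l c0); apply: le_trans (Tc _) _.
  rewrite linearB !xs.
  by apply: Ne => //; exact: leq_trans mn.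
exists z => //; apply: (cvg_seq_unique _ sy); apply/cvg_seqP => e e0.
have [N Ne] := (cvg_seqP _ _).1 xz _ (divr_gt0 e0 M0); exists N => n /Ne.
rewrite /= -(xs n) -linearB ler_pdivlMr// mulrC; exact: le_trans (TM _).
Qed.

Lemma below_isomorphism T c : 0 < c -> strong_below T c -> isomorphism_onto_range T.
Proof.
move=> c0 Tc; have Ti := below_injective c0 Tc.
have /choice[S SP] : forall y, exists x, range T y -> T x = y.
  by move=> y; have [[x _ xy]|ny] := pselect (range T y); [exists x|exists 0 => /ny].
have TS x : S (T x) = x by apply: Ti; apply: SP; exists x.
exists S; split=> //; apply/subspace_continuousP => _ [x _ <-].
rewrite /from_subspace TS => V /nbhs_ballP[e /= e0 eV].
apply/nbhs_ballP; exists (c * e); first by rewrite /= mulr_gt0.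
move=> y' /= xy [y _ yE]; move: xy; rewrite -yE -!ball_normE /= -linearB => xy.
apply: eV; rewrite TS -ball_normE /= -(ltr_pM2l c0); exact: le_lt_trans (Tc _) xy.
Qed.

Lemma isomorphism_below T : isomorphism_onto_range T -> exists2 c, 0 < c & strong_below T c.
Proof.
move=> [S [TS /subspace_continuousP Sc]].
have /Sc : range T (T 0) by exists 0.
rewrite /from_subspace TS => /(_ _ (nbhsx_ballx 0 1 ltr01)) /nbhs_ballP[d /= d0 dS].
exists d => // z; have [->|z0] := eqVneq z 0; first by rewrite normr0 mulr0.
have nz : 0 < `|z| by rewrite normr_gt0.
rewrite leNgt; apply/negP => Tz.
pose w := `|z|^-1 *: z.
have nv : `|(`|z|^-1)| = `|z|^-1 by rewrite normrV ?unitfE ?gt_eqF// normr_id.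
have B : ball (T 0) d (T w).
  by rewrite -ball_normE /= linear0 sub0r normrN linearZ normrZ nv mulrC ltr_pdivrMr.
have rT : range T (T w) by exists w.
have := dS _ B rT; rewrite /= TS -ball_normE /= sub0r normrN normrZ nv.
by rewrite mulVf ?gt_eqF// ltxx.
Qed.

(** If [n] vectors spanned modulo the range, [left_kernel] would give a nontrivial combination of
    [n + 1] independent vectors inside the range. *)
Lemma independent_codim T : (forall n, exists v c, [/\ size v = n, 0 < c & strong_independent T v c]) ->
  infinite_codim (range T).
Proof.
move=> H [n [w wP]]; have [v [c [vn c0 vc]]] := H n.+1.
have /choice[f fP] : forall j : 'I_n.+1, exists xa : U * ('I_n -> R),
    dd (nth [::] v j) = T xa.1 + \sum_(i < n) xa.2 i *: w i.
  by move=> j; have [_ [x _ <-] [_ [a ->] E]] := wP (dd (nth [::] v j)); exists (x, a).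
have [s [s0 sM]] := left_kernel (\matrix_(j < n.+1, i < n) (f j).2 i).
pose s' (l : nat) := if insub l is Some j then s 0 (j : 'I_n.+1) else 0.
have cE : combo v s' = T (\sum_(j < n.+1) s 0 j *: (f j).1).
  rewrite /combo vn linear_sum.
  have -> : \sum_(l < n.+1) s' l *: dd (nth [::] v l) =
      \sum_(l < n.+1) s 0 l *: T (f l).1 + \sum_(l < n.+1) \sum_(i < n) (s 0 l * (f l).2 i) *: w i.
    rewrite -big_split; apply: eq_bigr => l _; rewrite /= fP scalerDr scaler_sumr /s' valK.
    by congr (_ + _); apply: eq_bigr => i _; rewrite scalerA.
  rewrite exchange_big /= [X in _ + X]big1 ?addr0; last first.
    move=> i _; rewrite -scaler_suml.
    have := congr1 (fun A : 'rV[R]_n => A 0 i) sM; rewrite !mxE.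
    under eq_bigr do rewrite mxE.
    by move=> ->; rewrite scale0r.
  by apply: eq_bigr => j _; rewrite linearZ.
move/eqP: s0; apply; apply/rowP => j; rewrite mxE.
have := vc (- \sum_(j < n.+1) s 0 j *: (f j).1) s' j; rewrite vn => /(_ (ltn_ord j)).
by rewrite cE linearN addNr normr0 pmulr_rle0// normr_le0 /s' valK => /eqP.
Qed.

(** Vectors are added one at a time. The range plus finitely many vectors stays closed and proper,
    so some [z] has distance at least [e] from it, and a rational vector within [e / 2] of [z] keeps
    distance [e / 2]. *)
Lemma codim_independent T c : 0 < c -> strong_below T c -> infinite_codim (range T) ->
  forall n, exists v c, [/\ size v = n, 0 < c & strong_independent T v c].
Proof.
move=> c0 Tc Tcodim.
pose Y v : set U := [set x | exists y s, x = T y + combo v s].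
have Ylin v a x y : Y v x -> Y v y -> Y v (a *: x + y).
  move=> [x1 [s1 ->]] [y1 [t1 ->]]; exists (a *: x1 + y1), (fun l => a * s1 l + t1 l).
  rewrite linearP scalerDr addrACA; congr (_ + _).
  by rewrite /combo scaler_sumr -big_split; apply: eq_bigr => l _; rewrite /= scalerDl scalerA.
suff H n : exists v c, [/\ size v = n, 0 < c, strong_independent T v c & closed (Y v)].
  by move=> n; have [v [d [? ? ? _]]] := H n; exists v, d.
elim: n => [|n [v [d [vn d0 vd Yc]]]].
  exists [::], 1; split=> //; rewrite (_ : Y [::] = range T); first exact: below_closed Tc.
  apply/seteqP; split=> [_ [y [s ->]]|_ [y _ <-]]; last exists y, (fun=> 0);
    by rewrite /combo big_ord0 addr0//; exists y.
have [z nYz] : exists z, ~ Y v z.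
  apply/existsNP => H; apply: Tcodim; exists n, (fun i => dd (nth [::] v i)) => z.
  have [y [s ->]] := H z; exists (T y); first by exists y.
  exists (combo v s) => //; rewrite /combo vn; by exists (fun i => s i).
have [e e0 eY] := closed_dist Yc nYz.
have [t zt] := rcomb_dense u1 ub z (divr_gt0 e0 (ltr0n _ 2 : 0 < 2 :> R)).
have e20 : 0 < e / 2 by rewrite divr_gt0.
have e2Y y : Y v y -> e / 2 <= `|dd t - y|.
  move=> /eY; have := ler_normD (z - dd t) (dd t - y); rewrite subrKA; lra.
have combo_rcons s : combo (rcons v t) s = combo v s + s n *: dd t.
  rewrite /combo size_rcons big_ord_recr /= nth_rcons ltnn eqxx vn; congr (_ + _).
  by apply: eq_bigr => l _; rewrite nth_rcons vn ltn_ord.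
(* The new coefficient is at most the norm divided by [e / 2]; subtracting its term worsens the old
   bound by the factor $1 + \|d_t\|/(e/2)$. *)
exists (rcons v t), (Num.min (e / 2) (d / (1 + `|dd t| / (e / 2)))).
have k0 : 0 < 1 + `|dd t| / (e / 2) by rewrite ltr_wpDr// divr_ge0// ltW.
split; [by rewrite size_rcons vn|by rewrite lt_min e20 divr_gt0| |].
- move=> y s i; rewrite size_rcons vn combo_rcons addrA ltnS leq_eqVlt => i_n.
  have h : e / 2 * `|s n| <= `|T y + combo v s + s n *: dd t|.
    by apply: (line_norm_ge (@Ylin v) e2Y); exists y, s.
  move: i_n => /orP[/eqP->|i_n].
    by apply: le_trans h; rewrite ler_wpM2r// ge_min lexx.
  apply: (@le_trans _ _ (d / (1 + `|dd t| / (e / 2)) * `|s i|)).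
    by rewrite ler_wpM2r// ge_min lexx orbT.
  rewrite mulrAC ler_pdivrMr//.
  have := vd y s i; rewrite vn => /(_ i_n) /le_trans; apply.
  have := ler_normB (T y + combo v s + s n *: dd t) (s n *: dd t); rewrite addrK normrZ => /le_trans; apply.
  rewrite mulrDr mulr1 lerD2l mulrCA mulrC ler_wpM2l// ler_pdivlMr// mulrC; exact: h.
- rewrite (_ : Y _ = [set x | exists y t', Y v y /\ x = y + t' *: dd t]).
    exact: closed_add_line (@Ylin v) Yc e20 e2Y.
  apply/seteqP; split=> [_ [y [s ->]]|_ [_ [t' [[y [s ->]] ->]]]].
    by exists (T y + combo v s), (s n); rewrite combo_rcons addrA; split=> //; exists y, s.
  exists y, (fun l => if l == n then t' else s l); rewrite combo_rcons eqxx addrA.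
  congr (_ + _ + _); rewrite /combo; apply: eq_bigr => l _.
  by rewrite ltn_eqF// -vn.
Qed.

Lemma EmbE : @Emb R U U = [set T | bounded_below T /\ independent T].
Proof.
apply/seteqP; split=> T.
  move=> [/isomorphism_below[c c0 Tc] _ Tcod]; split; first by apply/bounded_belowP; exists c.
  move=> n; have [v [d [vn d0 vd]]] := codim_independent c0 Tc Tcod n; exists v; split=> //.
  have [j /(_ j (leqnn j)) jd] := recip_small d0; exists j => a s i i_n.
  apply: le_trans (vd (dd a) (fun l => ratr s`_l) i _); last by rewrite vn.
  by rewrite ler_wpM2r// ltW.
move=> [/bounded_belowP[c c0 Tc] Ti]; split; [exact: below_isomorphism Tc|exact: below_closed Tc|].
apply: independent_codim => n; have [v [vn [j vj]]] := Ti n; exists v, (recip R j).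
by split=> //; [exact: recip_gt0|apply: independentP; rewrite vn].
Qed.

Lemma measurable_norm_ge d (Om : measurableType d) (T : Om -> bop) z z0 (r : R) :
  measurable_fun setT T -> measurable [set w | r <= `|T w z + z0|].
Proof.
move=> mT; rewrite (_ : [set w | _] = [set w | ~ (`|T w z - (- z0)| < r)]).
  apply: measurable_not; rewrite -[X in measurable X]setTI.
  apply: (mT measurableT [set S | `|S z - (- z0)| < r]); exact: measurable_sot_ball.
by apply/seteqP; split=> w /=; rewrite opprK leNgt => /negP.
Qed.

Lemma measurable_Emb : measurable (@Emb R U U).
Proof.
rewrite EmbE; apply: measurable_and.
  apply: measurable_exists => j; apply: measurable_forall => s.
  have := @measurable_norm_ge _ bop id (dd s) 0 (recip R j * `|dd s|) (@measurable_id _ _ _).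
  by under [X in measurable X]eq_set do rewrite addr0.
apply: measurable_forall => n; apply: measurable_exists => v; apply: measurable_and.
  exact: measurable_const.
apply: measurable_exists => j; do 2!apply: measurable_forall => ?.
apply: measurable_forall => i; apply: measurable_imply; first exact: measurable_const.
exact: (@measurable_norm_ge _ bop id _ _ _ (@measurable_id _ _ _)).
Qed.

End MeasurableEmbeddings.

(** * Analyticity of the relations of position *)

Section AnalyticPositions.
Variables (R : realType) (U : completeNormedModType R) (u : nat -> U).
Hypothesis u1 : normalized u.
Hypothesis ub : schauder_basis_of setT u.
Local Notation dd := (rcomb u).
Local Notation bop := (bounded_op U U).

Section MeasurableFamilies.
Context d (Om : measurableType d).
Implicit Types A B : Om -> bop.

Lemma measurable_op_preimage A (S : set bop) :
  measurable_fun setT A -> measurable S -> measurable [set w | S (A w)].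
Proof. by move=> mA mS; rewrite -[X in measurable X]setTI; exact: mA. Qed.

Lemma measurable_op_near A z z0 (r : R) :
  measurable_fun setT A -> measurable [set w | `|A w z - z0| < r].
Proof. by move=> mA; apply: (measurable_op_preimage (S := [set T : bop | `|T z - z0| < r]) mA); exact: measurable_sot_ball. Qed.

Lemma measurable_opballB k : measurable (opball k : set bop).
Proof. by rewrite (bop_measurableE u1 ub); exact: (measurable_opball u1 ub). Qed.

(** Composition is jointly strongly continuous only when the left factor stays in a norm ball. The
    middle vector is thus replaced by a rational one, at a cost controlled by the ball containing
    [A w]. *)
Lemma measurable_bop_comp A B : measurable_fun setT A -> measurable_fun setT B ->
  measurable_fun setT (fun w => bop_comp (A w) (B w)).
Proof.
move=> mA mB; apply: (measurable_bop u1 ub) => s t q.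
rewrite (_ : [set w | _] = [set w | exists k : nat, opball k (A w) /\ exists (j : nat) (m : seq rat),
    `|B w (dd s) - dd m| < recip R j /\ `|A w (dd m) - dd t| < ratr q - k%:R * recip R j]).
  apply: measurable_exists => k; apply: measurable_and.
    by apply: (measurable_op_preimage (S := opball k)) => //; exact: measurable_opballB.
  by do 2!apply: measurable_exists => ?; apply: measurable_and; exact: measurable_op_near.
apply/seteqP; split=> [w /= h|w /= [k [Ak [j [m [h1 h2]]]]]].
  have [k Ak] := opball_ex (A w); exists k; split=> //.
  have k0 : 0 < 2 * k%:R + 1 :> R by rewrite ltr_wpDl// mulr_ge0.
  have h0 : 0 < ratr q - `|A w (B w (dd s)) - dd t| by rewrite subr_gt0.
  have [j /(_ j (leqnn j)) je] := recip_small (divr_gt0 h0 k0).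
  have [m Bm] := rcomb_dense u1 ub (B w (dd s)) (recip_gt0 R j).
  exists j, m; split=> //; move: je; rewrite ltr_pdivlMr// => je.
  have h1 := Ak (B w (dd s) - dd m); rewrite linearB in h1.
  have h2 := ler_normB (A w (B w (dd s)) - dd t) (A w (B w (dd s)) - A w (dd m)).
  rewrite subACA subrr sub0r opprB in h2.
  have r0 := recip_gt0 R j; have kk : 0 <= k%:R :> R by [].
  move: (k%:R : R) kk k0 je h1 {Ak} => K kk k0 je h1.
  hide_ratr; nra.
have h3 := Ak (B w (dd s) - dd m); rewrite linearB in h3.
have h4 := ler_normD (A w (B w (dd s)) - A w (dd m)) (A w (dd m) - dd t); rewrite subrKA in h4.
have r0 := recip_gt0 R j; have kk : 0 <= k%:R :> R by [].
move: (k%:R : R) kk h2 h3 {Ak} => K kk h2 h3; hide_ratr; nra.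
Qed.

Lemma measurable_bop_eq A B : measurable_fun setT A -> measurable_fun setT B ->
  measurable [set w | A w = B w].
Proof.
move=> mA mB; rewrite (_ : [set w | _] =
    [set w | forall p, opbit u p (A w) <-> opbit u p (B w)]).
  by apply: measurable_forall => p; apply: measurable_iff; exact: measurable_op_near.
apply/seteqP; split=> [w /= -> //|w /= AB]; apply: (opcode_inj u1 ub).
apply/funext => n; rewrite /opcode; case: unpickle => // p.
by apply/asboolP/asboolP => /AB.
Qed.

End MeasurableFamilies.

Lemma linear_injective_infinite_dim (T : bop) : injective T -> infinite_dim (range T).
Proof.
move=> Ti [n [v vP]].
have /choice[f fP] : forall j : 'I_n.+1, exists a : 'I_n -> R, T (u j) = \sum_(i < n) a i *: v i.
  by move=> j; have [a] := vP (T (u j)) (ex_intro2 _ _ _ I erefl); exists a.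
have [s [s0 sM]] := left_kernel (\matrix_(j < n.+1, i < n) f j i).
pose s' (l : nat) := if insub l is Some j then s 0 (j : 'I_n.+1) else 0.
have Ts : \sum_(l < n.+1) s 0 l *: u l = 0.
  apply: Ti; rewrite linear0 linear_sum.
  transitivity (\sum_(l < n.+1) s 0 l *: T (u l)); first by apply: eq_bigr => l _; rewrite linearZ.
  under eq_bigr => l _ do rewrite fP scaler_sumr.
  rewrite exchange_big /= big1// => i _.
  under eq_bigr do rewrite scalerA.
  rewrite -scaler_suml; have := congr1 (fun A : 'rV[R]_n => A 0 i) sM; rewrite !mxE.
  by under eq_bigr do rewrite mxE; move=> ->; rewrite scale0r.
have c0 : coef ub 0 = s'.
  apply: coef_unique; apply/cvg_seqP => e e0; exists n.+1 => m nm.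
  rewrite /series /= big_mkord sub0r normrN (_ : \sum_(i < m) _ = 0) ?normr0 ?ltW// -[RHS]Ts.
  transitivity (\sum_(l < n.+1) s' l *: u l); last by apply: eq_bigr => l _; rewrite /s' valK.
  rewrite (big_ord_widen _ (fun l => s' l *: u l) nm) [RHS]big_mkcond; apply: eq_bigr => i _.
  rewrite /lincomb; case: ltnP => // ni; rewrite /s' insubF ?scale0r//.
  by apply/negbTE; rewrite -leqNgt.
move/eqP: s0; apply; apply/rowP => j; rewrite mxE.
by have := congr1 (fun a : nat -> R => a j) c0; rewrite coef0 /s' valK.
Qed.

Lemma Emb_injective (T : bop) : @Emb R U U T -> injective T.
Proof. by move=> [/isomorphism_below[c c0 Tc] _ _]; exact: below_injective Tc. Qed.

(** Equality of ranges splits into $PT = T$ and approximation of the range of [P] by the closed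
    range of [T]; injectivity of [T] supplies infinite dimension. Every condition is now Borel. *)
Lemma Emb_cE : @Emb_c R U U = [set TP | [/\ Emb TP.1, bop_comp TP.2 TP.2 = TP.2,
  bop_comp TP.2 TP.1 = TP.1
  & forall (m : seq rat) (j : nat), exists a, `|TP.1 (dd a) - TP.2 (dd m)| < recip R j]].
Proof.
apply/seteqP; split=> -[T P] /= [ET].
  move=> [PP _] TP; split=> //.
  - by apply: bop_ext => z; rewrite bop_compE.
  - apply: bop_ext => z; rewrite bop_compE.
    have [x _ <-] : range P (T z) by rewrite -TP; exists z.
    by rewrite PP.
  - move=> m j; have [x _ <-] : range T (P (dd m)) by rewrite TP; exists (dd m).
    have [M M0 TM] := bop_bound T.
    have [a xa] := rcomb_dense u1 ub x (divr_gt0 (recip_gt0 R j) M0); exists a.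
    rewrite -linearB; apply: le_lt_trans (TM _) _.
    by rewrite mulrC -ltr_pdivlMr// distrC.
move=> PP PT TP.
have rE : range T = range P.
  apply/seteqP; split=> [_ [x _ <-]|_ [z _ <-]].
    by exists (T x) => //; rewrite -[in RHS]PT bop_compE.
  have [_ Tc _] := ET; have [M M0 PM] := bop_bound P.
  apply: Tc => V /nbhs_ballP[e /= e0 eV].
  have [|m zm] := rcomb_dense u1 ub z (e := e / 2 / M); first by rewrite !divr_gt0.
  have [|j /(_ j (leqnn j)) je] := @recip_small R (e / 2); first by rewrite divr_gt0.
  have [a am] := TP m j; exists (T (dd a)); split; first by exists (dd a).
  apply: eV; rewrite -ball_normE /=.
  have h1 := PM (z - dd m); rewrite linearB in h1.
  have h2 := ler_normD (P z - P (dd m)) (P (dd m) - T (dd a)); rewrite subrKA in h2.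
  move: zm; rewrite ltr_pdivlMr// => zm; rewrite distrC in am; nra.
split=> //; split; last by rewrite -rE; apply: linear_injective_infinite_dim; exact: Emb_injective.
by move=> z; rewrite -[in RHS]PP bop_compE.
Qed.

Lemma measurable_op_dist d (Om : measurableType d) (A B : Om -> bop) z z' (r : R) :
  measurable_fun setT A -> measurable_fun setT B ->
  measurable [set w | `|A w z - B w z'| < r].
Proof.
move=> mA mB; rewrite (_ : [set w | _] = [set w | exists (t : seq rat) (q : rat),
    `|A w z - dd t| < ratr q /\ `|B w z' - dd t| < r - ratr q]).
  by do 2!apply: measurable_exists => ?; apply: measurable_and; exact: measurable_op_near.
apply/seteqP; split=> [w /= h|w /= [t [q [h1 h2]]]]; last first.
  have := ler_normB (A w z - dd t) (B w z' - dd t); rewrite opprB subrKA; hide_ratr; lra.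
pose e := (r - `|A w z - B w z'|) / 2; have e0 : 0 < e by rewrite divr_gt0// subr_gt0.
have [q q0 qe] := eps_rat e0.
have [|t At] := rcomb_dense u1 ub (A w z) (e := ratr q); first by rewrite ltr0q.
exists t, q; split=> //.
have := ler_normB (A w z - dd t) (A w z - B w z'); rewrite subACA subrr sub0r opprB.
by move: qe; rewrite /e; hide_ratr; lra.
Qed.

Lemma measurable_Emb_c : measurable (@Emb_c R U U).
Proof.
rewrite Emb_cE (_ : [set TP | _] = [set TP : bop * bop | Emb TP.1 /\ bop_comp TP.2 TP.2 = TP.2 /\
  bop_comp TP.2 TP.1 = TP.1 /\ forall (m : seq rat) (j : nat), exists a,
    `|TP.1 (dd a) - TP.2 (dd m)| < recip R j]); last first.
  by apply/seteqP; split=> -[T P] /= => [[]|[? [? []]]].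
have m1 := @measurable_fst _ _ bop bop; have m2 := @measurable_snd _ _ bop bop.
apply: measurable_and.
  exact: (measurable_op_preimage (S := @Emb R U U) m1 (measurable_Emb u1 ub)).
apply: measurable_and; first by apply: measurable_bop_eq => //; exact: measurable_bop_comp.
apply: measurable_and; first by apply: measurable_bop_eq => //; exact: measurable_bop_comp.
apply: measurable_forall => m; apply: measurable_forall => j; apply: measurable_exists => a.
exact: measurable_op_dist.
Qed.

(** Quantifying an automorphism together with its inverse turns the condition into equations between
    compositions, which are Borel. *)
Lemma position_equivP (T T' : bop) : position_equiv T T' <->
  exists AB : bop * bop, [/\ bop_comp AB.1 AB.2 = bop_id U, bop_comp AB.2 AB.1 = bop_id U
    & T = bop_comp AB.1 T'].
Proof.
split=> [[A [B [AB BA]] TA]|[[A B] [/= AB BA TA]]].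
  by exists (A, B); split; apply: bop_ext => z; rewrite bop_compE /= ?AB ?BA ?TA.
exists A; last by move=> y; rewrite TA.
have comp1 C D : bop_comp C D = bop_id U -> cancel D C.
  by move=> CD z; rewrite -[LHS]/(bop_comp C D z) CD.
by exists B; split; exact: comp1.
Qed.

Lemma position_equiv_refl (T : bop) : position_equiv T T.
Proof. by exists (bop_id U) => //; exists (bop_id U). Qed.

Lemma position_equiv_sym (T T' : bop) : position_equiv T T' -> position_equiv T' T.
Proof. by move=> [A [B [AB BA]] TA]; exists B; [exists A|move=> y; rewrite TA AB]. Qed.

Lemma position_equiv_trans (T T' T'' : bop) :
  position_equiv T T' -> position_equiv T' T'' -> position_equiv T T''.
Proof.
move=> /position_equivP[[A B] [/= AB BA ->]] /position_equivP[[A' B'] [/= AB' BA' ->]].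
exists (bop_comp A A') => //; exists (bop_comp B' B).
have comp1 C D : bop_comp C D = bop_id U -> cancel D C.
  by move=> CD z; rewrite -[LHS]/(bop_comp C D z) CD.
by split=> z; rewrite !bop_compE; [rewrite (comp1 _ _ BA) (comp1 _ _ BA')|rewrite (comp1 _ _ AB') (comp1 _ _ AB)].
Qed.

(** The map [p] lets one argument serve embeddings and pairs with a projection: it is the identity
    or the first component. *)
Lemma analytic_pullback d (E : measurableType d) (D : set E) (p : E -> bop) :
  measurable_fun setT p -> standard_borel R D ->
  analytic_equivalence R D (fun x y => position_equiv (p x) (p y)).
Proof.
move=> mp sD; have [_ mD] := sD; split.
  split=> //; split=> [x _|x y _ _|x y z _ _ _].
  - exact: position_equiv_refl.
  - exact: position_equiv_sym.
  - exact: position_equiv_trans.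
exists _, (bop * bop)%type; split.
  by apply: coded_standard_borel; case: (coded_bop u1 ub) => f cf; exists (fun x : bop * bop => interleave (f x.1) (f x.2)); exact: borel_code_prod.
exists [set w : (E * E) * (bop * bop) | D w.1.1 /\ D w.1.2 /\
  bop_comp w.2.1 w.2.2 = bop_id U /\ bop_comp w.2.2 w.2.1 = bop_id U /\
  p w.1.1 = bop_comp w.2.1 (p w.1.2)].
  have m1 : measurable_fun setT (fun w : (E * E) * (bop * bop) => w.1.1).
    exact: (measurableT_comp (@measurable_fst _ _ E E) (@measurable_fst _ _ _ _)).
  have m2 : measurable_fun setT (fun w : (E * E) * (bop * bop) => w.1.2).
    exact: (measurableT_comp (@measurable_snd _ _ E E) (@measurable_fst _ _ _ _)).
  have m3 : measurable_fun setT (fun w : (E * E) * (bop * bop) => w.2.1).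
    exact: (measurableT_comp (@measurable_fst _ _ bop bop) (@measurable_snd _ _ _ _)).
  have m4 : measurable_fun setT (fun w : (E * E) * (bop * bop) => w.2.2).
    exact: (measurableT_comp (@measurable_snd _ _ bop bop) (@measurable_snd _ _ _ _)).
  have mid : measurable_fun setT (fun w : (E * E) * (bop * bop) => bop_id U) by exact: measurable_cst.
  apply: measurable_and; first by rewrite -[X in measurable X]setTI; exact: m1.
  apply: measurable_and; first by rewrite -[X in measurable X]setTI; exact: m2.
  apply: measurable_and; first by apply: measurable_bop_eq => //; exact: measurable_bop_comp.
  apply: measurable_and; first by apply: measurable_bop_eq => //; exact: measurable_bop_comp.
  apply: measurable_bop_eq; first exact: measurableT_comp.
  by apply: measurable_bop_comp => //; exact: measurableT_comp.
apply/seteqP; split=> -[x y] /=.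
  by move=> [Dx Dy /position_equivP[[A B] [/= AB BA xy]]]; exists (x, y, (A, B)).
move=> [[[x' y'] [A B]] /= [Dx [Dy [AB [BA xy]]]] [<- <-]]; split=> //.
by apply/position_equivP; exists (A, B).
Qed.

Lemma analytic_Emb : analytic_equivalence R (@Emb R U U) (@position_equiv R U U).
Proof.
apply: (analytic_pullback (p := id)) => //.
by split; [exact: standard_borel_bop u1 ub|exact: measurable_Emb u1 ub].
Qed.

Lemma analytic_Emb_c : analytic_equivalence R (@Emb_c R U U) (@position_equiv_c R U U).
Proof.
apply: (analytic_pullback (p := fst)) => //; split; last exact: measurable_Emb_c.
by apply: coded_standard_borel; case: (coded_bop u1 ub) => f cf; exists (fun x : bop * bop => interleave (f x.1) (f x.2)); exact: borel_code_prod.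
Qed.

End AnalyticPositions.

(** * Cantor-Bernstein with pieces, and translations of nodes *)

(** The set [D] collects the orbits under $g \circ f$ of the points of [S] outside the image of [g];
    the bijection is [f] on [D] and the inverse of [g] on the rest of [S]. Recording which piece
    acts is what later bounds the norm of the automorphism. *)
Lemma cantor_bernstein_pieces (T : Type) (S S' : T -> Prop) (f g : T -> T) :
  (forall t, S t -> S' (f t)) -> (forall t, S' t -> S (g t)) ->
  injective f -> injective g ->
  exists s s' : T -> T,
    (forall t, S t -> [/\ S' (s t), s' (s t) = t & s t = f t \/ g (s t) = t]) /\
    (forall t, S' t -> [/\ S (s' t), s (s' t) = t & s' t = g t \/ f (s' t) = t]).
Proof.
move=> fS gS finj ginj.
pose D t := exists n t0, [/\ S t0, ~ (exists2 w, S' w & g w = t0) & t = iter n (g \o f) t0].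
have D_S t : D t -> S t.
  by move=> [n [t0 [St0 _ ->]]]; elim: n => //= n IH; apply/gS/fS.
have /choice[s sP] : forall t, exists w, (D t -> w = f t) /\ (S t -> ~ D t -> S' w /\ g w = t).
  move=> t; have [Dt|nDt] := pselect (D t); first by exists (f t).
  have [[w S'w gw]|nw] := pselect (exists2 w, S' w & g w = t); first by exists w.
  by exists t; split=> // St; case: nDt; exists 0%N, t.
have /choice[s' s'P] : forall w, exists t, (forall t1, D t1 -> f t1 = w -> t = t1) /\
    ((forall t1, D t1 -> f t1 <> w) -> t = g w).
  move=> w; have [[t Dt ft]|nt] := pselect (exists2 t, D t & f t = w).
    exists t; split=> [t1 _ ft1|/(_ t Dt)//]; apply: finj; by rewrite ft.
  by exists (g w); split=> // t1 Dt1 ft1; case: nt; exists t1.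
have Dg w t1 : D t1 -> g (f t1) = g w -> f t1 = w by move=> _ /ginj.
have gD t1 : D t1 -> D (g (f t1)).
  by move=> [n [t0 [St0 nt0 ->]]]; exists n.+1, t0.
exists s, s'; split=> [t St|w S'w].
  have [Dt|nDt] := pselect (D t).
    have [sf _] := sP t; rewrite (sf Dt); split; [exact: fS| |by left].
    by have [h _] := s'P (f t); exact: h.
  have [_ /(_ St nDt)[S'w gw]] := sP t; split=> //; last by right.
  have [_ h] := s'P (s t); rewrite h// => t1 Dt1 ft1; apply: nDt.
  by rewrite -gw -ft1; exact: gD.
have [[t Dt ft]|nt] := pselect (exists2 t, D t & f t = w).
  have [h _] := s'P w; rewrite (h t Dt ft); split; [exact: D_S| |by right].
  by have [sf _] := sP t; rewrite sf.
have [_ h] := s'P w; rewrite h; last by move=> t1 Dt1 ft1; apply: nt; exists t1.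
have nDgw : ~ D (g w).
  move=> [[|n] [t0 [St0 nt0 gt]]]; first by apply: nt0; exists w.
  apply: nt; exists (iter n (g \o f) t0); first by exists n, t0.
  exact: ginj.
split; [exact: gS| |by left].
by have [_ /(_ (gS _ S'w) nDgw)[_ /ginj]] := sP (g w).
Qed.

Lemma prefix_nth (T : eqType) (x0 : T) (s t : seq T) :
  prefix s t <-> (size s <= size t)%N /\ forall j, (j < size s)%N -> nth x0 s j = nth x0 t j.
Proof.
split=> [/prefixP[w ->]|[st H]].
  by split=> [|j js]; rewrite ?size_cat ?leq_addr// nth_cat js.
apply/prefixP; exists (drop (size s) t); rewrite -[LHS](cat_take_drop (size s)); congr (_ ++ _).
apply: (@eq_from_nth _ x0); first by rewrite size_takel.
by move=> j; rewrite size_takel// => js; rewrite nth_take// H.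
Qed.

Section NodeShift.
Variable alpha : nat -> nat.

Lemma size_shift_node t : size (shift_node alpha t) = size t.
Proof. by rewrite size_mkseq. Qed.

Lemma nth_shift_node t j : (j < size t)%N -> nth (false, 0%N) (shift_node alpha t) j =
  ((nth (false, 0%N) t j).1, (nth (false, 0%N) t j).2 + alpha j)%N.
Proof. by move=> jt; rewrite nth_mkseq. Qed.

Lemma unzip1_shift_node t : unzip1 (shift_node alpha t) = unzip1 t.
Proof.
have sz : size (unzip1 (shift_node alpha t)) = size t by rewrite /unzip1 size_map size_shift_node.
apply: (@eq_from_nth _ false) => [|j]; rewrite sz ?size_map// => jt.
by rewrite !(nth_map (false, 0%N)) ?size_shift_node// nth_shift_node.
Qed.

Lemma prefix_shift_node s t : prefix (shift_node alpha s) (shift_node alpha t) <-> prefix s t.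
Proof.
rewrite !(prefix_nth (false, 0%N)) !size_shift_node; split=> -[st H]; split=> // j js.
  have := H j js; rewrite !nth_shift_node ?(leq_trans js)// => -[e1 /addIn e2].
  by rewrite [LHS]surjective_pairing e1 e2 -surjective_pairing.
by rewrite !nth_shift_node ?(leq_trans js)// H.
Qed.

Lemma shift_node_inj : injective (shift_node alpha).
Proof.
move=> s t st; have := prefix_shift_node s t; rewrite st prefix_refl => -[/(_ isT) h _].
have := congr1 size st; rewrite !size_shift_node => sz.
by move/prefixP: h => [w tw]; move: sz; rewrite tw size_cat -[LHS]addn0 => /addnI/esym/size0nil ->; rewrite cats0.
Qed.

Definition unshift_node (t : node) : option node :=
  if pselect (exists s, shift_node alpha s = t) is left e then Some (projT1 (cid e)) else None.

Lemma unshift_nodeP s t : unshift_node t = Some s <-> shift_node alpha s = t.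
Proof.
rewrite /unshift_node; case: pselect => [e|ne]; last by split=> // st; case: ne; exists s.
case: cid => w /= wt; split=> [[<-]//|st]; congr Some; apply: shift_node_inj.
by rewrite wt.
Qed.

End NodeShift.

Definition node_map (kappa : nat -> option nat) (psi : node -> option node) (i : nat) : option nat :=
  if @pickle_inv (nat * node)%type i is Some (c, t) then
    if kappa c is Some c' then omap (idx c') (psi t) else None
  else None.

Lemma node_mapP kappa psi i j : node_map kappa psi i = Some j <->
  exists c t c' t', [/\ i = idx c t, kappa c = Some c', psi t = Some t' & j = idx c' t'].
Proof.
rewrite /node_map; split=> [|[c [t [c' [t' [-> kc pt ->]]]]]]; last first.
  by rewrite /idx pickleK_inv kc pt.
have := @pickle_invK (nat * node)%type i; case: pickle_inv => [[c t]|//] /= <-.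
case kc: (kappa c) => [c'|//]; case pt: (psi t) => [t'|//] /= [<-].
by exists c, t, c', t'.
Qed.

Lemma admissible_pmap h p : (forall i j k, h i = Some k -> h j = Some k -> i = j) ->
  (forall c tau, p.1 = pickle tau -> chain_above c tau p.2 ->
     exists c', chain_above c' tau (pmap h p.2)) ->
  admissible p -> admissible (p.1, pmap h p.2).
Proof.
move=> hinj hchain [up sp ch]; split=> /=.
- elim: (p.2) up => //= i F IH /andP[iF /IH uF]; case hi: (h i) => [k|] //=.
  rewrite uF andbT; apply: contra iF; rewrite mem_pmap => /mapP[j jF hj].
  by rewrite (hinj _ _ _ hi (esym hj)).
- by apply: leq_trans sp; rewrite size_pmap; exact: count_size.
- case: ch => [|[c [tau [ptau ch]]]]; [by left|right].
  by have [c' ?] := hchain c tau ptau ch; exists c', tau.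
Qed.

(** Bits do not change, so blocks keep their [tau]; order is preserved, so chains remain chains; a
    whole block lies in one copy and moves to one copy. *)
Lemma node_map_embedding kappa psi :
  (forall a b c, kappa a = Some c -> kappa b = Some c -> a = b) ->
  (forall s t w, psi s = Some w -> psi t = Some w -> s = t) ->
  (forall t t', psi t = Some t' -> unzip1 t' = unzip1 t) ->
  (forall s t s' t', prefix s t -> psi s = Some s' -> psi t = Some t' -> prefix s' t') ->
  partial_embedding (node_map kappa psi).
Proof.
move=> kinj pinj punzip pprefix.
have hinj i j k : node_map kappa psi i = Some k -> node_map kappa psi j = Some k -> i = j.
  move=> /node_mapP[c [t [c' [t' [-> kc pt ->]]]]] /node_mapP[d [s [d' [s' [-> kd ps]]]]].
  rewrite /idx => /(pcan_inj pickleK)[ec et]; rewrite -ec in kd; rewrite -et in ps.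
  by rewrite (kinj _ _ _ kc kd) (pinj _ _ _ pt ps).
split=> // p; apply: admissible_pmap => // c tau ptau [ch1 ch2].
have src i : i \in pmap (node_map kappa psi) p.2 -> exists t c' t',
    [/\ idx c t \in p.2, kappa c = Some c', psi t = Some t' & i = idx c' t'].
  rewrite mem_pmap => /mapP[j jF /esym/node_mapP[d [t [c' [t' [ej kd pt ->]]]]]].
  have [s es _] := ch1 _ jF; move: jF; rewrite ej => jF.
  move: es; rewrite ej /idx => /(pcan_inj pickleK)[ed _]; rewrite -ed.
  by exists t, c', t'.
exists (odflt 0%N (kappa c)); split.
  move=> i /src[t [c' [t' [jF kc pt ->]]]]; rewrite kc /=; exists t' => //.
  have [s es ps] := ch1 _ jF; rewrite (punzip _ _ pt).
  by move: es; rewrite /idx => /(pcan_inj pickleK)[->].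
move=> s t /src[s0 [c1 [s1 [sF kc ps es]]]] /src[t0 [c2 [t1 [tF kc' pt et]]]].
move: es et; rewrite /idx => /(pcan_inj pickleK)[_ ->] /(pcan_inj pickleK)[_ ->].
have /orP[h|h] := ch2 _ _ sF tF; apply/orP; [left|right]; exact: pprefix h _ _.
Qed.

Lemma id_embedding : partial_embedding Some.
Proof.
split=> [i j k [->] [->]//|p ap].
by rewrite (_ : pmap Some p.2 = p.2) -?surjective_pairing//; elim: (p.2) => //= i F ->.
Qed.

Definition copy_down (c : nat) : option nat := if c is c'.+1 then Some c' else None.
Definition copy_zero (c : nat) : option nat := if c is 0%N then Some 0%N else None.

(** The elementary moves: identity, one copy down, one copy up, and inside copy 0 a translation or
    an inverse translation of nodes. *)
Definition piece_maps (alpha beta : nat -> nat) : seq (nat -> option nat) :=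
  [:: Some; node_map copy_down Some; node_map (Some \o S) Some;
      node_map copy_zero (Some \o shift_node alpha); node_map copy_zero (unshift_node beta)].

Lemma pieces_embedding alpha beta k : (k < 5)%N ->
  partial_embedding (nth Some (piece_maps alpha beta) k).
Proof.
have szero a b c : copy_zero a = Some c -> copy_zero b = Some c -> a = b by case: a b => [|a] [].
case: k => [|[|[|[|[|//]]]]] _ /=; first exact: id_embedding.
- apply: node_map_embedding; [|by move=> s t w [->] [->]|by move=> t t' [->]|by move=> s t s' t' st [<-] [<-]].
  by move=> [|a] [|b] c //= [->] [->].
- apply: node_map_embedding; [|by move=> s t w [->] [->]|by move=> t t' [->]|by move=> s t s' t' st [<-] [<-]].
  by move=> a b c /= [<-] [].
- apply: node_map_embedding => //=.
  + by move=> s t w [<-] [] /esym/shift_node_inj.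
  + by move=> t t' [<-]; exact: unzip1_shift_node.
  + by move=> s t s' t' st [<-] [<-]; apply/prefix_shift_node.
- apply: node_map_embedding => //=.
  + by move=> s t w /unshift_nodeP <- /unshift_nodeP.
  + by move=> t t' /unshift_nodeP <-; rewrite unzip1_shift_node.
  + by move=> s t s' t' + /unshift_nodeP es /unshift_nodeP et; rewrite -es -et => /prefix_shift_node.
Qed.

(** * Piecewise index maps: shifts and swaps of copies *)

Section PiecewiseMaps.
Variable R : realType.

(** The embeddings are split off one at a time, each contributing a contraction to the pullback. *)
Lemma pull_bounded_pieces (hs : nat -> nat -> option nat) n (h : nat -> option nat) :
  (forall k, (k < n)%N -> partial_embedding (hs k)) ->
  (forall i j, h i = Some j -> exists2 k, (k < n)%N & hs k i = Some j) ->
  pull_bounded R h n.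
Proof.
elim: n h => [|n IH] h hemb hh.
  move=> f K K0 fK; apply: (@tree_norm_le_mono _ _ (fun=> 0)).
    by move=> i; rewrite /pull; case hi: (h i) => [j|]//; have [] := hh _ _ hi.
  move=> P dP; rewrite mul0r expr0n /sqsum big1// => p _; rewrite /block big1 ?mulr0 ?expr0n//.
  by move=> i _; rewrite normr0.
pose h' i := if h i == hs n i then None else h i.
rewrite -addn1; apply: (@pull_boundedU _ _ h' (hs n)).
- apply: IH => [k kn|i j]; first by apply: hemb; rewrite ltnS ltnW.
  rewrite /h'; case: eqP => // hi hj; have [k kn hk] := hh _ _ hj.
  by exists k => //; move: kn; rewrite ltnS leq_eqVlt => /orP[/eqP kn|//]; case: hi; rewrite hj -kn hk.
- exact/partial_embedding_bounded/hemb.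
- by move=> i; rewrite /h'; case: eqP => [->|_]; [exact: Or33|exact: Or32].
Qed.

(** Numbers coding no pair are fixed, so that a bijection of pairs becomes a bijection of all
    indices. *)
Definition code_map (phi : nat -> node -> option (nat * node)) (i : nat) : option nat :=
  if @pickle_inv (nat * node)%type i is Some (c, t) then omap pickle (phi c t) else Some i.

Lemma code_map_idx phi c t : code_map phi (idx c t) = omap pickle (phi c t).
Proof. by rewrite /code_map /idx pickleK_inv. Qed.

Lemma code_mapP phi i j : code_map phi i = Some j ->
  (exists c t d u, [/\ i = idx c t, phi c t = Some (d, u) & j = idx d u]) \/
  (i = j /\ @pickle_inv (nat * node)%type i = None).
Proof.
rewrite /code_map; have := @pickle_invK (nat * node)%type i.
case: pickle_inv => [[c t] /= <-|_ [<-]]; last by right.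
by case E: (phi c t) => [[d u]|//] [<-]; left; exists c, t, d, u.
Qed.

Lemma code_map_inverse phi phi' i j :
  (forall c t d u, phi c t = Some (d, u) -> phi' d u = Some (c, t)) ->
  code_map phi i = Some j -> code_map phi' j = Some i.
Proof.
move=> H /code_mapP[[c [t [d [w [-> /H E ->]]]]]|[<- E]]; last by rewrite /code_map E.
by rewrite code_map_idx E.
Qed.

Lemma code_map_finite phi phi' :
  (forall c t d u, phi c t = Some (d, u) -> phi' d u = Some (c, t)) ->
  forall j, exists b, forall i, (b <= i)%N -> code_map phi i != Some j.
Proof.
move=> H j; case E: (code_map phi' j) => [i0|]; last first.
  by exists 0%N => i _; apply/eqP => /(code_map_inverse H); rewrite E.
exists i0.+1 => i bi; apply/eqP => /(code_map_inverse H); rewrite E => -[ei].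
by rewrite ei ltnn in bi.
Qed.

Lemma code_map_bounded alpha beta phi :
  (forall c t, [\/ phi c t = None, phi c t = Some (c, t) | exists k, (k < 4)%N /\
     code_map phi (idx c t) = nth Some (piece_maps alpha beta) k.+1 (idx c t)]) ->
  pull_bounded R (code_map phi) 5.
Proof.
move=> H; apply: (pull_bounded_pieces (hs := fun k => nth Some (piece_maps alpha beta) k)).
  exact: pieces_embedding.
move=> i j hi; have [[c [t [d [w [ei E ej]]]]]|[<- _]] := code_mapP hi; last by exists 0%N.
have [|e|[k [k4 ek]]] := H c t; first by rewrite E.
- by exists 0%N => //=; rewrite ej ei; move: E; rewrite e => -[<- <-].
- by exists k.+1 => //; rewrite ei -ek -ei.
Qed.

(** Named after the motion of entries: over [S], index (c + 1, t) reads (c, t), so entries move up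
    one copy and copy 0 is filled with zeros. *)
Definition up (S : node -> bool) (c : nat) (t : node) : option (nat * node) :=
  if S t then (if c is c'.+1 then Some (c', t) else None) else Some (c, t).

Definition down (S : node -> bool) (c : nat) (t : node) : option (nat * node) :=
  Some (if S t then c.+1 else c, t).

Lemma up_down S c t d w : up S c t = Some (d, w) -> down S d w = Some (c, t).
Proof.
by rewrite /up /down; case E: (S t); [case: c => //= c [<- <-]; rewrite E|move=> [<- <-]; rewrite E].
Qed.

Lemma down_up S c t d w : down S c t = Some (d, w) -> up S d w = Some (c, t).
Proof. by rewrite /up /down; case E: (S t) => -[<- <-]; rewrite E. Qed.

Lemma up_bounded S : pull_bounded R (code_map (up S)) 5.
Proof.
apply: (@code_map_bounded (fun=> 0%N) (fun=> 0%N)) => c t; rewrite code_map_idx /up.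
case: (S t); last exact: Or32.
by case: c => [|c]; [exact: Or31|apply: Or33; exists 0%N; rewrite /= /node_map pickleK_inv].
Qed.

Lemma down_bounded S : pull_bounded R (code_map (down S)) 5.
Proof.
apply: (@code_map_bounded (fun=> 0%N) (fun=> 0%N)) => c t; rewrite code_map_idx /down.
case: (S t); last exact: Or32.
by apply: Or33; exists 1%N; rewrite /= /node_map pickleK_inv.
Qed.

Definition up_map S := Pullback (@up_bounded S) (code_map_finite (@up_down S)).
Definition down_map S := Pullback (@down_bounded S) (code_map_finite (@down_up S)).

Section Swap.
Variables (S S' : node -> bool) (s : node -> node).

(** Index map of an automorphism carrying the position of [S'] to that of [S]. The parts missed by
    the two ranges, in copy 0, are matched by [s]; elsewhere the shift for [S'] is undone and that
    for [S] performed, a move by at most one copy. *)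
Definition swap (c : nat) (t : node) : option (nat * node) :=
  if S t then
    if c is c'.+1 then Some (if S' t then c else c', t) else Some (0%N, s t)
  else Some (if S' t then c.+1 else c, t).

Lemma swap_bounded alpha beta :
  (forall t, S t -> s t = shift_node alpha t \/ shift_node beta (s t) = t) ->
  pull_bounded R (code_map swap) 5.
Proof.
move=> H; apply: (@code_map_bounded alpha beta) => c t; rewrite code_map_idx /swap.
case E: (S t); last by case: (S' t); [apply: Or33; exists 1%N; rewrite /= /node_map pickleK_inv|exact: Or32].
case: c => [|c]; last by case: (S' t); [exact: Or32|apply: Or33; exists 0%N; rewrite /= /node_map pickleK_inv].
apply: Or33; case: (H t E) => [->|st]; [exists 2%N|exists 3%N]; rewrite /= /node_map pickleK_inv//.
by rewrite /= ((unshift_nodeP beta (s t) t).2 st).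
Qed.

End Swap.

Lemma swap_inverse (S S' : node -> bool) (s s' : node -> node) : (forall t, S t -> S' (s t) /\ s' (s t) = t) ->
  forall c t d w, swap S S' s c t = Some (d, w) -> swap S' S s' d w = Some (c, t).
Proof.
move=> H c t d w; rewrite /swap; case E: (S t); last first.
  by case E': (S' t) => -[<- <-]; rewrite E' E.
case: c => [[<- <-]|c]; first by have [-> ->] := H t E.
by case E': (S' t) => -[<- <-]; rewrite E' E.
Qed.

Lemma swap_total (S S' : node -> bool) (s : node -> node) c t : exists d w, swap S S' s c t = Some (d, w).
Proof.
rewrite /swap; case: (S t); last by eexists; eexists; reflexivity.
by case: c => [|c]; eexists; eexists; reflexivity.
Qed.

Lemma pull_opK phi phi' (h h' : pullback R) (v : tree_space R) :
  (forall i, h i = code_map phi i) -> (forall i, h' i = code_map phi' i) ->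
  (forall c t, exists d w, phi c t = Some (d, w)) ->
  (forall c t d u, phi c t = Some (d, u) -> phi' d u = Some (c, t)) ->
  pull_op h (pull_op h' v) = v.
Proof.
move=> hE hE' tot inv; apply: tree_space_ext => i; rewrite !pull_opE.
have [j ij] : exists j, h i = Some j.
  rewrite hE /code_map; case: pickle_inv => [[c t]|]; last by exists i.
  by have [d [w ->]] := tot c t; exists (idx d w).
rewrite ij pull_opE hE'; rewrite hE in ij.
by rewrite (code_map_inverse inv ij).
Qed.

End PiecewiseMaps.

(** * Positions attached to sets of nodes *)

Section Lift.
Variables (R : realType) (U : completeNormedModType R).
Local Notation W := (tree_space R).
Variables (V : {linear W -> U}) (Q : {linear U -> W}) (MV MQ : R).
Hypothesis QV : forall w, Q (V w) = w.
Hypothesis MV0 : 0 < MV.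
Hypothesis MQ0 : 0 < MQ.
Hypothesis V_bound : forall w, `|V w| <= MV * `|w|.
Hypothesis Q_bound : forall z, `|Q z| <= MQ * `|z|.

(** The pullback on the copy of [W] and the identity on the kernel of [Q]. *)
Definition lift_fun (h : pullback R) (z : U) : U := V (pull_op h (Q z)) + (z - V (Q z)).

Lemma lift_linear h : linear (lift_fun h).
Proof.
move=> a z w; rewrite /lift_fun (linearP Q) pull_op_linear !(linearP V).
by rewrite opprD [X in _ + X]addrACA [LHS]addrACA -scalerBr -scalerDr.
Qed.

Lemma lift_bounded h : exists M : R, forall z, `|lift_fun h z| <= M * `|z|.
Proof.
exists (MV * ((pbound h)%:R * MQ) + (1 + MV * MQ)) => z; rewrite /lift_fun.
have h1 := ler_normD (V (pull_op h (Q z))) (z - V (Q z)).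
have h2 := ler_normB z (V (Q z)).
have h3 := V_bound (pull_op h (Q z)); have h4 := V_bound (Q z); have h5 := Q_bound z.
have h6 := pull_op_norm h (Q z).
have h7 := ler_wpM2l (ltW MV0) h6; have h8 := ler_wpM2l (ltW MV0) h5.
have b0 : 0 <= MV * (pbound h)%:R :> R by rewrite mulr_ge0// ltW.
have h9 := ler_wpM2l b0 h5.
move: ((pbound h)%:R : R) h6 h7 b0 h9 => b *; lra.
Qed.

Definition lift_lin h : {linear U -> U} := HB.pack (lift_fun h) (GRing.isLinear.Build R U U _ (lift_fun h) (@lift_linear h)).
Definition lift h : bounded_op U U := @BoundedOp R U U (lift_lin h) (lift_bounded h).

Arguments lift : simpl never.

Lemma liftE h z : lift h z = V (pull_op h (Q z)) + (z - V (Q z)).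
Proof. by []. Qed.

Lemma Q_lift h z : Q (lift h z) = pull_op h (Q z).
Proof. by rewrite liftE linearD linearB !QV subrr addr0. Qed.

Lemma lift_lift h h' z : lift h (lift h' z) = V (pull_op h (pull_op h' (Q z))) + (z - V (Q z)).
Proof. by rewrite [LHS]liftE Q_lift liftE [X in _ + (X - _)]addrC addrK. Qed.

Definition position (S : node -> bool) : bounded_op U U := lift (up_map R S).
Definition coposition (S : node -> bool) : bounded_op U U := lift (down_map R S).
Definition position_projection (S : node -> bool) : bounded_op U U :=
  bop_comp (position S) (coposition S).

Arguments position : simpl never.
Arguments coposition : simpl never.

Lemma up_mapE S i : up_map R S i = code_map (up S) i.
Proof. by []. Qed.

Lemma down_mapE S i : down_map R S i = code_map (down S) i.
Proof. by []. Qed.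

Lemma pull_code_idx (h : pullback R) phi (v : W) c t : (forall i, h i = code_map phi i) ->
  pull_op h v (idx c t) = if phi c t is Some (d, w) then v (idx d w) else 0.
Proof. by move=> hE; rewrite pull_opE hE code_map_idx; case: (phi c t) => // -[]. Qed.

Lemma pull_down_up S (v : W) : pull_op (down_map R S) (pull_op (up_map R S) v) = v.
Proof.
apply: (pull_opK (phi := down S) (phi' := up S)) => //; last exact: down_up.
by move=> c t; rewrite /down; eexists; eexists; reflexivity.
Qed.

Lemma positionK S : cancel (position S) (coposition S).
Proof. by move=> z; rewrite lift_lift pull_down_up addrC subrK. Qed.

(* The coordinates [(0, t)] with [t] in [S]: what the range of [position S] misses. *)
Definition missing (S : node -> bool) (v : W) : W :=
  v - pull_op (up_map R S) (pull_op (down_map R S) v).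

Lemma missing_linear S : linear (missing S).
Proof. by move=> a v w; rewrite /missing !pull_op_linear scalerBr opprD addrACA. Qed.

Lemma missing_supp S v i : missing S v i != 0 -> exists2 t, S t & i = idx 0 t.
Proof.
rewrite /missing tree_spaceB pull_opE up_mapE; case E: (code_map (up S) i) => [j|].
  by rewrite pull_opE down_mapE (code_map_inverse (@up_down S) E) subrr eqxx.
move=> _; move: E; rewrite /code_map; have := @pickle_invK (nat * node)%type i.
case: pickle_inv => // -[c t] /= <-; rewrite /up; case St: (S t) => //.
by case: c => // _; exists t.
Qed.

Lemma missing_branch (S : node -> bool) t v : S t -> missing S v (idx 0 t) = v (idx 0 t).
Proof. by move=> St; rewrite /missing tree_spaceB pull_opE up_mapE code_map_idx /up St subr0. Qed.

Lemma missing_basis (S : node -> bool) t : S t -> missing S (tree_basis R (idx 0 t)) = tree_basis R (idx 0 t).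
Proof.
move=> St; apply: tree_space_ext => i; have [->|ni] := eqVneq i (idx 0 t).
  by rewrite missing_branch.
rewrite tree_basisE (negPf ni) /missing tree_spaceB tree_basisE (negPf ni) sub0r pull_opE.
rewrite up_mapE; case E: (code_map (up S) i) => [j|]; last by rewrite oppr0.
rewrite pull_opE down_mapE (code_map_inverse (@up_down S) E) tree_basisE.
by rewrite (negPf ni) oppr0.
Qed.

(** $26 = 1 + 5 \cdot 5$, from two maps made of five pieces each. *)
Lemma missing_bound S v : `|missing S v| <= 26 * `|v|.
Proof.
have h1 := ler_normB v (pull_op (up_map R S) (pull_op (down_map R S) v)).
have h2 := pull_op_norm (up_map R S) (pull_op (down_map R S) v).
have h3 := pull_op_norm (down_map R S) v; rewrite /= in h2 h3; rewrite /missing; lra.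
Qed.

Lemma missing_up S v : missing S (pull_op (up_map R S) v) = 0.
Proof. by rewrite /missing pull_down_up subrr. Qed.

Lemma position_decomposition S z :
  z = position S (coposition S z) + V (missing S (Q z)).
Proof.
by rewrite lift_lift /missing linearB -addrA subrKA addrC subrK.
Qed.

Lemma position_below S : exists2 c, 0 < c & strong_below (position S) c.
Proof.
have [M M0 LM] := bop_bound (coposition S); exists M^-1; first by rewrite invr_gt0.
by move=> z; rewrite mulrC ler_pdivrMr// mulrC -[X in `|X| <= _](positionK S z).
Qed.

(** Coordinates in copy 0 over [S] vanish on the range, so the corresponding basis vectors are
    independent modulo it. *)
Lemma position_codim (S : node -> bool) (t : nat -> node) : injective t -> (forall j, S (t j)) ->
  infinite_codim (range (position S)).
Proof.
move=> ti tS [n [w wP]].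
pose e (j : 'I_n.+1) := tree_basis R (idx 0 (t j)).
have /choice[f fP] : forall j : 'I_n.+1, exists xa : U * ('I_n -> R),
    V (e j) = position S xa.1 + \sum_(i < n) xa.2 i *: w i.
  by move=> j; have [_ [x _ <-] [_ [a ->] E]] := wP (V (e j)); exists (x, a).
have [s [s0 sM]] := left_kernel (\matrix_(j < n.+1, i < n) (f j).2 i).
have E : V (\sum_j s 0 j *: e j) = position S (\sum_j s 0 j *: (f j).1).
  transitivity (\sum_(j < n.+1) (s 0 j *: position S (f j).1 + \sum_(i < n) (s 0 j * (f j).2 i) *: w i)).
    rewrite linear_sum; apply: eq_bigr => j _; rewrite linearZ /= fP scalerDr scaler_sumr.
    by congr (_ + _); apply: eq_bigr => i _; rewrite scalerA.
  transitivity (\sum_(j < n.+1) s 0 j *: position S (f j).1 +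
      \sum_(j < n.+1) \sum_(i < n) (s 0 j * (f j).2 i) *: w i); first by rewrite big_split.
  rewrite [X in _ + X](_ : _ = 0) ?addr0.
    by rewrite linear_sum; apply: eq_bigr => j _; rewrite linearZ.
  rewrite exchange_big /= big1// => i _; rewrite -scaler_suml.
  have := congr1 (fun A : 'rV[R]_n => A 0 i) sM; rewrite !mxE.
  by under eq_bigr do rewrite mxE; move=> ->; rewrite scale0r.
move/eqP: s0; apply; apply/rowP => j; rewrite mxE.
have := congr1 (fun v : W => v (idx 0 (t j))) (congr1 Q E).
rewrite QV Q_lift pull_opE up_mapE code_map_idx /up tS tree_space_sum.
have ce l : (s 0 l *: e l) (idx 0 (t j)) = s 0 l * (l == j)%:R.
  rewrite tree_spaceZ tree_basisE; congr (_ * (nat_of_bool _)%:R).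
  by apply/eqP/eqP => [/idx_inj/ti/val_inj//|->].
under eq_bigr do rewrite ce.
rewrite (bigD1 j)//= eqxx mulr1 big1 ?addr0// => l /negPf ->.
by rewrite mulr0.
Qed.

Lemma position_Emb_c (u : nat -> U) (S : node -> bool) (t : nat -> node) :
  schauder_basis_of setT u -> injective t -> (forall j, S (t j)) ->
  Emb_c (position S, position_projection S).
Proof.
move=> ub ti tS; have [c c0 Tc] := position_below S.
have Ti := below_injective c0 Tc.
have rE : range (position S) = range (position_projection S).
  apply/seteqP; split=> [_ [z _ <-]|_ [z _ <-]]; last by exists (coposition S z).
  by exists (position S z) => //; rewrite bop_compE positionK.
split=> //=; first split.
- exact: below_isomorphism Tc.
- exact: below_closed Tc.
- exact: position_codim ti tS.
- split; first by move=> z; rewrite !bop_compE positionK.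
  rewrite -rE; exact: linear_injective_infinite_dim ub _ Ti.
Qed.

(** The pieces of the bijection are translations or their inverses, so the two swaps are bounded and
    mutually inverse; the relation between the positions is checked index by index. *)
Lemma swap_position (S S' : node -> bool) (s s' : node -> node) alpha beta :
  (forall t, S t -> [/\ S' (s t), s' (s t) = t & s t = shift_node alpha t \/ shift_node beta (s t) = t]) ->
  (forall t, S' t -> [/\ S (s' t), s (s' t) = t & s' t = shift_node beta t \/ shift_node alpha (s' t) = t]) ->
  position_equiv (position S) (position S').
Proof.
move=> Hs Hs'.
have b1 : pull_bounded R (code_map (swap S S' s)) 5.
  by apply: (@swap_bounded R S S' s alpha beta) => t /Hs[].
have b2 : pull_bounded R (code_map (swap S' S s')) 5.
  by apply: (@swap_bounded R S' S s' beta alpha) => t /Hs'[].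
have i1 : forall c t d w, swap S S' s c t = Some (d, w) -> swap S' S s' d w = Some (c, t).
  by apply: swap_inverse => t /Hs[].
have i2 : forall c t d w, swap S' S s' c t = Some (d, w) -> swap S S' s d w = Some (c, t).
  by apply: swap_inverse => t /Hs'[].
pose h1 := Pullback b1 (code_map_finite i1); pose h2 := Pullback b2 (code_map_finite i2).
exists (lift h1).
  by exists (lift h2); split=> z; rewrite lift_lift;
    [rewrite (pull_opK (phi := swap S' S s') (phi' := swap S S' s))|
     rewrite (pull_opK (phi := swap S S' s) (phi' := swap S' S s'))] => //;
    [rewrite addrC subrK|exact: swap_total|rewrite addrC subrK|exact: swap_total].
move=> z; rewrite lift_lift [LHS]liftE; congr (V _ + _).
have h1E i : h1 i = code_map (swap S S' s) i by [].
apply: tree_space_ext => i.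
case E: (@pickle_inv (nat * node)%type i) => [[c t]|]; last first.
  by rewrite !pull_opE up_mapE h1E /code_map E pull_opE up_mapE /code_map E.
have := @pickle_invK (nat * node)%type i; rewrite E /oapp -/(idx c t) => <-.
have upE S0 v d w := @pull_code_idx (up_map R S0) (up S0) v d w (up_mapE S0).
rewrite upE (pull_code_idx _ _ _ h1E) /up /swap; case St: (S t); last first.
  by case S't: (S' t); rewrite upE /up S't.
case: c {E} => [|c]; first by have [S'st _ _] := Hs t St; rewrite upE /up S'st.
by case S't: (S' t); rewrite upE /up S't.
Qed.

Lemma geometric_le1 (D : seq nat) : uniq D -> \sum_(i <- D) (2 ^+ i.+1)^-1 <= 1 :> R.
Proof.
move=> uD; pose n := (\max_(i <- D) i).+1.
have Dn i : i \in D -> (i < n)%N by move=> iD; rewrite ltnS /n (big_rem i iD) leq_maxl.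
have geo k : \sum_(i <- iota 0 k) (2 ^+ i.+1)^-1 = 1 - (2 ^+ k)^-1 :> R.
  elim: k => [|k IH]; first by rewrite big_nil expr0 invr1 subrr.
  rewrite -addn1 iotaD big_cat /= big_seq1 IH add0n addn1 exprS invfM.
  have : 0 < (2 ^+ k)^-1 :> R by rewrite invr_gt0 exprn_gt0.
  by move: ((2 ^+ k)^-1 : R) => a a0; lra.
apply: (@le_trans _ _ (\sum_(i <- iota 0 n) (2 ^+ i.+1)^-1)); last first.
  by rewrite geo gerBl invr_ge0 exprn_ge0.
have -> : \sum_(i <- D) (2 ^+ i.+1)^-1 = \sum_(i <- [seq i <- iota 0 n | i \in D]) (2 ^+ i.+1)^-1 :> R.
  apply/perm_big/uniq_perm => //; first by rewrite filter_uniq ?iota_uniq.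
  by move=> i; rewrite mem_filter mem_iota add0n; case: (boolP (i \in D)) => // /Dn ->.
rewrite big_filter big_mkcond; apply: ler_sum => i _.
by case: ifP => // _; rewrite invr_ge0 exprn_ge0.
Qed.

Let final_estimate (M N B : R) : 0 < M -> 0 < N -> 0 <= B ->
  N * (1 + B) <= (M + N + 2) * B + (M + N + 2).
Proof. by move=> M0 N0 B0; have h := mulr_ge0 (ltW M0) B0; lra. Qed.

(** * From an automorphism to a branch *)

Section Converse.
Variables (S S' : node -> bool) (y : nat -> bool) (A A' : bounded_op U U).
Hypothesis S_prefix : forall s t, prefix s t -> S t -> S s.
Hypothesis S'_branch : forall n, S' (mkseq (fun j => (y j, 0%N)) n).
Hypothesis AK : cancel A A'.
Hypothesis SA : forall z, position S z = A (position S' z).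

(** Compressions of [A] and its inverse to the missing parts. As [A] maps the range of [position S']
    onto that of [position S], they act modulo these ranges. *)
Let J w := missing S (Q (A (V w))).
Let K w := missing S' (Q (A' (V w))).

Let J_linear : linear J.
Proof. by move=> a v w; rewrite /J (linearP V) (linearP A) (linearP Q) missing_linear. Qed.

Let JL : {linear W -> W} := HB.pack J (GRing.isLinear.Build R W W _ J J_linear).

Let op_bounded (S0 : node -> bool) (B : bounded_op U U) : exists2 M : R, 0 < M &
  forall w, `|missing S0 (Q (B (V w)))| <= M * `|w|.
Proof.
have [M M0 BM] := bop_bound B; exists (26 * (MQ * (M * MV))); first by rewrite !mulr_gt0.
move=> w; apply: le_trans (missing_bound _ _) _; rewrite -!mulrA ler_pM2l//.
apply: le_trans (Q_bound _) _; rewrite ler_pM2l//; apply: le_trans (BM _) _.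
by rewrite ler_pM2l.
Qed.

(** Applying [A'] to the decomposition of [A (V w)] adds only a vector in the range of
    [position S'], which [missing S'] annihilates. *)
Let KJ w : missing S' w = w -> K (J w) = w.
Proof.
move=> mw; pose z := coposition S (A (V w)).
have e1 : A (V w) = position S z + V (J w) by exact: position_decomposition.
have e2 : V w = position S' z + A' (V (J w)).
  by rewrite -[LHS]AK e1 linearD SA AK.
have : missing S' (Q (V w)) = missing S' (Q (position S' z + A' (V (J w)))) by rewrite -e2.
have mD v v' : missing S' (v + v') = missing S' v + missing S' v'.
  by have := missing_linear S' 1 v v'; rewrite !scale1r.
by rewrite QV mw linearD Q_lift mD missing_up add0r => /esym.
Qed.

Let e i : W := tree_basis R (branch y i).

Let combination (D : seq nat) (eps : nat -> R) : W := \sum_(i <- D) eps i *: e i.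

Let combinationE D eps j : uniq D -> combination D eps j =
  \sum_(i <- D) eps i * (j == branch y i)%:R.
Proof.
by move=> _; rewrite /combination tree_space_sum; apply: eq_bigr => i _; rewrite tree_spaceZ tree_basisE.
Qed.

Let combination_branch D eps i : uniq D -> i \in D -> combination D eps (branch y i) = eps i.
Proof.
move=> uD iD; rewrite combinationE// (bigD1_seq i)//= eqxx mulr1 big1 ?addr0// => k ki.
by rewrite (inj_eq (@branch_inj y)) eq_sym (negPf ki) mulr0.
Qed.

Let combination_off D eps j : uniq D -> j \notin map (branch y) D -> combination D eps j = 0.
Proof.
move=> uD jD; rewrite combinationE// big_seq big1// => i iD.
by case: eqP => [ji|_]; rewrite ?mulr0//; move: jD; rewrite ji map_f.
Qed.

Let combination_le1 D eps : uniq D -> (forall i, `|eps i| <= 1) ->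
  (forall j, `|combination D eps j| <= 1) /\
  (forall j, combination D eps j != 0 -> j \in map (branch y) D).
Proof.
move=> uD e1; split=> j; have [/mapP[i iD ->]|jD] := boolP (j \in map (branch y) D).
- by rewrite combination_branch.
- by rewrite combination_off// normr0.
- by [].
- by rewrite combination_off// eqxx.
Qed.

Let missing_combination D eps : missing S' (combination D eps) = combination D eps.
Proof.
rewrite /combination; elim: D => [|i D IH].
  by rewrite big_nil; have := missing_linear S' (-1) 0 0; rewrite !scaleN1r !addNr.
rewrite big_cons missing_linear IH; congr (_ *: _ + _).
by apply: missing_basis; exact: S'_branch.
Qed.

(** Without such a branch the vectors [J (e i)] would contradict [no_branch_image]. They are
    truncated to finite supports with errors $2^{-(i+1)}$, so signed sums change by at most 1; upper
    estimates come from boundedness of [J], the lower one from [K] inverting [J] on the branch. *)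
Lemma position_branch : exists beta, forall n, S (mkseq (fun j => (y j, beta j)) n).
Proof.
apply: contrapT => nb.
have [M M0 JM] := op_bounded S A; have [N N0 KN] := op_bounded S' A'.
have d0 i : 0 < (2 ^+ i.+1)^-1 :> R by rewrite invr_gt0 exprn_gt0.
have /choice[n nP] : forall i, exists n, `|J (e i) - series (lincomb (J (e i)) (tree_basis R)) n| <= (2 ^+ i.+1)^-1.
  move=> i; have [n /(_ n (leqnn n)) h] := (cvg_seqP _ _).1 (@cvg_tree_basis R (J (e i))) _ (d0 i).
  by exists n.
pose g i : W := series (lincomb (J (e i)) (tree_basis R)) (n i).
have gJ D eps : uniq D -> (forall i, `|eps i| <= 1) ->
    `|J (combination D eps) - \sum_(i <- D) eps i *: g i| <= 1.
  move=> uD e1; rewrite -[J _]/(JL _) /combination linear_sum -sumrB.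
  apply: le_trans (geometric_le1 uD); apply: le_trans (ler_norm_sum _ _ _) _; apply: ler_sum => i _.
  rewrite linearZ -scalerBr normrZ -[leRHS]mul1r; apply: ler_pM => //; exact: nP.
have gE D eps j : \sum_(i <- D) eps i * g i j = (\sum_(i <- D) eps i *: g i) j.
  by rewrite tree_space_sum; apply: eq_bigr => i _; rewrite tree_spaceZ.
(* One constant for all hypotheses: [M] and [N] bound [J] and [K], and the summand 2 helps to absorb
   the truncation errors. *)
pose C := M + N + 2.
have sum_le D eps (B : R) : uniq D -> (forall i, `|eps i| <= 1) -> 0 <= B ->
    tree_norm_le (combination D eps) B ->
    tree_norm_le (fun j => \sum_(i <- D) eps i * g i j) (C * B + C).
  move=> uD e1 B0 cB.
  apply: (tree_norm_le_mono (g := \sum_(i <- D) eps i *: g i)); first by move=> j; rewrite gE.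
  apply: (tree_norm_le_trans (tree_norm_ge0 _) _ (tree_normP _)); rewrite -tree_space_normE.
  have h1 : `|combination D eps| <= B by exact: tree_norm_leP.
  have h2 := JM (combination D eps); have h3 := gJ D eps uD e1.
  have h4 := ler_normB (J (combination D eps)) (J (combination D eps) - \sum_(i <- D) eps i *: g i).
  rewrite opprB addrC subrK in h4; apply: le_trans h4 _; apply: le_trans (lerD h2 h3) _.
  have h5 := ler_wpM2l (ltW M0) h1; have h6 := mulr_ge0 (ltW N0) B0; rewrite /C; lra.
apply: (@no_branch_image R y (fun t => S t) (fun i => g i) C n).
- rewrite /C; lra.
- exact: S_prefix.
- move=> beta; apply: contrapT => H; apply: nb; exists beta => k.
  by apply: contrapT => Hk; apply: H; exists k.
- move=> i j; rewrite series_tree_basisE; case: ltnP => // _; last by rewrite eqxx.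
  by move=> /missing_supp.
- move=> i; apply: (tree_norm_le_trans (tree_norm_ge0 _) _ (tree_normP _)); rewrite -tree_space_normE.
  have h1 := ler_normB (J (e i)) (J (e i) - g i); rewrite opprB addrC subrK in h1.
  have h2 := JM (e i); rewrite (tree_basis_normalized R) mulr1 in h2.
  have h3 : (2 ^+ i.+1)^-1 <= 1 :> R.
    by rewrite invf_le1 ?exprn_gt0// exprn_ege1// ler1n.
  apply: le_trans h1 _; apply: le_trans (lerD h2 (le_trans (nP i) h3)) _; rewrite /C; lra.
- move=> m D eps uD sD e1; apply: sum_le => //.
  by have [h1 h2] := combination_le1 uD e1; exact: branch_norm_le uD sD h1 h2.
- move=> m tau D eps uD sD e1 mt tx; apply: sum_le => //.
  by have [h1 h2] := combination_le1 uD e1; exact: branch_norm_off_le uD sD h1 h2 mt tx.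
- move=> m l D B uD sD ml Dl B0 gB.
  have e1 (i : nat) : `|1 : R| <= 1 by rewrite normr1.
  have h0 : tree_norm_le (\sum_(i <- D) 1 *: g i) B.
    by apply: tree_norm_le_mono gB => j; rewrite -gE; under eq_bigr do rewrite mul1r.
  have h1 : `|\sum_(i <- D) 1 *: g i| <= B by exact: tree_norm_leP.
  have h2 := gJ D (fun=> 1) uD e1.
  have h3 := KN (J (combination D (fun=> 1))).
  rewrite -/(K _) KJ ?missing_combination// in h3.
  have h4 := ler_normD (J (combination D (fun=> 1)) - \sum_(i <- D) 1 *: g i) (\sum_(i <- D) 1 *: g i).
  rewrite subrK in h4.
  apply: (@le_trans _ _ `|combination D (fun=> 1)|); last first.
    apply: le_trans h3 _; apply: le_trans (ler_wpM2l (ltW N0) (le_trans h4 (lerD h2 h1))) _.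
    exact: final_estimate.
  apply: (le_branch_norm uD sD ml Dl) => //.
  apply: (tree_norm_le_mono (g := combination D (fun=> 1))); last exact: tree_normP.
  move=> j; have [/mapP[i iD ->]|jD] := boolP (j \in map (branch y) D).
    by rewrite combination_branch.
  by rewrite normr0.
Qed.

End Converse.

(** * Measurable dependence on the set of nodes *)

Section MeasurableLift.
Variables (u : nat -> U) (h : (node -> bool) -> pullback R).
Hypothesis u1 : normalized u.
Hypothesis ub : schauder_basis_of setT u.
Hypothesis h_bound : forall S, pbound (h S) = 5%N.
Hypothesis h_local : forall n, exists k, forall (S S' : node -> bool) i j,
  (forall t, (pickle t < k)%N -> S t = S' t) -> h S i = Some j -> (j < n)%N -> h S' i = Some j.

(** Locality is indexed by the target [j], since a vector supported below [n] is read only through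
    targets below [n]. Truncating [w] within [d / 10] costs five times that for each of the two
    pullbacks. *)
Lemma pull_op_local (w : W) (d : R) : 0 < d -> exists k, forall S S' : node -> bool,
  (forall t, (pickle t < k)%N -> S t = S' t) -> `|pull_op (h S) w - pull_op (h S') w| <= d.
Proof.
move=> d0; have [|n /(_ n (leqnn n)) wn] := (cvg_seqP _ _).1 (@cvg_tree_basis R w) (d / 10).
  by rewrite divr_gt0.
set v := series _ n in wn.
have [k hk] := h_local n; exists k => S S' SS'.
have vE : pull_op (h S) v = pull_op (h S') v.
  apply: tree_space_ext => i; rewrite !pull_opE.
  have half (S1 S2 : node -> bool) : (forall t, (pickle t < k)%N -> S1 t = S2 t) ->
      forall j, h S1 i = Some j -> v j != 0 -> h S2 i = Some j.
    move=> S12 j hj; rewrite series_tree_basisE; case: ltnP => [jn _|_]; last by rewrite eqxx.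
    exact: hk S12 hj jn.
  have h1 := half S S' SS'; have h2 := half S' S (fun t tk => esym (SS' t tk)).
  case E1: (h S i) => [j|]; case E2: (h S' i) => [j'|] //.
  - have [vj|/(h1 _ E1)] := eqVneq (v j) 0; last by rewrite E2 => -[->].
    by have [vj'|/(h2 _ E2)] := eqVneq (v j') 0; [rewrite vj vj'|rewrite E1 => -[->]].
  - by have [//|/(h1 _ E1)] := eqVneq (v j) 0; rewrite E2.
  - by have [//|/(h2 _ E2)] := eqVneq (v j') 0; rewrite E1.
have lin S0 : pull_op (h S0) w = pull_op (h S0) (w - v) + pull_op (h S0) v.
  by have := pull_op_linear (h S0) 1 (w - v) v; rewrite !scale1r subrK.
rewrite (lin S) (lin S') vE opprD addrACA subrr addr0.
have b1 := pull_op_norm (h S) (w - v); have b2 := pull_op_norm (h S') (w - v).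
rewrite !h_bound in b1 b2; apply: le_trans (ler_normB _ _) _; lra.
Qed.

(** Up to a small error the value at a rational vector depends on finitely many memberships, so the
    set is a countable union over finite patterns [l]. *)
Lemma measurable_lift d (Om : measurableType d) (S_ : Om -> node -> bool) :
  (forall t, measurable [set w | S_ w t]) -> measurable_fun setT (fun w => lift (h (S_ w))).
Proof.
move=> mS; apply: (measurable_bop u1 ub) => a b q.
set z := rcomb u a; set z0 := rcomb u b.
pose bitset (l : seq bool) : node -> bool := fun t => nth false l (pickle t).
rewrite (_ : [set w | _] = [set w | exists (k j : nat) (l : seq bool),
    (forall S S' : node -> bool, (forall t, (pickle t < k)%N -> S t = S' t) ->
       `|lift (h S) z - lift (h S') z| <= recip R j) /\
    (forall t, (pickle t < k)%N -> (S_ w t <-> bitset l t)) /\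
    `|lift (h (bitset l)) z - z0| < ratr q - recip R j]).
  do 3!apply: measurable_exists => ?; apply: measurable_and; first exact: measurable_const.
  apply: measurable_and; last exact: measurable_const.
  apply: measurable_forall => t; apply: measurable_imply; first exact: measurable_const.
  by apply: measurable_iff; [exact: mS|exact: measurable_const].
apply/seteqP; split=> [w /= hw|w /= [k [j [l [loc [Sl hl]]]]]]; last first.
  have := loc (S_ w) (bitset l); have eS t : (pickle t < k)%N -> S_ w t = bitset l t.
    by move=> /Sl h'; apply/idP/idP => /h'.
  move=> /(_ eS) h1.
  have := ler_normD (lift (h (S_ w)) z - lift (h (bitset l)) z) (lift (h (bitset l)) z - z0).
  by rewrite subrKA; hide_ratr; lra.
have [|j /(_ j (leqnn j)) jw] := @recip_small R ((ratr q - `|lift (h (S_ w)) z - z0|) / 2).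
  by rewrite divr_gt0// subr_gt0.
have [k hk] := pull_op_local (Q z) (divr_gt0 (recip_gt0 R j) MV0).
have loc (S S' : node -> bool) : (forall t, (pickle t < k)%N -> S t = S' t) ->
    `|lift (h S) z - lift (h S') z| <= recip R j.
  move=> /hk SS'; rewrite !liftE opprD addrACA subrr addr0 -linearB.
  by apply: le_trans (V_bound _) _; rewrite mulrC -ler_pdivlMr.
pose l := mkseq (fun i => if @unpickle node i is Some t then S_ w t else false) k.
have lE t : (pickle t < k)%N -> bitset l t = S_ w t.
  by move=> tk; rewrite /bitset nth_mkseq// pickleK.
exists k, j, l; split=> //; split; first by move=> t /lE ->.
have := loc (bitset l) (S_ w) lE.
have := ler_normD (lift (h (bitset l)) z - lift (h (S_ w)) z) (lift (h (S_ w)) z - z0).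
by rewrite subrKA; move: jw; hide_ratr; lra.
Qed.

End MeasurableLift.

(** Nodes are not moved, so a target [j] already names the node whose membership matters. *)
Lemma code_map_local (phi : (node -> bool) -> nat -> node -> option (nat * node)) :
  (forall S c t d w, phi S c t = Some (d, w) -> t = w) ->
  (forall (S S' : node -> bool) c t, S t = S' t -> phi S c t = phi S' c t) ->
  forall n, exists k, forall (S S' : node -> bool) i j,
  (forall t, (pickle t < k)%N -> S t = S' t) ->
  code_map (phi S) i = Some j -> (j < n)%N -> code_map (phi S') i = Some j.
Proof.
move=> phi_node phi_loc n.
pose v j := if @pickle_inv (nat * node)%type j is Some (d, w) then (pickle w).+1 else 0%N.
exists (\max_(j < n) v j) => S S' i j SS' hj jn.
have [[c [t [d [w [ei E ej]]]]]|[<- E]] := code_mapP hj; last by rewrite /code_map E.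
rewrite ei ej code_map_idx -(phi_loc S) ?E// SS'// (phi_node _ _ _ _ _ E).
have := @leq_bigmax_cond _ predT (fun j : 'I_n => v j) (Ordinal jn) isT.
by rewrite /= /v ej /idx pickleK_inv.
Qed.

Lemma measurable_position (u : nat -> U) d (Om : measurableType d) (S_ : Om -> node -> bool) :
  normalized u -> schauder_basis_of setT u -> (forall t, measurable [set w | S_ w t]) ->
  measurable_fun setT (fun w => position (S_ w)).
Proof.
move=> u1 ub mS; apply: (measurable_lift (h := fun S => up_map R S) u1 ub) => //.
apply: (code_map_local (phi := up)) => [S c t d' w|S S' c t e]; rewrite /up.
  by case: (S t); [case: c => // c [_ ->]|move=> [_ ->]].
by rewrite e.
Qed.

Lemma measurable_coposition (u : nat -> U) d (Om : measurableType d) (S_ : Om -> node -> bool) :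
  normalized u -> schauder_basis_of setT u -> (forall t, measurable [set w | S_ w t]) ->
  measurable_fun setT (fun w => coposition (S_ w)).
Proof.
move=> u1 ub mS; apply: (measurable_lift (h := fun S => down_map R S) u1 ub) => //.
by apply: (code_map_local (phi := down)) => [S c t d' w [_ ->]//|S S' c t e]; rewrite /down e.
Qed.

End Lift.

(** * The Borel reduction *)

Section Reduction.
Variables (R : realType) (U : completeNormedModType R) (u : nat -> U) (k : nat -> nat).
Hypothesis u1 : normalized u.
Hypothesis ub : unconditional_basis_of setT u.
Hypothesis kmono : {homo k : m n / (m < n)%N}.
Hypothesis ke : equivalent_sequences (@tree_basis R) (u \o k).
Local Notation W := (tree_space R).

Let V : {linear W -> U} := HB.pack (copy u k) (GRing.isLinear.Build R W U _ (copy u k) (copy_linear ke)).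
Let Q : {linear U -> W} :=
  HB.pack (cocopy ub kmono ke) (GRing.isLinear.Build R U W _ (cocopy ub kmono ke) (cocopy_linear ub kmono ke)).

Context d (E : measurableType d) (D : set E) (r : E -> E -> Prop).
Hypothesis Dr : analytic_equivalence R D r.

Lemma measurable_chain_tree C (f : E -> nat -> bool) t :
  (forall n, measurable [set x | f x n]) -> measurable [set x | `[< chain_tree C (f x) t >]].
Proof.
move=> mf; rewrite (_ : [set x | _] = [set x | exists b : seq bool,
    (forall i, (i < size t)%N -> (f x i <-> nth false b i)) /\ chain_tree C (nth false b) t]).
  apply: measurable_exists => b; apply: measurable_and; last exact: measurable_const.
  apply: measurable_forall => i; apply: measurable_imply; first exact: measurable_const.
  by apply: measurable_iff; [exact: mf|exact: measurable_const].
have agr (a a' : nat -> bool) : agree (size t) a a' -> chain_tree C a t -> chain_tree C a' t.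
  by move=> aa' h; apply: chain_agree_le h _ _ _ _ _ _.
apply/seteqP; split=> x /=.
  move=> /asboolP xt; exists (mkseq (f x) (size t)); split=> [i it|]; first by rewrite nth_mkseq.
  by apply: agr xt => i it; rewrite nth_mkseq.
move=> [b [xb bt]]; apply/asboolP; apply: agr bt => i it.
by apply/idP/idP => /(xb i it).
Qed.

(** Symmetry of [r] enters twice: it supplies translations both ways for Cantor-Bernstein, and in
    the converse the branch found in the tree of [x] lies over the code of [y], which yields
    [r y x]. *)
Lemma reduction_exists : exists rho : E -> bounded_op U U * bounded_op U U,
  [/\ forall x, Emb_c (rho x), measurable_fun setT rho
    & forall x y, D x -> D y -> (r x y <-> position_equiv (rho x).1 (rho y).1)].
Proof.
have [[_ [rxx rsym rtr]] _] := Dr.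
have [f [C [mf rE]]] := analytic_chain Dr.
have [MV MV0 Vb] : exists2 M, 0 < M & forall w, `|V w| <= M * `|w| := copy_bounded u1 ub kmono ke.
have [MQ MQ0 Qb] : exists2 M, 0 < M & forall z, `|Q z| <= M * `|z| := cocopy_bounded u1 ub kmono ke.
have QV w : Q (V w) = w by exact: copyK.
pose S x t := `[< chain_tree C (f x) t >].
have mS t : measurable [set x | S x t] by exact: measurable_chain_tree.
have Sself x n : S x (mkseq (fun i => (f x i, 0%N)) n) by apply/asboolP; exact: chain_tree_self.
pose T x := @position R U V Q MV MQ MV0 Vb Qb (S x).
pose L x := @coposition R U V Q MV MQ MV0 Vb Qb (S x).
exists (fun x => (T x, bop_comp (T x) (L x))); split.
(* The initial segments of the zero branch are infinitely many nodes of the tree, whence infinite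
   codimension. *)
- move=> x; apply: (position_Emb_c QV MV0 Vb Qb ub.1 (t := fun n => mkseq (fun i => (f x i, 0%N)) n)).
    by move=> m n /(congr1 size); rewrite !size_mkseq.
  exact: Sself.
- have m1 : measurable_fun setT T by exact: measurable_position u1 ub.1 mS.
  have m2 : measurable_fun setT L by exact: measurable_coposition u1 ub.1 mS.
  by apply: measurable_fun_pair => //; exact: (measurable_bop_comp u1 ub.1).
- move=> x y Dx Dy; split=> /= [rxy|[A [A' [AK A'K]] TA]].
    have [alpha xy] := (rE x y Dx Dy).1 rxy.
    have [beta yx] := (rE y x Dy Dx).1 (rsym _ _ Dx Dy rxy).
    have [|||| s [s' [Hs Hs']]] := @cantor_bernstein_pieces node (S x) (S y) (shift_node alpha) (shift_node beta).
    + by move=> t /asboolP xt; apply/asboolP; exact: chain_tree_shift xt.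
    + by move=> t /asboolP yt; apply/asboolP; exact: chain_tree_shift yt.
    + exact: shift_node_inj.
    + exact: shift_node_inj.
    exact: (swap_position QV MV0 Vb Qb Hs Hs').
  apply: rsym => //; apply/rE => //.
  have [|beta Hbeta] := position_branch QV MQ0 _ (Sself y) AK TA.
    by move=> s t st /asboolP xt; apply/asboolP; exact: chain_tree_prefix xt.
  by exists beta; apply/chain_tree_branch => n; exact/asboolP/Hbeta.
Qed.

End Reduction.

(** * Completeness of both relations *)

Section Complexity.
Variables (R : realType).

Lemma complete_complexity d (E : measurableType d) (D : set E) r :
  complete_analytic_equivalence R D r -> has_complexity_Emax R D r.
Proof.
move=> cr; have [[sr _] _] := cr.
have Dself : borel_reducible R D r D r by split=> //; exists id; split.
by exists d, E, D, r.
Qed.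

End Complexity.

Theorem proposition2p15 (R : realType) (U : completeNormedModType R)
    (hU : pelczynski_universal_unconditional U) :
  has_complexity_Emax R (@Emb R U U) (@position_equiv R U U) /\
  has_complexity_Emax R (@Emb_c R U U) (@position_equiv_c R U U).
Proof.
(* Universality enters here: it places the tree basis along a subsequence [k] of the basis of
   [U]. *)
have [u [[u1 ub] /(_ _ _ (tree_basis_unconditional R))[k [kmono ke]]]] := hU.
have aE := analytic_Emb u1 ub.1; have aEc := analytic_Emb_c u1 ub.1.
split; apply: complete_complexity; split=> // d' E C r Cr;
  have [rho [rhoE mrho rhoP]] := reduction_exists u1 ub kmono ke Cr.
- split; [by case: Cr|by case: aE|exists (fst \o rho); split=> //].
    by move=> x _; have [] := rhoE x.
  by apply: measurable_funTS; exact: measurableT_comp.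
- split; [by case: Cr|by case: aEc|exists rho; split=> //].
  by apply: measurable_funTS.
Qed.
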